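(* Let $E$ and $F$ be symmetric sequence spaces. If $E$ is $2$-convex, $F$ is $2$-concave and $1\le q\le2\le p\le\infty$, then $\mathcal M(E,F)=\mathcal M(p,q)$.
   Context: Sequences and matrices have entries in a fixed field $\mathbb K$ ($\mathbb R$ or $\mathbb C$). $c_0$ is the space of sequences converging to zero; for $x\in c_0$, $|x|=(|x_i|)_{i\ge1}$ and $x^*$ is the non-increasing rearrangement of $|x|$. A symmetric sequence space is a linear subspace $E\subset c_0$ with a complete norm such that: (i) if $y\in E$, $x\in c_0$ and $|x|\le|y|$ coordinatewise, then $x\in E$ and $\|x\|\le\|y\|$; (ii) if $x\in E$, $x'\in c_0$ and $(x')^*=x^*$, then $x'\in E$ and $\|x'\|=\|x\|$; normalised so that $\|(1,0,0,\dots)\|=1$. $E$ is $2$-convex if there is $C>0$ with $\|(\sum_{k=1}^n|x_k|^2)^{1/2}\|_E\le C(\sum_{k=1}^n\|x_k\|_E^2)^{1/2}$ for all finite families $x_1,\dots,x_n\in E$, and $2$-concave if there is $C>0$ with $(\sum_{k=1}^n\|x_k\|_E^2)^{1/2}\le C\|(\sum_{k=1}^n|x_k|^2)^{1/2}\|_E$ for all such families (operations coordinatewise). For sequence spaces $X,Y$ (symmetric sequence spaces, or $l_r$ with $1\le r\le\infty$), $B(X,Y)$ is the space of bounded linear operators $X\to Y$, identified with infinite matrices $A=(a_{ij})_{i,j\ge1}$ acting by $A(x)=(\sum_j a_{ij}x_j)_i$. The Schur product of matrices is $A*B=(a_{ij}b_{ij})$. $\mathcal M(X,Y)$ is the set of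 all infinite matrices $M$ with $M*A\in B(X,Y)$ for every $A\in B(X,Y)$, and $\mathcal M(p,q):=\mathcal M(l_p,l_q)$. The equality is an equality of sets of matrices. *)

(* Defs.v *)
From HB Require Import structures.
From mathcomp Require Import all_boot all_order all_algebra.
From mathcomp Require Import complex.
From mathcomp Require Import all_classical all_reals all_analysis.

Set Implicit Arguments.
Unset Strict Implicit.
Unset Printing Implicit Defensive.

Import Order.TTheory GRing.Theory Num.Theory.
Import numFieldNormedType.Exports.

Local Open Scope classical_set_scope.
Local Open Scope ring_scope.

Inductive scalars := RealScalars | ComplexScalars.

Definition scalar_field (R : realType) (k : scalars) : numFieldType :=
  match k with
  | RealScalars => R
  | ComplexScalars => R[i]
  end.

(* The order norm of [R[i]] takes its values in [R[i]]; here the modulus of a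
   scalar is an element of [R]. *)
Definition modulus (R : realType) (k : scalars) : scalar_field R k -> R :=
  match k with
  | RealScalars => fun x : R => `|x|
  | ComplexScalars => fun z : R[i] => Normc.normc z
  end.

Definition of_real (R : realType) (k : scalars) : R -> scalar_field R k :=
  match k with
  | RealScalars => fun x : R => x
  | ComplexScalars => fun x : R => (x%:C)%C
  end.

(* All sequences and matrices are indexed from 0. *)
Notation sequence R k := (nat -> scalar_field R k).
Notation matrix_oo R k := (nat -> nat -> scalar_field R k).

Definition c0 (R : realType) (k : scalars) : set (sequence R k) :=
  [set x | x @ \oo --> (0 : scalar_field R k)].

(* Inverse of the distribution function: for [x] in [c0], [rearrangement x n] is
   the (n+1)-th largest of the numbers [modulus (x i)], counted with
   multiplicity. *)
Definition rearrangement (R : realType) (k : scalars) (x : sequence R k)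
    (n : nat) : R :=
  inf [set t : R | 0 <= t /\ ([set i | t < modulus (x i)] #<= `I_n)%card].

(* The values of [seq_norm] outside [carrier] are irrelevant. *)
Record seq_space (R : realType) (k : scalars) := SeqSpace {
  carrier : set (sequence R k);
  seq_norm : sequence R k -> R }.

Record symmetric_space (R : realType) (k : scalars) (E : seq_space R k) :
    Prop := SymmetricSpace {
  sym_c0 : carrier E `<=` @c0 R k;
  sym_0 : carrier E (fun=> 0);
  sym_add : forall x y, carrier E x -> carrier E y ->
    carrier E (fun i => x i + y i);
  sym_scale : forall a x, carrier E x -> carrier E (fun i => a * x i);
  sym_norm_eq0 : forall x, carrier E x -> seq_norm E x = 0 -> x = (fun=> 0);
  sym_norm_triangle : forall x y, carrier E x -> carrier E y ->
    seq_norm E (fun i => x i + y i) <= seq_norm E x + seq_norm E y;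
  sym_norm_scale : forall a x, carrier E x ->
    seq_norm E (fun i => a * x i) = modulus a * seq_norm E x;
  sym_complete : forall u : nat -> sequence R k,
    (forall n, carrier E (u n)) ->
    (forall e : R, 0 < e -> exists N, forall m n, (N <= m)%N -> (N <= n)%N ->
       seq_norm E (fun i => u m i - u n i) < e) ->
    exists2 x, carrier E x &
      (fun n => seq_norm E (fun i => u n i - x i)) @ \oo --> (0 : R);
  sym_solid : forall x y, carrier E y -> c0 x ->
    (forall i, modulus (x i) <= modulus (y i)) ->
    carrier E x /\ seq_norm E x <= seq_norm E y;
  sym_rearrangement : forall x x', carrier E x -> c0 x' ->
    rearrangement x' = rearrangement x ->
    carrier E x' /\ seq_norm E x' = seq_norm E x;
  sym_unit_mem : carrier E (fun i => (i == 0%N)%:R);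
  sym_unit_norm : seq_norm E (fun i => (i == 0%N)%:R) = 1 }.

Definition square_function (R : realType) (k : scalars) (n : nat)
    (x : 'I_n -> sequence R k) : sequence R k :=
  fun i => of_real k (Num.sqrt (\sum_(j < n) modulus (x j i) ^+ 2)).

Definition two_convex (R : realType) (k : scalars) (E : seq_space R k) : Prop :=
  exists2 C : R, 0 < C &
    forall (n : nat) (x : 'I_n -> sequence R k), (forall j, carrier E (x j)) ->
      seq_norm E (square_function x)
        <= C * Num.sqrt (\sum_(j < n) seq_norm E (x j) ^+ 2).

Definition two_concave (R : realType) (k : scalars) (E : seq_space R k) : Prop :=
  exists2 C : R, 0 < C &
    forall (n : nat) (x : 'I_n -> sequence R k), (forall j, carrier E (x j)) ->
      Num.sqrt (\sum_(j < n) seq_norm E (x j) ^+ 2)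
        <= C * seq_norm E (square_function x).

Definition ell_norm (R : realType) (k : scalars) (r : \bar R)
    (x : sequence R k) : \bar R :=
  Lnorm (@counting nat R) r (fun i => (modulus (x i))%:E).

Definition ell (R : realType) (k : scalars) (r : \bar R) : seq_space R k :=
  SeqSpace [set x : sequence R k | (ell_norm r x < +oo)%E]
           (fun x => fine (ell_norm r x)).

Definition mx_series (R : realType) (k : scalars) (A : matrix_oo R k)
    (x : sequence R k) (i : nat) : sequence R k :=
  series (fun j => A i j * x j).

Definition mx_apply (R : realType) (k : scalars) (A : matrix_oo R k)
    (x : sequence R k) : sequence R k :=
  fun i => limn (mx_series A x i).

Definition bounded_operators (R : realType) (k : scalars) (X Y : seq_space R k) :
    set (matrix_oo R k) :=
  [set A | (forall x, carrier X x ->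
             (forall i, cvgn (mx_series A x i)) /\ carrier Y (mx_apply A x)) /\
           (exists C : R, forall x, carrier X x ->
             seq_norm Y (mx_apply A x) <= C * seq_norm X x)].

Definition schur_product (R : realType) (k : scalars) (A B : matrix_oo R k) :
    matrix_oo R k :=
  fun i j => A i j * B i j.

Definition schur_multipliers (R : realType) (k : scalars) (X Y : seq_space R k) :
    set (matrix_oo R k) :=
  [set M | forall A, bounded_operators X Y A ->
             bounded_operators X Y (schur_product M A)].

(* Main.v *)
Require Import Defs.
From HB Require Import structures.
From mathcomp Require Import all_boot all_order all_algebra.
From mathcomp Require Import finmap complex ring lra.
From mathcomp Require Import all_classical all_reals all_analysis ess_sup_inf.

(** Both sides of the theorem describe the same set of matrices, which does not
    depend on the spaces: a matrix is a Schur multiplier from a 2-convex space X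
    to a 2-concave space Y exactly when its finite sections are uniformly
    bounded as Schur multipliers on l_2 ([schur_multipliersP]).  The pairs
    (E, F) and (l_p, l_q) with q <= 2 <= p are two instances.

    On n coordinates, a 2-convex lattice norm N is equivalent to the supremum of
    the weighted Hilbert norms (sum_i phi_i |w_i|^2)^(1/2), where phi runs over
    the compact convex set of the weights that stay below N
    ([exists_norming_weight]).  The dual of a 2-concave norm is 2-convex
    ([dual_norm_convex2]), so an operator from X to Y is a bilinear form on a
    product of two 2-convex spaces, and a diagonal change of variables
    A |-> D A D' commutes with Schur multiplication.

    - From l_2 to (X, Y): by Grothendieck's inequality and a minimax argument, a
      bounded form is dominated by one weight in each variable
      ([grothendieck_factorization]).  Hence A = D B D' with B bounded on l_2
      (for complex scalars, one such term for the real part of A and one for the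
      imaginary part), and M * A = D (M * B) D' is bounded as soon as M * B is.
    - From (X, Y) to l_2: by Lozanovskii's theorem ([lozanovskii]) each vector of
      l_2 is a product of the square root of a weight and a vector of X of
      comparable norm.  If B is bounded on l_2, then D B D' is bounded from X
      to Y for all such D and D'; evaluating M * (D B D') at the second factors
      evaluates M * B at arbitrary vectors of l_2.

    The existence of weights, the norming functionals, the factorization of
    forms and Lozanovskii's theorem are all instances of one lemma on infinite
    systems of affine inequalities over a compact convex set ([minimax]).

    The infinite matrices are reached through their n x n sections.  Bounded
    operators are the matrices with uniformly bounded sections
    ([bounded_operator_section_bound], [section_bound_bounded_operator]), and a
    Schur multiplier is automatically uniformly bounded on sections, by a
    gliding hump argument ([schur_multiplier_uniform]).  This requires that a
    sequence with bounded sections belongs to Y, which 2-concavity provides for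
    the symmetric spaces ([symmetric_fatou]). *)

Set Implicit Arguments.
Unset Strict Implicit.
Unset Printing Implicit Defensive.

Import Order.TTheory GRing.Theory Num.Theory.
Import numFieldNormedType.Exports.

Local Open Scope classical_set_scope.
Local Open Scope ring_scope.

(** * Systems of affine inequalities on compact convex sets *)

Lemma continuous_sum (R : realType) (T : topologicalType) (K : finType)
    (f : K -> T -> R) :
  (forall k, continuous (f k)) -> continuous (fun x => \sum_k f k x).
Proof.
move=> cf x; elim: (index_enum K) => [|k r IH].
  rewrite (_ : (fun _ => _) = cst 0); first exact: cst_continuous.
  by apply/funext => y; rewrite big_nil.
rewrite (_ : (fun _ => _) = f k \+ (fun y => \sum_(j <- r) f j y)).
  exact: (continuousD (cf k x) IH).
by apply/funext => y; rewrite big_cons.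
Qed.

Section affine.
Context {R : realType}.
Implicit Types I : finType.

(** Functionals rather than points carry the data below: each system of
    inequalities is a family of affine functionals that must be made nonpositive
    at a common point. *)
Definition affine_fun I (c : I -> R) (b : R) (s : I -> R) : R :=
  \sum_i c i * s i + b.

Definition convex_set I (S : set {ptws I -> R}) := forall s s' (t : R), S s -> S s' -> 0 <= t <= 1 ->
  S (fun i => (1 - t) * s i + t * s' i).

Definition closed_convex I (S : set {ptws I -> R}) := closed S /\ convex_set S.

Lemma affine_fun_continuous I I' (h : I -> I') (c : I -> R) b :
  continuous (fun s : {ptws I' -> R} => affine_fun c b (s \o h)).
Proof.
move=> s; apply: (@continuousD _ _ _ (fun s : {ptws I' -> R} =>
  \sum_i c i * s (h i))); last exact: cst_continuous.
apply: continuous_sum => i s'; apply: continuousM; first exact: cst_continuous.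
exact: (@proj_continuous I' (fun _ : I' => (R : topologicalType)) (h i)).
Qed.

Lemma affine_fun_convex I (c : I -> R) b s s' t :
  affine_fun c b (fun i => (1 - t) * s i + t * s' i)
  = (1 - t) * affine_fun c b s + t * affine_fun c b s'.
Proof.
rewrite /affine_fun !mulrDr !mulr_sumr addrACA -big_split/= -mulrDl subrK mul1r.
by congr (_ + _); apply: eq_bigr => i _; ring.
Qed.

(** The reindexing [h] lets a constraint on one block of coordinates be stated on
    a product, such as a pair of weights seen as one function on a sum type. *)
Lemma closed_convex_halfspace I I' (h : I -> I') (c : I -> R) b :
  closed_convex [set s : {ptws I' -> R} | affine_fun c b (s \o h) <= 0].
Proof.
split.
  rewrite (_ : mkset _ = (fun s : {ptws I' -> R} => affine_fun c b (s \o h))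
    @^-1` [set x | x <= 0]) //.
  apply: closed_comp; last exact: closed_le.
  by move=> s _; exact: affine_fun_continuous.
move=> s s' t /= hs hs' /andP[t0 t1].
have := affine_fun_convex c b (s \o h) (s' \o h) t; rewrite /comp => ->.
move: hs hs'; rewrite /comp; nra.
Qed.

Lemma closed_convex_bigcap I (K : Type) (S : K -> set {ptws I -> R}) :
  (forall k, closed_convex (S k)) -> closed_convex [set s | forall k, S k s].
Proof.
move=> cS; split.
  have -> : [set s | forall k, S k s] = \bigcap_(k in [set: K]) S k.
    by rewrite predeqE => s; split=> /= [h k _|h k]; apply: h.
  by apply: closed_bigI => k _; have [] := cS k.
by move=> s s' t h h' t01 k; have [_] := cS k; apply; [exact: h|exact: h'|].
Qed.

Lemma closed_convexI I (S S' : set {ptws I -> R}) :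
  closed_convex S -> closed_convex S' -> closed_convex (S `&` S').
Proof.
move=> [cS vS] [cS' vS']; split; first exact: closedI.
move=> s s' t [h1 h1'] [h2 h2'] t01; split; [exact: vS|exact: vS'].
Qed.

Lemma bounded_closed_convex_compact I (a b : I -> R) (S : set {ptws I -> R}) :
  closed_convex S -> (forall s, S s -> forall i, a i <= s i <= b i) -> compact S.
Proof.
move=> [cS _] Sab; apply: (@subclosed_compact _ _
  ([set s : {ptws I -> R} | forall i, `[a i, b i]%classic (s i)]) cS).
- apply: (@tychonoff I (fun _ : I => (R : topologicalType))
    (fun i => `[a i, b i]%classic)) => i.
  exact: segment_compact.
- by move=> s /Sab h i /=; rewrite in_itv/=.
Qed.

End affine.

Section minimax.
Context {R : realType} {I : finType}.
Implicit Types (S : set {ptws I -> R}).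

(** Minimize the sum of the squares of the positive parts of the functionals.  At a
    minimum s0, the first-order condition in the direction of a point s reads
    sum_k a_k (F_k s - F_k s0) >= 0, where a_k is the positive part of F_k s0.
    Choosing s so that sum_k a_k F_k s <= 0 leaves sum_k a_k^2 <= 0. *)
Lemma finite_minimax S (J : Type) (c : J -> I -> R) (b : J -> R) :
  compact S -> convex_set S ->
  (forall (m : nat) (j : 'I_m -> J) (t : 'I_m -> R), (forall k, 0 <= t k) ->
     exists2 s, S s & \sum_k t k * affine_fun (c (j k)) (b (j k)) s <= 0) ->
  forall (m : nat) (j : 'I_m -> J),
    exists2 s, S s & forall k, affine_fun (c (j k)) (b (j k)) s <= 0.
Proof.
move=> cS vS H m j.
pose F k s := affine_fun (c (j k)) (b (j k)) s.
pose g (s : {ptws I -> R}) := \sum_k (Num.max 0 (F k s)) ^+ 2.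
have gc : continuous g.
  apply: continuous_sum => k s; rewrite (_ : (fun _ => _) =
    (fun s => Num.max 0 (F k s)) \* (fun s => Num.max 0 (F k s))); last first.
    by apply/funext => x; rewrite expr2.
  have Fc : {for s, continuous (fun s : {ptws I -> R} => Num.max 0 (F k s))}.
    exact: (@continuous_max _ {ptws I -> R} (fun=> 0) (F k) s (@cst_continuous _ _ _ _)
      (@affine_fun_continuous _ _ _ id _ _ s)).
  exact: (continuousM Fc Fc).
have S0 : S !=set0 by have [//|s] := H m j (fun=> 0); exists s.
have [s0 s0S smin] := compact_EVT_min S0 cS (continuous_subspaceT gc).
rewrite inE in s0S; exists s0 => //.
pose a k := Num.max 0 (F k s0).
have a0 k : 0 <= a k by rewrite le_max lexx.
have [s Ss Hs] := H m j a a0.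
pose d k := F k s - F k s0.
(* comparison of the minimum with the point at parameter t on the segment from s0 to s *)
have deriv t : 0 <= t -> t <= 1 ->
    0 <= t * (2 * \sum_k a k * d k + t * \sum_k d k ^+ 2).
  move=> t0 t1.
  have := smin _ (mem_set (vS _ _ t s0S Ss (introT andP (conj t0 t1)))).
  rewrite /g => gle.
  have : \sum_k a k ^+ 2 <= \sum_k (a k + t * d k) ^+ 2.
    apply: le_trans gle _; apply: ler_sum => k _.
    rewrite /F affine_fun_convex -/(F k s0) -/(F k s) /d.
    have -> : (1 - t) * F k s0 + t * F k s = F k s0 + t * (F k s - F k s0) by ring.
    move: (F k s - F k s0) => e; rewrite /a !maxEle.
    by case: ifP => h1; case: ifP => h2; nra.
  have -> : \sum_k (a k + t * d k) ^+ 2 =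
     \sum_k a k ^+ 2 + t * (2 * \sum_k a k * d k + t * \sum_k d k ^+ 2).
    rewrite mulrDr !mulr_sumr -!big_split/=; apply: eq_bigr => k _; ring.
  by rewrite lerDl.
have ad : 0 <= \sum_k a k * d k.
  rewrite leNgt; apply/negP => ad.
  (* if the slope were -A < 0, the parameter A / (D + A) would contradict minimality *)
  pose D := \sum_k d k ^+ 2.
  have D0 : 0 <= D by apply: sumr_ge0 => k _; exact: sqr_ge0.
  pose A := - \sum_k a k * d k.
  have A0 : 0 < A by rewrite oppr_gt0.
  have t0 : 0 < A / (D + A) by rewrite divr_gt0// ltr_wpDl.
  have t1 : A / (D + A) <= 1 by rewrite ler_pdivrMr ?ltr_wpDl// mul1r lerDr.
  have := deriv _ (ltW t0) t1; rewrite pmulr_rge0// -/D.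
  have : A / (D + A) * D <= A.
    by rewrite mulrAC ler_pdivrMr ?ltr_wpDl// ler_wpM2l ?(ltW A0)// lerDl ltW.
  rewrite /A; lra.
have : \sum_k a k ^+ 2 <= 0.
  apply: le_trans Hs.
  have -> : \sum_k a k ^+ 2 = \sum_k a k * F k s0.
    by apply: eq_bigr => k _; rewrite /a maxEle; case: ifP => _; ring.
  by rewrite -subr_ge0 -sumrB (eq_bigr (fun k => a k * d k))// => k _; rewrite /d mulrBr.
move=> le0 k.
have : a k ^+ 2 <= 0.
  by apply: le_trans le0; rewrite (bigD1 k)//= lerDl sumr_ge0// => i _; exact: sqr_ge0.
rewrite -/(F k s0) /a maxEle; case: ifP => [h|/negbT]; last by rewrite -ltNge => /ltW.
nra.
Qed.

(** A system of affine inequalities is solvable on a compact convex set as soon as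
    each nonnegative combination of them is: finite subsystems are solvable, and
    compactness passes to the whole system.  All the existence theorems below
    (weights, functionals, factorizations) are obtained from this statement, the
    hypothesis being each time an inequality between norms. *)
Lemma minimax S (J : Type) (c : J -> I -> R) (b : J -> R) :
  compact S -> convex_set S ->
  (forall (m : nat) (j : 'I_m -> J) (t : 'I_m -> R), (forall k, 0 <= t k) ->
     exists2 s, S s & \sum_k t k * affine_fun (c (j k)) (b (j k)) s <= 0) ->
  exists2 s, S s & forall j, affine_fun (c j) (b j) s <= 0.
Proof.
move=> cS vS H; have fin := finite_minimax cS vS H.
pose f (j : {classic J}) : set {ptws I -> R} :=
  S `&` [set s | affine_fun (c j) (b j) s <= 0].
have [j0|J0] := pselect (exists j : J, True); last first.
  have [s Ss _] := fin 0%N (fun k => False_rect J (notF (ltn_ord k))).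
  by exists s => // j; exfalso; apply: J0; exists j.
have [] : \bigcap_(j in [set: {classic J}]) f j !=set0.
  pose T : ptopologicalType :=
    HB.pack {ptws I -> R} (isPointed.Build {ptws I -> R} (fun=> 0)).
  have := cS; rewrite (@compact_In0 T); apply.
    by exists (fun j => [set s | affine_fun (c j) (b j) s <= 0]) => // j _;
      have [] := closed_convex_halfspace id (c j) (b j).
  move=> D _.
  have [s Ss sD] := fin _ (fun k => tnth (in_tuple (enum_fset D)) k).
  exists s => j /= jD; split => //=.
  have /tnthP[k ->] : j \in in_tuple (enum_fset D) by [].
  exact: sD.
move=> s h; case: j0 => j _; exists s; first by have [] := h j Logic.I.
by move=> k; have [] := h k Logic.I.
Qed.

End minimax.

(** * Ideal norms and their quadratic weights *)

Lemma cauchy_schwarz (R : realType) (K : finType) (x y : K -> R) :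
  (\sum_k x k * y k) ^+ 2 <= (\sum_k x k ^+ 2) * \sum_k y k ^+ 2.
Proof.
pose A := \sum_k x k ^+ 2; pose B := \sum_k x k * y k; pose C := \sum_k y k ^+ 2.
have A0 : 0 <= A by apply: sumr_ge0 => k _; exact: sqr_ge0.
have C0 : 0 <= C by apply: sumr_ge0 => k _; exact: sqr_ge0.
have quad t : 0 <= A * t ^+ 2 + 2 * B * t + C.
  have -> : A * t ^+ 2 + 2 * B * t + C = \sum_k (t * x k + y k) ^+ 2.
    rewrite /A /B /C mulr_suml mulr_sumr mulr_suml -!big_split/=.
    by apply: eq_bigr => k _; ring.
  by apply: sumr_ge0 => k _; exact: sqr_ge0.
rewrite -/A -/B -/C; move: A0; rewrite le_eqVlt => /orP[/eqP A0|A0]; last first.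
  have := quad (- B / A).
  have -> : A * (- B / A) ^+ 2 + 2 * B * (- B / A) + C = (A * C - B ^+ 2) / A.
    by field; rewrite gt_eqF.
  by rewrite ler_pdivlMr// mul0r subr_ge0.
rewrite -A0 mul0r; have x0 k : x k = 0.
  have /eqP := esym A0; rewrite psumr_eq0; last by move=> i _; exact: sqr_ge0.
  by move=> /allP/(_ k (mem_index_enum _)) /=; rewrite sqrf_eq0 => /eqP.
by rewrite /B big1 ?expr0n// => k _; rewrite x0 mul0r.
Qed.

Lemma cauchy_schwarz_sqrt (R : realType) (K : finType) (x y : K -> R) :
  \sum_k x k * y k <= Num.sqrt (\sum_k x k ^+ 2) * Num.sqrt (\sum_k y k ^+ 2).
Proof.
rewrite -sqrtrM; last by apply: sumr_ge0 => k _; exact: sqr_ge0.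
apply: le_trans (ler_norm _) _; rewrite -sqrtr_sqr ler_sqrt ?cauchy_schwarz//.
by rewrite mulr_ge0// sumr_ge0// => k _; exact: sqr_ge0.
Qed.

Definition unit_vec (R : pzRingType) (I : eqType) (i : I) : I -> R :=
  fun j => (j == i)%:R.

Section ideal_norms.
Context {R : realType}.
Implicit Types (I : finType) (C : R).

(** Finite dimensional lattice norms on real vectors.  In place of the triangle
    inequality comes convexity for a domain, [triangle_ineq] for a target. *)
Record ideal_norm I (N : (I -> R) -> R) : Prop := IdealNorm {
  ideal_mono : forall x y, (forall i, `|x i| <= `|y i|) -> N x <= N y;
  ideal_homo : forall a x, 0 <= a -> N (fun i => a * x i) = a * N x;
  ideal_unit : forall i, 0 < N (unit_vec R i) }.

Definition triangle_ineq I (N : (I -> R) -> R) :=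
  forall x y, N (fun i => x i + y i) <= N x + N y.

Definition quadratic_mean I (K : finType) (x : K -> I -> R) : I -> R :=
  fun i => Num.sqrt (\sum_k x k i ^+ 2).

(** Families indexed by an arbitrary finite type, so that two families can be
    concatenated along a sum type. *)
Definition convex2 I (C : R) (N : (I -> R) -> R) :=
  forall (K : finType) (x : K -> I -> R),
    N (quadratic_mean x) <= C * Num.sqrt (\sum_k N (x k) ^+ 2).

Definition concave2 I (C : R) (N : (I -> R) -> R) :=
  forall (K : finType) (x : K -> I -> R),
    Num.sqrt (\sum_k N (x k) ^+ 2) <= C * N (quadratic_mean x).

Lemma ideal_norm0 I (N : (I -> R) -> R) : ideal_norm N -> N (fun=> 0) = 0.
Proof.
move=> iN; rewrite -[RHS](mul0r (N (fun=> 0))) -(ideal_homo iN)//.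
by congr N; apply/funext => i; rewrite mul0r.
Qed.

Lemma ideal_norm_ge0 I (N : (I -> R) -> R) x : ideal_norm N -> 0 <= N x.
Proof.
move=> iN; rewrite -(ideal_norm0 iN); apply: (ideal_mono iN) => i.
by rewrite normr0.
Qed.

Lemma ideal_norm_abs I (N : (I -> R) -> R) x y : ideal_norm N ->
  (forall i, `|x i| = `|y i|) -> N x = N y.
Proof. by move=> iN h; apply/eqP; rewrite eq_le !(ideal_mono iN)// => i; rewrite h. Qed.

Lemma ideal_norm_coord I (N : (I -> R) -> R) x i : ideal_norm N ->
  `|x i| * N (unit_vec R i) <= N x.
Proof.
move=> iN; rewrite -(ideal_homo iN)//; apply: (ideal_mono iN) => j.
rewrite /unit_vec; case: eqP => [->|_]; first by rewrite mulr1 normr_id.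
by rewrite mulr0 normr0.
Qed.

Lemma triangle_sum I (K : finType) (N : (I -> R) -> R) (x : K -> I -> R) :
  ideal_norm N -> triangle_ineq N ->
  N (fun i => \sum_k x k i) <= \sum_k N (x k).
Proof.
move=> iN sN; elim: (index_enum K) => [|k r IH].
  rewrite big_nil (_ : (fun i => _) = fun=> 0) ?(ideal_norm0 iN)//.
  by apply/funext => i; rewrite big_nil.
rewrite big_cons (_ : (fun i => _) = fun i => x k i + \sum_(j <- r) x j i).
  by apply: le_trans (sN _ _) _; rewrite lerD2l.
by apply/funext => i; rewrite big_cons.
Qed.

Lemma sum_unit_vec I (f : I -> R) i : \sum_j f j * unit_vec R i j = f i.
Proof.
rewrite (bigD1 i)//= /unit_vec eqxx mulr1 big1 ?addr0// => j ji.
by rewrite (negbTE ji) mulr0.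
Qed.

Lemma sum_unit_vec_r I (f : I -> R) i : \sum_j f j * unit_vec R j i = f i.
Proof.
by rewrite -[RHS](sum_unit_vec f i); apply: eq_bigr => j _; rewrite /unit_vec eq_sym.
Qed.

Lemma sum_unit_sqr I (w : I -> R) (r : R) i :
  \sum_j w j * (r * unit_vec R i j) ^+ 2 = w i * r ^+ 2.
Proof.
rewrite -[RHS](sum_unit_vec (fun j => w j * r ^+ 2) i); apply: eq_bigr => j _.
by rewrite /unit_vec; case: eqP => _ /=; ring.
Qed.

Lemma closed_convex_box I (a b : I -> R) :
  closed_convex [set s : {ptws I -> R} | forall i, a i <= s i <= b i].
Proof.
apply: closed_convex_bigcap => i; rewrite [X in closed_convex X](_ : _ =
  [set s : {ptws I -> R} | affine_fun (fun j => - unit_vec R i j) (a i) (s \o id) <= 0] `&`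
  [set s : {ptws I -> R} | affine_fun (fun j => unit_vec R i j) (- b i) (s \o id) <= 0]).
  by apply: closed_convexI; exact: closed_convex_halfspace.
rewrite predeqE => s /=; rewrite /affine_fun subr_le0 addrC.
under eq_bigr do rewrite mulNr mulrC/=.
under [X in _ /\ X <= _]eq_bigr do rewrite mulrC/=.
by rewrite sumrN !sum_unit_vec subr_le0; split=> [/andP[]|[-> ->]].
Qed.

(** The unit ball, in the concavification of N, of the dual norm: for a 2-convex N
    the map w^2 |-> N(w)^2 is equivalent to a norm on nonnegative vectors, and
    these are its nonnegative functionals. *)
Definition weights I (N : (I -> R) -> R) : set {ptws I -> R} :=
  [set phi | (forall i, 0 <= phi i) /\
             forall w, \sum_i phi i * w i ^+ 2 <= N w ^+ 2].

Lemma closed_convex_ge0 I I' (h : I -> I') :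
  closed_convex [set s : {ptws I' -> R} | forall i : I, 0 <= s (h i)].
Proof.
apply: closed_convex_bigcap => i.
have := closed_convex_halfspace h (fun j : I => - unit_vec R i j) 0.
congr closed_convex; rewrite predeqE => s /=; rewrite /affine_fun addr0.
under eq_bigr do rewrite mulNr mulrC/=.
by rewrite sumrN sum_unit_vec /= oppr_le0.
Qed.

Lemma closed_convex_weights I I' (h : I -> I') (N : (I -> R) -> R) :
  closed_convex [set s : {ptws I' -> R} | weights N (s \o h)].
Proof.
apply: closed_convexI; first exact: closed_convex_ge0.
apply: closed_convex_bigcap => w.
have := closed_convex_halfspace h (fun j : I => w j ^+ 2) (- N w ^+ 2).
congr closed_convex; rewrite predeqE => s /=; rewrite /affine_fun subr_le0.
by under eq_bigr do rewrite mulrC/=.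
Qed.

Lemma weights_bound I (N : (I -> R) -> R) phi i :
  weights N phi -> 0 <= phi i <= N (unit_vec R i) ^+ 2.
Proof.
move=> [p0 pN]; rewrite p0/=; apply: le_trans (pN _).
have := sum_unit_sqr phi 1 i; rewrite expr1n mulr1 => <-.
by apply: ler_sum => j _; rewrite mul1r.
Qed.

Lemma sqr_sqrt_sum (K : finType) (x : K -> R) :
  Num.sqrt (\sum_k x k ^+ 2) ^+ 2 = \sum_k x k ^+ 2.
Proof. by rewrite sqr_sqrtr// sumr_ge0// => k _; exact: sqr_ge0. Qed.

(** Hahn-Banach for the concavification of a 2-convex norm.  The unknown weight
    phi ranges over a box and must satisfy sum phi w^2 <= N(w)^2 for every w, and
    the reverse inequality up to C^2 at w0.  A nonnegative combination of these
    inequalities is solvable because of 2-convexity, applied to the vectors w of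
    the combination together with multiples of the unit vectors. *)
Lemma exists_norming_weight I (N : (I -> R) -> R) C : ideal_norm N ->
  0 < C -> convex2 C N ->
  forall w, exists2 phi, weights N phi & N w ^+ 2 <= C ^+ 2 * \sum_i phi i * w i ^+ 2.
Proof.
move=> iN C0 cN w0.
pose D i := N (unit_vec R i) ^+ 2.
have D0 i : 0 <= D i by exact: sqr_ge0.
pose c (o : option (I -> R)) i := if o is Some w then w i ^+ 2 else - (C ^+ 2 * w0 i ^+ 2).
pose b (o : option (I -> R)) := if o is Some w then - N w ^+ 2 else N w0 ^+ 2.
pose S : set {ptws I -> R} := [set s | forall i, 0 <= s i <= D i].
have Scc : closed_convex S := closed_convex_box (fun=> 0) D.
have [|s Ss sP] := minimax (c := c) (b := b)
    (bounded_closed_convex_compact Scc (fun s h => h)) Scc.2; last first.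
  exists s.
    split=> [i|w]; first by have /andP[] := Ss i.
    have := sP (Some w); rewrite /affine_fun/= subr_le0.
    by under eq_bigr do rewrite mulrC.
  have := sP None; rewrite /affine_fun/= addrC.
  under eq_bigr do rewrite mulNr -mulrA mulrC [_ * s _]mulrC.
  by rewrite sumrN subr_le0 mulr_sumr; under [leRHS]eq_bigr do rewrite mulrC.
move=> m j t t0.
pose val k : I -> R := if j k is Some w then w else fun=> 0.
pose on k : R := if j k is Some _ then 0 else t k.
pose p i := \sum_k t k * val k i ^+ 2.
pose P := \sum_k t k * N (val k) ^+ 2.
pose T := \sum_k on k.
have T0 : 0 <= T by apply: sumr_ge0 => k _; rewrite /on; case: (j k).
have p0 i : 0 <= p i by apply: sumr_ge0 => k _; rewrite mulr_ge0// sqr_ge0.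
(* the value at a point s of the box is T N(w0)^2 - P - sum_i s_i e_i: saturate the box
   where e is nonnegative *)
pose e i := C ^+ 2 * T * w0 i ^+ 2 - p i.
pose s i := if 0 <= e i then D i else 0.
exists s.
  by move=> i; rewrite /s; case: ifP => _; rewrite !lexx !D0.
have -> : \sum_k t k * affine_fun (c (j k)) (b (j k)) s
    = T * N w0 ^+ 2 - P - \sum_i s i * e i.
  transitivity (\sum_k (on k * N w0 ^+ 2 - t k * N (val k) ^+ 2
     - \sum_i s i * (C ^+ 2 * on k * w0 i ^+ 2 - t k * val k i ^+ 2))).
    apply: eq_bigr => k _; rewrite /affine_fun /on /val /c /b; case: (j k) => [w|].
      rewrite mul0r sub0r mulrDr mulrN addrC mulr_sumr -sumrN; congr (_ + _).
      by apply: eq_bigr => i _; ring.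
    rewrite (ideal_norm0 iN) expr0n/= mulr0 subr0 mulrDr addrC mulr_sumr -sumrN.
    by congr (_ + _); apply: eq_bigr => i _; ring.
  rewrite !sumrB -mulr_suml; congr (_ - _); rewrite exchange_big/=.
  apply: eq_bigr => i _; rewrite -mulr_sumr sumrB; congr (_ * (_ - _)).
  by rewrite /T mulr_sumr mulr_suml.
pose z i := Num.sqrt (Num.max 0 (e i)).
have z2 i : z i ^+ 2 = Num.max 0 (e i) by rewrite sqr_sqrtr// le_max lexx.
have -> : \sum_i s i * e i = \sum_i D i * z i ^+ 2.
  apply: eq_bigr => i _; rewrite z2 /s maxEle.
  by case: ifP => _; rewrite ?mul0r ?mulr0.
(* C^2 T w0^2 <= p + z^2 coordinatewise; p + z^2 is the squared quadratic mean of this family *)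
pose fam (k : 'I_m + I) : I -> R := match k with
  | inl k => fun i => Num.sqrt (t k) * val k i
  | inr l => fun i => z l * unit_vec R l i end.
have key : C ^+ 2 * (T * N w0 ^+ 2) <= C ^+ 2 * (P + \sum_i D i * z i ^+ 2).
  have -> : C ^+ 2 * (T * N w0 ^+ 2) = N (fun i => C * Num.sqrt T * w0 i) ^+ 2.
    rewrite (ideal_homo iN) ?mulr_ge0 ?sqrtr_ge0 ?(ltW C0)// !exprMn sqr_sqrtr//.
    by rewrite mulrA.
  have -> : P + \sum_i D i * z i ^+ 2 = \sum_k N (fam k) ^+ 2.
    rewrite big_sumType/=; congr (_ + _); apply: eq_bigr => k _.
      by rewrite (ideal_homo iN) ?sqrtr_ge0// exprMn sqr_sqrtr.
    by rewrite (ideal_homo iN) ?sqrtr_ge0// exprMn mulrC.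
  have le1 : N (fun i => C * Num.sqrt T * w0 i) <= N (quadratic_mean fam).
    apply: (ideal_mono iN) => i; rewrite [leRHS]ger0_norm ?sqrtr_ge0//.
    rewrite -sqrtr_sqr ler_sqrt; last by rewrite sumr_ge0// => k _; exact: sqr_ge0.
    rewrite !exprMn sqr_sqrtr// big_sumType/=.
    rewrite (eq_bigr (fun k => t k * val k i ^+ 2)); last first.
      by move=> k _; rewrite exprMn sqr_sqrtr.
    rewrite (eq_bigr (fun l => z l ^+ 2 * unit_vec R l i)); last first.
      move=> l _; rewrite exprMn; congr (_ * _).
      by rewrite /unit_vec; case: eqP; rewrite ?expr1n ?expr0n.
    rewrite sum_unit_vec_r -/(p i) z2 addrC -lerBlDr -/(e i).
    by rewrite le_max lexx orbT.
  have le2 := le_trans le1 (cN _ fam).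
  have := ler_pM (ideal_norm_ge0 _ iN) (ideal_norm_ge0 _ iN) le2 le2.
  by rewrite -!expr2 exprMn sqr_sqrt_sum.
by move: key; rewrite ler_pM2l ?exprn_gt0//; lra.
Qed.

End ideal_norms.
(** * Dual norms and Lozanovskii's factorization *)

Section duality.
Context {R : realType}.
Implicit Types (I : finType) (C : R).

(** The Hahn-Banach theorem for N at y: the functional g ranges over the box
    given by the norms of the unit vectors, and a combination of the
    inequalities g(w) <= N(w) and N(y) <= g(y) is solvable by the triangle
    inequality. *)
Lemma exists_norming_functional I (N : (I -> R) -> R) :
  ideal_norm N -> triangle_ineq N ->
  forall y, exists2 g : I -> R, (forall w, \sum_i g i * w i <= N w) &
    N y <= \sum_i g i * y i.
Proof.
move=> iN sN y.
pose D i := N (unit_vec R i).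
have D0 i : 0 <= D i by exact: ideal_norm_ge0.
pose c (o : option (I -> R)) i := if o is Some w then w i else - y i.
pose b (o : option (I -> R)) := if o is Some w then - N w else N y.
pose S : set {ptws I -> R} := [set s | forall i, - D i <= s i <= D i].
have Scc : closed_convex S := closed_convex_box (fun i => - D i) D.
have [|s Ss sP] := minimax (c := c) (b := b)
    (bounded_closed_convex_compact Scc (fun s h => h)) Scc.2; last first.
  exists s.
    move=> w; have := sP (Some w); rewrite /affine_fun/= subr_le0.
    by under eq_bigr do rewrite mulrC.
  have := sP None; rewrite /affine_fun/= addrC.
  under eq_bigr do rewrite mulNr mulrC.
  by rewrite sumrN subr_le0.
move=> m j t t0.
pose val k : I -> R := if j k is Some w then w else fun=> 0.
pose on k : R := if j k is Some _ then 0 else t k.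
pose v i := \sum_k t k * val k i.
pose P := \sum_k t k * N (val k).
pose T := \sum_k on k.
have T0 : 0 <= T by apply: sumr_ge0 => k _; rewrite /on; case: (j k).
(* at a point s of the box the combination equals T N(y) - P + sum_i s_i e_i: take the
   sign of s opposite to that of e *)
pose e i := v i - T * y i.
pose s i := if 0 <= e i then - D i else D i.
exists s.
  by move=> i; have := D0 i; rewrite /s; case: ifP => _; lra.
have -> : \sum_k t k * affine_fun (c (j k)) (b (j k)) s
    = T * N y - P + \sum_i s i * e i.
  transitivity (\sum_k (on k * N y - t k * N (val k)
     + \sum_i s i * (t k * val k i - on k * y i))).
    apply: eq_bigr => k _; rewrite /affine_fun /on /val /c /b; case: (j k) => [w|].
      rewrite mul0r sub0r mulrDr mulrN addrC mulr_sumr; congr (_ + _).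
      by apply: eq_bigr => i _; ring.
    rewrite (ideal_norm0 iN) mulr0 subr0 mulrDr addrC mulr_sumr.
    by congr (_ + _); apply: eq_bigr => i _; ring.
  rewrite big_split/= sumrB -mulr_suml; congr (_ + _); rewrite exchange_big/=.
  apply: eq_bigr => i _; rewrite -mulr_sumr sumrB; congr (_ * (_ - _)).
  by rewrite mulr_suml.
have -> : \sum_i s i * e i = - \sum_i `|e i| * D i.
  rewrite -sumrN; apply: eq_bigr => i _; rewrite /s; case: ifP => [h|/negbT].
    by rewrite ger0_norm//; ring.
  by rewrite -ltNge => h; rewrite ltr0_norm//; ring.
have Nv : N v <= P.
  apply: le_trans (triangle_sum (fun k i => t k * val k i) iN sN) _.
  by apply: ler_sum => k _; rewrite (ideal_homo iN).
have Ne : N e <= \sum_i `|e i| * D i.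
  have -> : e = fun i => \sum_j e j * unit_vec R j i.
    by apply/funext => i; rewrite sum_unit_vec_r.
  apply: le_trans (triangle_sum (fun j i => e j * unit_vec R j i) iN sN) _.
  apply: ler_sum => k _; rewrite sum_unit_vec_r -(ideal_homo iN)//.
  rewrite (@ideal_norm_abs _ _ N (fun i => e k * unit_vec R k i)
    (fun i => `|e k| * unit_vec R k i))// => i.
  by rewrite !normrM normr_id.
have : T * N y <= N v + N e.
  rewrite -(ideal_homo iN)//.
  have -> : N e = N (fun i => - e i) by apply: ideal_norm_abs => // i; rewrite normrN.
  have -> : (fun i => T * y i) = fun i => v i + - e i.
    by apply/funext => i; rewrite /e; ring.
  exact: sN.
lra.
Qed.

Definition dual_norm I (N : (I -> R) -> R) (g : I -> R) : R :=
  sup [set r | exists2 y, N y <= 1 & r = \sum_i `|g i| * `|y i|].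

Lemma sum_norm_ge0 I (g y : I -> R) : 0 <= \sum_i `|g i| * `|y i|.
Proof. by apply: sumr_ge0 => i _; rewrite mulr_ge0. Qed.

Lemma dual_norm_has_sup I (N : (I -> R) -> R) (g : I -> R) : ideal_norm N ->
  has_sup [set r | exists2 y, N y <= 1 & r = \sum_i `|g i| * `|y i|].
Proof.
move=> iN; split.
  by exists (\sum_i `|g i| * `|0 : R|); exists (fun=> 0); rewrite ?ideal_norm0.
exists (\sum_i `|g i| * (N (unit_vec R i))^-1) => _ [y Ny ->].
apply: ler_sum => i _; rewrite ler_wpM2l// -[leRHS]mul1r.
rewrite ler_pdivlMr ?(ideal_unit iN)//.
exact: le_trans (ideal_norm_coord _ _ iN) Ny.
Qed.

Lemma le_dual_norm I (N : (I -> R) -> R) (g y : I -> R) : ideal_norm N -> N y <= 1 ->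
  \sum_i `|g i| * `|y i| <= dual_norm N g.
Proof.
by move=> iN Ny; apply: ub_le_sup; [exact: (dual_norm_has_sup g iN).2|exists y].
Qed.

Lemma dual_norm_le I (N : (I -> R) -> R) (g : I -> R) c : ideal_norm N ->
  (forall y, N y <= 1 -> \sum_i `|g i| * `|y i| <= c) -> dual_norm N g <= c.
Proof.
move=> iN h; apply: ge_sup; first exact: (dual_norm_has_sup g iN).1.
by move=> _ [y Ny ->]; exact: h.
Qed.

(** When [N y = 0] the vector y vanishes, since each unit vector has positive
    norm; otherwise normalize y. *)
Lemma pairing_le I (N : (I -> R) -> R) (g y : I -> R) : ideal_norm N ->
  \sum_i `|g i| * `|y i| <= dual_norm N g * N y.
Proof.
move=> iN; have := ideal_norm_ge0 y iN; rewrite le_eqVlt => /orP[/eqP Ny|Ny].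
  rewrite -Ny mulr0 big1// => i _; have := ideal_norm_coord y i iN.
  rewrite -Ny pmulr_lle0 ?(ideal_unit iN)// normr_le0 => /eqP ->.
  by rewrite normr0 mulr0.
have := @le_dual_norm _ N g (fun i => (N y)^-1 * y i) iN.
rewrite (ideal_homo iN) ?invr_ge0 ?(ltW Ny)// mulVf ?gt_eqF// => /(_ (lexx 1)).
have -> : \sum_i `|g i| * `|(N y)^-1 * y i| = (\sum_i `|g i| * `|y i|) / N y.
  rewrite mulr_suml; apply: eq_bigr => i _.
  by rewrite normrM ger0_norm ?invr_ge0 ?(ltW Ny)//; ring.
by rewrite ler_pdivrMr.
Qed.

Lemma dual_norm_ideal I (N : (I -> R) -> R) : ideal_norm N ->
  ideal_norm (dual_norm N).
Proof.
move=> iN; split=> [x y xy|a x a0|i].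
- apply: dual_norm_le => // z Nz; apply: le_trans (le_dual_norm y iN Nz).
  by apply: ler_sum => i _; rewrite ler_wpM2r.
- have le b z : 0 <= b -> dual_norm N (fun i => b * z i) <= b * dual_norm N z.
    move=> b0; apply: dual_norm_le => // w Nw.
    apply: le_trans (ler_wpM2l b0 (le_dual_norm z iN Nw)).
    rewrite mulr_sumr; apply: ler_sum => i _.
    by rewrite normrM (ger0_norm b0) mulrA.
  apply/eqP; rewrite eq_le le//=.
  have {a0} [<-|a0] : 0 = a \/ 0 < a by move: a0; rewrite le_eqVlt => /orP[/eqP|]; tauto.
    rewrite mul0r; apply: le_trans (@le_dual_norm _ N _ (fun=> 0) iN _).
      by apply: sum_norm_ge0.
    by rewrite ideal_norm0.
  rewrite mulrC -ler_pdivlMr// mulrC.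
  have := le a^-1 (fun i => a * x i); rewrite invr_ge0 (ltW a0) => /(_ isT).
  rewrite [X in dual_norm _ X](_ : _ = x)//.
  by apply/funext => j; rewrite mulrA mulVf ?mul1r// gt_eqF.
- have u0 := ideal_unit iN i.
  apply: lt_le_trans (@le_dual_norm _ N _ (fun j => (N (unit_vec R i))^-1 * unit_vec R i j) iN _).
    rewrite (bigD1 i)//= ltr_wpDr//; first by apply: sumr_ge0 => j _; rewrite mulr_ge0.
    by rewrite /unit_vec eqxx mulr1 normr1 mul1r normr_gt0 invr_neq0// gt_eqF.
  by rewrite (ideal_homo iN) ?invr_ge0 ?(ltW u0)// mulVf// gt_eqF.
Qed.

(** Changing the signs of y to those of a norming functional g does not change its
    norm, so g is bounded by 1 for the dual norm, which takes absolute values. *)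
Lemma dual_norm_norming I (N : (I -> R) -> R) : ideal_norm N -> triangle_ineq N ->
  forall y, exists2 g : I -> R, dual_norm N g <= 1 & N y <= \sum_i `|g i| * `|y i|.
Proof.
move=> iN sN y; have [g g1 gy] := exists_norming_functional iN sN y.
exists g; last first.
  apply: le_trans gy _; apply: ler_sum => i _.
  by rewrite -normrM ler_norm.
apply: dual_norm_le => // z Nz.
apply: le_trans Nz.
have -> : N z = N (fun i => if 0 <= g i then `|z i| else - `|z i|).
  by apply: ideal_norm_abs => // i; case: ifP; rewrite ?normrN normr_id.
apply: le_trans (g1 _); apply: ler_sum => i _.
case: ifP => [h|/negbT]; first by rewrite ger0_norm.
by rewrite -ltNge => h; rewrite ltr0_norm// mulNr mulrN.
Qed.

(** For a test vector y, spread y over the family by y_k = y |g_k| / G where G is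
    the quadratic mean of the g_k.  Then sum_i G_i |y_i| = sum_k <|g_k|, |y_k|>,
    the quadratic mean of the y_k is at most |y|, and concavity of N bounds
    the norms of the y_k. *)
Lemma dual_norm_convex2 I (N : (I -> R) -> R) C : ideal_norm N -> 0 < C ->
  concave2 C N -> convex2 C (dual_norm N).
Proof.
move=> iN C0 cN K g; apply: dual_norm_le => // y Ny.
pose G := quadratic_mean g.
have G2 i : G i ^+ 2 = \sum_k g k i ^+ 2 by exact: sqr_sqrt_sum.
have G0 i : 0 <= G i by exact: sqrtr_ge0.
(* where G vanishes all the g_k vanish, and the default inverse makes h vanish *)
pose h k i := g k i / G i.
have Gh i : G i * \sum_k h k i ^+ 2 = G i.
  under eq_bigr do rewrite exprMn.
  rewrite -mulr_suml -G2 -exprMn.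
  have [->|Gi] := eqVneq (G i) 0; first by rewrite mul0r.
  by rewrite mulfV// expr1n mulr1.
have -> : \sum_i `|quadratic_mean g i| * `|y i| =
    \sum_k \sum_i `|g k i| * `|y i * h k i|.
  rewrite exchange_big; apply: eq_bigr => i _ /=.
  rewrite -/(G i) ger0_norm// -{1}(Gh i) mulr_sumr mulr_suml.
  apply: eq_bigr => k _; rewrite /h normrM normf_div (ger0_norm (G0 i)).
  have [->|Gi] := eqVneq (G i) 0; first by rewrite invr0 !(mulr0,mul0r).
  rewrite exprMn -real_normK ?num_real// exprVn; field; exact: Gi.
apply: le_trans (_ : \sum_k dual_norm N (g k) * N (fun i => y i * h k i) <= _).
  by apply: ler_sum => k _; exact: pairing_le.
apply: le_trans (cauchy_schwarz_sqrt _ _) _; rewrite mulrC ler_wpM2r ?sqrtr_ge0//.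
apply: le_trans (cN _ _) _; rewrite -[leRHS]mulr1 ler_wpM2l ?(ltW C0)//.
apply: le_trans Ny; apply: (ideal_mono iN) => i.
rewrite [leLHS]ger0_norm ?sqrtr_ge0// -sqrtr_sqr ler_sqrt ?sqr_ge0//.
under eq_bigr do rewrite exprMn; rewrite -mulr_sumr ler_piMr ?sqr_ge0//.
have [Gi|Gi] := eqVneq (G i) 0; last first.
  by rewrite -[leLHS]mul1r -(mulVf Gi) -mulrA Gh mulVf.
by rewrite big1 ?ler01// => k _; rewrite /h Gi invr0 mulr0 expr0n.
Qed.

(** The best t gives 2 a <= 2 sqrt (p q); p and q are perturbed by e > 0 so that
    this t exists. *)
Lemma sqr_le_of_amgm (a p q : R) : 0 <= p -> 0 <= q ->
  (forall t, 0 < t -> 2 * a <= t ^+ 2 * p + t^-1 ^+ 2 * q) ->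
  0 <= a -> a ^+ 2 <= p * q.
Proof.
move=> p0 q0 h a0.
have le_e e : 0 < e -> 2 * a <= 2 * Num.sqrt ((p + e) * (q + e)).
  move=> e0; have pe : 0 < p + e by lra.
  have qe : 0 < q + e by lra.
  pose t := Num.sqrt (Num.sqrt (q + e) / Num.sqrt (p + e)).
  have t0 : 0 < t by rewrite sqrtr_gt0 divr_gt0// sqrtr_gt0.
  apply: le_trans (h t t0) _.
  have t2 : t ^+ 2 = Num.sqrt (q + e) / Num.sqrt (p + e).
    by rewrite sqr_sqrtr// divr_ge0// sqrtr_ge0.
  rewrite exprVn t2 invf_div sqrtrM ?(ltW pe)//.
  have sp : Num.sqrt (p + e) ^+ 2 = p + e by rewrite sqr_sqrtr// ltW.
  have sq : Num.sqrt (q + e) ^+ 2 = q + e by rewrite sqr_sqrtr// ltW.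
  have sp0 : 0 < Num.sqrt (p + e) by rewrite sqrtr_gt0.
  have sq0 : 0 < Num.sqrt (q + e) by rewrite sqrtr_gt0.
  move: (Num.sqrt (p + e)) (Num.sqrt (q + e)) sp sq sp0 sq0 => P Q PE QE P0 Q0.
  have -> : 2 * (P * Q) = Q / P * P ^+ 2 + P / Q * Q ^+ 2.
    by field; rewrite !gt_eqF.
  rewrite PE QE lerD// ler_wpM2l ?divr_ge0 ?(ltW P0) ?(ltW Q0)//; lra.
have {}le_e e : 0 < e -> a ^+ 2 <= (p + e) * (q + e).
  move=> e0; have E0 : 0 <= (p + e) * (q + e) by rewrite mulr_ge0//; lra.
  rewrite -[leRHS](sqr_sqrtr E0) ler_sqr ?nnegrE ?sqrtr_ge0//.
  by have := le_e e e0; lra.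
apply/ler_addgt0Pr => d d0.
pose e := Num.min 1 (d / (p + q + 1)).
have s0 : 0 < p + q + 1 by lra.
have e0 : 0 < e by rewrite lt_min ltr01 divr_gt0.
have e1 : e <= 1 by rewrite ge_min lexx.
have e2 : e * (p + q + 1) <= d by rewrite -ler_pdivlMr// ge_min lexx orbT.
by have := le_e e e0; nra.
Qed.

(** For a unit vector x of l_2, a factorization |x|^2 <= C^2 phi w with phi a
    weight and w in the polar of the weights, so that N(sqrt w) <= C.  The set
    of pairs (phi, w) with sqrt (phi_i w_i) >= |x_i| / C is convex: it is cut
    out by the inequalities 2 |x_i| / C <= t phi_i + w_i / t, t > 0.  For a combination with
    coefficients T on phi and W on w, take phi norming sqrt T, and w
    proportional to T; the arithmetic-geometric inequality concludes. *)
Lemma lozanovskii I (N : (I -> R) -> R) C : ideal_norm N -> 0 < C ->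
  convex2 C N -> forall x : I -> R,
  exists phi, exists e : I -> R, [/\ weights N phi,
    forall i, x i ^+ 2 <= phi i * e i ^+ 2, forall i, 0 <= e i &
    N e <= C ^+ 2 * Num.sqrt (\sum_i x i ^+ 2)].
Proof.
move=> iN C0 cN x0.
pose nx : R := Num.sqrt (\sum_i x0 i ^+ 2).
have nx2 : nx ^+ 2 = \sum_i x0 i ^+ 2 by exact: sqr_sqrt_sum.
have nx0 : 0 <= nx by exact: sqrtr_ge0.
pose x i := x0 i / nx.
have xx0 i : x0 i = nx * x i.
  rewrite /x mulrCA; have [n0|n0] := eqVneq nx 0; last by rewrite mulfV// mulr1.
  rewrite n0 mul0r mulr0; have /eqP := nx2; rewrite n0 expr0n/= eq_sym psumr_eq0.
    by move=> /allP/(_ i (mem_index_enum _)); rewrite sqrf_eq0 => /eqP.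
  by move=> k _; exact: sqr_ge0.
have x1 : \sum_i x i ^+ 2 <= 1.
  under eq_bigr do rewrite exprMn; rewrite -mulr_suml -nx2 -exprMn.
  have [->|n0] := eqVneq nx 0; first by rewrite mul0r expr0n ler01.
  by rewrite mulfV// expr1n.
clearbody x.
rewrite -/nx; clearbody nx.
pose S : set {ptws (I + I) -> R} := [set s : {ptws (I + I) -> R} | weights N (s \o inl) /\
   (forall i, 0 <= s (inr i)) /\
   forall phi, weights N phi -> \sum_i phi i * s (inr i) <= 1].
have Scc : closed_convex S.
  apply: closed_convexI; first exact: closed_convex_weights.
  apply: closed_convexI; first exact: closed_convex_ge0.
  apply: closed_convex_bigcap => phi.
  have [wp|nwp] := pselect (weights N phi).
    have := closed_convex_halfspace (@inr I I) phi (-1).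
    congr closed_convex; rewrite predeqE => s /=; rewrite /affine_fun subr_le0.
    by split => // /(_ wp).
  rewrite [X in closed_convex X](_ : _ = setT); last by rewrite predeqE.
  by split; [exact: closedT|].
have ncv := exists_norming_weight iN C0 cN.
(* the weight norming the unit vector at i has a positive entry at i, which bounds w_i *)
have w_bound s : S s -> forall i, s (inr i) <= C ^+ 2 / N (unit_vec R i) ^+ 2.
  move=> [_ [s0 s1]] i; have u0 := ideal_unit iN i.
  have [phi wphi] := ncv (unit_vec R i).
  rewrite (_ : \sum_j _ = phi i); last first.
    rewrite -[RHS](sum_unit_vec phi i); apply: eq_bigr => j _; rewrite /unit_vec.
    by case: eqP => _; rewrite ?expr1n ?expr0n.
  move=> Nphi; rewrite ler_pdivlMr ?exprn_gt0//.
  apply: le_trans (ler_wpM2l (s0 i) Nphi) _; rewrite mulrCA ler_piMr ?sqr_ge0//.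
  apply: le_trans (s1 _ wphi); rewrite mulrC (bigD1 i)//= lerDl.
  by apply: sumr_ge0 => j _; rewrite mulr_ge0// wphi.1.
have Scomp : compact S.
  apply: (bounded_closed_convex_compact (a := fun=> 0) (b := fun k => match k with
    | inl i => N (unit_vec R i) ^+ 2 | inr i => C ^+ 2 / N (unit_vec R i) ^+ 2 end) Scc).
  move=> s Ss [i|i]; first by have := weights_bound i Ss.1.
  by rewrite Ss.2.1 w_bound.
pose c (ab : (I -> R) * (I -> R)) (k : I + I) := match k with
    | inl i => - ab.1 i ^+ 2 | inr i => - ab.2 i ^+ 2 end.
pose b (ab : (I -> R) * (I -> R)) := 2 * C^-1 * \sum_i `|x i| * `|ab.1 i * ab.2 i|.
have [|s [wphi [w0 w1]] sP] := minimax (c := c) (b := b) Scomp Scc.2; last first.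
  have xle i : (C^-1 * `|x i|) ^+ 2 <= s (inl i) * s (inr i).
    apply: sqr_le_of_amgm; [exact: (wphi.1 i)|exact: w0| |by rewrite mulr_ge0 ?invr_ge0 ?(ltW C0)].
    move=> t t0; have := sP (fun j => t * unit_vec R i j, fun j => t^-1 * unit_vec R i j).
    rewrite /affine_fun /b /c big_sumType/=.
    have h f (r : R) : \sum_j - (r * unit_vec R i j) ^+ 2 * f j = - (r ^+ 2 * f i).
      rewrite -(sum_unit_vec (fun j => - (r ^+ 2 * f j)) i); apply: eq_bigr => j _.
      by rewrite /unit_vec; case: eqP => _ /=; ring.
    rewrite (h (fun j => s (inl j))) (h (fun j => s (inr j))).
    rewrite (_ : \sum_j _ = `|x i|); first by lra.
    rewrite -(sum_unit_vec (fun j => `|x j|) i); apply: eq_bigr => j _; congr (_ * _).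
    rewrite /unit_vec; case: eqP => _ /=; last by rewrite !mulr0 normr0.
    by rewrite !mulr1 mulfV ?normr1// gt_eqF.
  exists (fun i => s (inl i)), (fun i => nx * C * Num.sqrt (s (inr i))); split => //.
  - move=> i; rewrite (xx0 i) !exprMn sqr_sqrtr ?w0//.
    have := xle i; rewrite exprMn real_normK ?num_real// exprVn mulrC.
    rewrite ler_pdivrMr ?exprn_gt0// => h.
    have h2 := ler_wpM2l (sqr_ge0 nx) h.
    apply: le_trans h2 _.
    rewrite le_eqVlt; apply/orP; left; apply/eqP; ring.
  - by move=> i; rewrite !mulr_ge0 ?sqrtr_ge0 ?(ltW C0).
  rewrite (ideal_homo iN); last by rewrite mulr_ge0 ?(ltW C0).
  have [phi wp Np] := ncv (fun i => Num.sqrt (s (inr i))).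
  have : N (fun i => Num.sqrt (s (inr i))) ^+ 2 <= C ^+ 2.
    apply: le_trans Np _; rewrite ler_piMr ?sqr_ge0//; apply: le_trans (w1 _ wp).
    by apply: ler_sum => i _; rewrite sqr_sqrtr.
  have N0 := ideal_norm_ge0 (fun i => Num.sqrt (s (inr i))) iN.
  rewrite ler_sqr ?nnegrE ?(ltW C0)// => NC.
  have := ler_wpM2l (mulr_ge0 nx0 (ltW C0)) NC; lra.
move=> m j t t0.
pose T i := \sum_k t k * (j k).1 i ^+ 2.
pose W i := \sum_k t k * (j k).2 i ^+ 2.
have T0 i : 0 <= T i by apply: sumr_ge0 => k _; rewrite mulr_ge0 ?sqr_ge0.
have W0 i : 0 <= W i by apply: sumr_ge0 => k _; rewrite mulr_ge0 ?sqr_ge0.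
pose p := N (fun i => Num.sqrt (T i)) ^+ 2.
have p0 : 0 <= p by exact: sqr_ge0.
have [phi wphi] := ncv (fun i => Num.sqrt (T i)); rewrite -/p => pphi.
have {}pphi : p / C ^+ 2 <= \sum_i phi i * T i.
  rewrite ler_pdivrMr ?exprn_gt0// mulrC; apply: le_trans pphi _.
  rewrite ler_wpM2l ?sqr_ge0//; apply: ler_sum => i _.
  by rewrite sqr_sqrtr.
(* p = 0 forces T = 0, and then w = 0 by the default inverse *)
pose w i := T i / p.
have Tw i : T i = p * w i.
  rewrite /w mulrCA; have [pp|pp] := eqVneq p 0; last by rewrite mulfV// mulr1.
  rewrite pp mul0r mulr0; have /eqP := pp; rewrite sqrf_eq0 => /eqP Np.
  have := ideal_norm_coord (fun i => Num.sqrt (T i)) i iN.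
  rewrite Np pmulr_lle0 ?(ideal_unit iN)// normr_le0 sqrtr_eq0 => h.
  by apply/eqP; rewrite eq_le h T0.
have w0 i : 0 <= w i by rewrite divr_ge0.
exists (fun k => match k with inl i => phi i | inr i => w i end).
  split; [exact: wphi|split=> //] => psi [psi0 wpsi] /=.
  have := wpsi (fun i => Num.sqrt (T i)); rewrite -/p.
  have -> : \sum_i psi i * Num.sqrt (T i) ^+ 2 = p * \sum_i psi i * w i.
    rewrite mulr_sumr; apply: eq_bigr => i _; rewrite sqr_sqrtr// Tw; ring.
  have [pp _|pp] := eqVneq p 0; last by rewrite ger_pMr// lt_neqAle eq_sym pp.
  by rewrite big1 ?ler01// => i _; rewrite /w pp invr0 !mulr0.
have -> : \sum_k t k * affine_fun (c (j k)) (b (j k))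
      (fun k0 => match k0 with inl i => phi i | inr i => w i end) =
    2 * C^-1 * \sum_k \sum_i t k * (`|x i| * `|(j k).1 i * (j k).2 i|)
    - \sum_i phi i * T i - \sum_i w i * W i.
  transitivity (\sum_k (2 * C^-1 * \sum_i t k * (`|x i| * `|(j k).1 i * (j k).2 i|)
     - \sum_i phi i * (t k * (j k).1 i ^+ 2) - \sum_i w i * (t k * (j k).2 i ^+ 2))).
    apply: eq_bigr => k _; rewrite /affine_fun big_sumType/= /b.
    transitivity (t k * (2 * C^-1 * \sum_i `|x i| * `|(j k).1 i * (j k).2 i|)
      + t k * (\sum_i - (j k).1 i ^+ 2 * phi i)
      + t k * (\sum_i - (j k).2 i ^+ 2 * w i)); first by ring.
    congr (_ + _ + _).
    - by rewrite -mulr_sumr; ring.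
    - by rewrite mulr_sumr -sumrN; apply: eq_bigr => i _; ring.
    - by rewrite mulr_sumr -sumrN; apply: eq_bigr => i _; ring.
  rewrite !sumrB -mulr_sumr; congr (_ - _ - _).
    by rewrite exchange_big/=; apply: eq_bigr => i _; rewrite mulr_sumr.
  by rewrite exchange_big/=; apply: eq_bigr => i _; rewrite mulr_sumr.
have step i : \sum_k t k * `|(j k).1 i * (j k).2 i| <= Num.sqrt (T i) * Num.sqrt (W i).
  have := cauchy_schwarz_sqrt (fun k => Num.sqrt (t k) * `|(j k).1 i|)
                              (fun k => Num.sqrt (t k) * `|(j k).2 i|).
  rewrite (eq_bigr (fun k => t k * `|(j k).1 i * (j k).2 i|)); last first.
    by move=> k _; rewrite normrM -{3}(sqr_sqrtr (t0 k)); ring.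
  have sq (f : 'I_m -> R) : \sum_k (Num.sqrt (t k) * `|f k|) ^+ 2 = \sum_k t k * f k ^+ 2.
    by apply: eq_bigr => k _; rewrite exprMn sqr_sqrtr// real_normK ?num_real.
  by rewrite !sq.
pose q := \sum_i w i * W i.
have q0 : 0 <= q by apply: sumr_ge0 => i _; rewrite mulr_ge0.
have le1 : \sum_k \sum_i t k * (`|x i| * `|(j k).1 i * (j k).2 i|) <= Num.sqrt (p * q).
  rewrite exchange_big/=.
  apply: le_trans (_ : \sum_i `|x i| * (Num.sqrt (T i) * Num.sqrt (W i)) <= _).
    apply: ler_sum => i _.
    rewrite (eq_bigr (fun k => `|x i| * (t k * `|(j k).1 i * (j k).2 i|))).
      by rewrite -mulr_sumr ler_wpM2l.
    by move=> k _; ring.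
  apply: le_trans (cauchy_schwarz_sqrt _ _) _.
  rewrite -[leRHS]mul1r; apply: ler_pM; rewrite ?sqrtr_ge0//.
    rewrite -[leRHS]sqrtr1 ler_sqrt ?ler01//.
    by under eq_bigr do rewrite real_normK ?num_real//.
  have pq0 : 0 <= p * q by rewrite mulr_ge0.
  rewrite ler_sqrt// /q mulr_sumr; apply: ler_sum => i _.
  by rewrite exprMn !sqr_sqrtr// Tw mulrA.
have le2 : 2 * C^-1 * Num.sqrt (p * q) <= p / C ^+ 2 + q.
  rewrite sqrtrM//.
  rewrite -[in leRHS](sqr_sqrtr p0) -[X in _ + X](sqr_sqrtr q0).
  rewrite -subr_ge0 (_ : _ - _ = (Num.sqrt p / C - Num.sqrt q) ^+ 2) ?sqr_ge0//.
  by field; rewrite gt_eqF.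
have C0' : 0 <= 2 * C^-1 by rewrite mulr_ge0// invr_ge0 ltW.
have := ler_wpM2l C0' le1; rewrite -/q; lra.
Qed.

End duality.
(** * Grothendieck's inequality *)

Section rademacher.
Context {R : realType} {W : finType}.
Implicit Types (e : {ffun W -> bool}) (u v : W -> R) (s : seq W).

Definition sign_of e w : R := (-1) ^+ e w.

Definition sign_mean (F : {ffun W -> bool} -> R) : R :=
  (\sum_e F e) / #|{ffun W -> bool}|%:R.

(** The random variable sum_w (+-1) u_w over independent uniform signs.  The sum
    runs over a sequence so that moments are computed one sign at a time. *)
Definition rademacher s u e : R := \sum_(w <- s) sign_of e w * u w.

Let card_signs : 0 < #|{ffun W -> bool}|%:R :> R.
Proof. by rewrite ltr0n; apply/card_gt0P; exists [ffun=> true]. Qed.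

Lemma sign_mean_le F G : (forall e, F e <= G e) -> sign_mean F <= sign_mean G.
Proof. by move=> FG; rewrite ler_pM2r ?invr_gt0//; exact: ler_sum. Qed.

Lemma sign_meanD F G : sign_mean (fun e => F e + G e) = sign_mean F + sign_mean G.
Proof. by rewrite /sign_mean big_split/= mulrDl. Qed.

Lemma sign_meanZ (a : R) F : sign_mean (fun e => a * F e) = a * sign_mean F.
Proof. by rewrite /sign_mean -mulr_sumr mulrA. Qed.

Lemma sign_mean_cst (a : R) : sign_mean (fun=> a) = a.
Proof.
rewrite /sign_mean; have -> : \sum_(e : {ffun W -> bool}) a = a * #|{ffun W -> bool}|%:R.
  by rewrite sumr_const mulr_natr.
by rewrite mulfK// gt_eqF.
Qed.

Lemma sign_mean_sum (K : finType) (F : K -> {ffun W -> bool} -> R) :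
  sign_mean (fun e => \sum_k F k e) = \sum_k sign_mean (F k).
Proof. by rewrite /sign_mean exchange_big/= mulr_suml. Qed.

Definition flip (w : W) e : {ffun W -> bool} := [ffun w' => e w' (+) (w' == w)].

Lemma flipK w : involutive (flip w).
Proof. by move=> e; apply/ffunP => w'; rewrite !ffunE -addbA addbb addbF. Qed.

Lemma sign_of_flip w e : sign_of (flip w e) w = - sign_of e w.
Proof. by rewrite /sign_of ffunE eqxx addbT; case: (e w); rewrite ?expr0 ?expr1 ?opprK. Qed.

Lemma rademacher_flip w s u e : w \notin s ->
  rademacher s u (flip w e) = rademacher s u e.
Proof.
move=> ws; apply: eq_big_seq => w' w's; rewrite /sign_of ffunE.
by case: eqP => [ww|_]; [move: ws; rewrite -ww w's|rewrite addbF].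
Qed.

(** Averaging over the sign at w, by the measure preserving involution that flips
    it. *)
Lemma sign_mean_flip w F :
  sign_mean F = sign_mean (fun e => (F e + F (flip w e)) / 2).
Proof.
have flipE : sign_mean (fun e => F (flip w e)) = sign_mean F.
  congr (_ / _); rewrite [RHS](reindex_inj (inv_inj (flipK w))).
  exact: eq_bigr.
under [X in _ = sign_mean X]eq_fun do rewrite mulrC.
by rewrite sign_meanZ sign_meanD flipE; lra.
Qed.

Lemma sign_of_sqr e w : sign_of e w ^+ 2 = 1.
Proof. by rewrite /sign_of sqrr_sign. Qed.

Lemma rademacher_cons w s u e :
  rademacher (w :: s) u e = sign_of e w * u w + rademacher s u e.
Proof. by rewrite /rademacher big_cons. Qed.

Lemma rademacher_orthogonal s u v : uniq s ->
  sign_mean (fun e => rademacher s u e * rademacher s v e) = \sum_(w <- s) u w * v w.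
Proof.
elim: s => [_|w s IH /= /andP[ws us]].
  under eq_fun do rewrite /rademacher !big_nil mul0r.
  by rewrite sign_mean_cst big_nil.
rewrite big_cons -(IH us) -(sign_mean_cst (u w * v w)) -sign_meanD.
rewrite (sign_mean_flip w); congr sign_mean; apply/funext => e.
rewrite !rademacher_cons !rademacher_flip// sign_of_flip.
have := sign_of_sqr e w; move: (sign_of e w) => x x2.
transitivity (x ^+ 2 * (u w * v w) + rademacher s u e * rademacher s v e).
  by field.
by rewrite x2 mul1r.
Qed.

(** Adding a coefficient b to a sum with second moment S and fourth moment m turns
    m into m + 6 b^2 S + b^4, and 3 S^2 + 6 b^2 S + b^4 <= 3 (S + b^2)^2. *)
Lemma rademacher_moment4 s u : uniq s ->
  sign_mean (fun e => rademacher s u e ^+ 4) <= 3 * (\sum_(w <- s) u w ^+ 2) ^+ 2.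
Proof.
elim: s => [_|w s IH /= /andP[ws us]].
  under eq_fun do rewrite /rademacher !big_nil expr0n.
  by rewrite sign_mean_cst big_nil expr0n mulr0.
rewrite big_cons (sign_mean_flip w).
rewrite (_ : (fun e => _) = fun e => rademacher s u e ^+ 4 +
    (6 * u w ^+ 2 * (rademacher s u e * rademacher s u e) + u w ^+ 4)); last first.
  apply/funext => e; rewrite !rademacher_cons !rademacher_flip// sign_of_flip.
  have := sign_of_sqr e w; move: (sign_of e w) (rademacher s u e) => x y x2.
  transitivity (y ^+ 4 + 6 * (x ^+ 2 * u w ^+ 2) * y ^+ 2
      + (x ^+ 2) ^+ 2 * u w ^+ 4); first by field.
  by rewrite x2; ring.
rewrite !sign_meanD sign_meanZ sign_mean_cst rademacher_orthogonal//.
have -> : \sum_(w' <- s) u w' * u w' = \sum_(w' <- s) u w' ^+ 2.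
  by apply: eq_bigr => w' _; rewrite expr2.
have := IH us; have := sqr_ge0 (u w); set S := \sum_(_ <- _) _.
move: (sign_mean _) (u w) => m b b0 mS.
have : 0 <= b ^+ 4 by rewrite -[4%N]/(2 * 2)%N exprM sqr_ge0.
rewrite (_ : 3 * (b ^+ 2 + S) ^+ 2 = 3 * S ^+ 2 + 6 * b ^+ 2 * S + 3 * b ^+ 4); last by ring.
by lra.
Qed.

End rademacher.

Section grothendieck.
Context {R : realType} {I J : finType} (a : I -> J -> R).

Definition bilin (x : J -> R) (y : I -> R) : R := \sum_i \sum_j a i j * (x j * y i).

Definition clamp (T x : R) : R := Num.max (- T) (Num.min x T).

Lemma clamp_norm T x : 0 <= T -> `|clamp T x| <= T.
Proof.
move=> T0; rewrite /clamp ler_norml.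
by case: (leP x T) => h1; [case: (leP (- T) x)|case: (leP (- T) T)] => h2; apply/andP; split; lra.
Qed.

Lemma clamp_sqr_le T x : 0 <= T -> clamp T x ^+ 2 <= x ^+ 2.
Proof.
by move=> T0; rewrite /clamp; case: (leP x T) => h1; [case: (leP (- T) x)|case: (leP (- T) T)] => h2; nra.
Qed.

Lemma clamp_remainder T x : 0 < T -> (x - clamp T x) ^+ 2 <= x ^+ 4 / T ^+ 2.
Proof.
move=> T0; rewrite ler_pdivlMr ?exprn_gt0// -exprMn (_ : x ^+ 4 = (x ^+ 2) ^+ 2).
  rewrite /clamp -real_normK ?num_real// ler_sqr ?nnegrE ?sqr_ge0 ?normr_ge0//.
  by rewrite ler_norml; case: (leP x T) => h1; [case: (leP (- T) x)|case: (leP (- T) T)] => h2;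
    apply/andP; split; nra.
by ring.
Qed.

(** The bound B holds for the matrices of scalar products of vectors of norm at
    most 1 in Euclidean spaces of every dimension: the step below raises the dimension
    from |W| to 2^|W|. *)
Definition gram_bound (B : R) := forall (W : finType) (u : J -> W -> R) (v : I -> W -> R),
  (forall j, \sum_w u j w ^+ 2 <= 1) -> (forall i, \sum_w v i w ^+ 2 <= 1) ->
  \sum_w bilin (u ^~ w) (v ^~ w) <= B.

Lemma bilinDl x x' y : bilin (fun j => x j + x' j) y = bilin x y + bilin x' y.
Proof.
rewrite /bilin -big_split/=; apply: eq_bigr => i _; rewrite -big_split/=.
by apply: eq_bigr => j _; ring.
Qed.

Lemma bilinDr x y y' : bilin x (fun j => y j + y' j) = bilin x y + bilin x y'.
Proof.
rewrite /bilin -big_split/=; apply: eq_bigr => i _; rewrite -big_split/=.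
by apply: eq_bigr => j _; ring.
Qed.

Lemma bilinZ (s t : R) x y :
  bilin (fun j => s * x j) (fun i => t * y i) = s * t * bilin x y.
Proof.
rewrite /bilin mulr_sumr; apply: eq_bigr => i _; rewrite mulr_sumr.
by apply: eq_bigr => j _; ring.
Qed.

Variable c : R.
Hypothesis a_le : forall x y, (forall j, `|x j| <= 1) -> (forall i, `|y i| <= 1) ->
  bilin x y <= c.

Lemma bilin_bound_ge0 : 0 <= c.
Proof.
have := a_le (x := fun=> 0) (y := fun=> 0); rewrite normr0 ler01.
have -> : bilin (fun=> 0) (fun=> 0) = 0.
  by rewrite /bilin big1// => i _; rewrite big1// => j _; rewrite !mulr0.
by apply.
Qed.

Lemma gram_bound_trivial : gram_bound (\sum_i \sum_j `|a i j|).
Proof.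
move=> W u v hu hv; rewrite exchange_big/=; apply: ler_sum => i _.
rewrite exchange_big/=; apply: ler_sum => j _; rewrite -mulr_sumr.
apply: le_trans (ler_norm _) _; rewrite normrM ler_piMr//.
rewrite -[leRHS]normr1 -ler_sqr ?nnegrE// !real_normK ?num_real//.
apply: le_trans (cauchy_schwarz _ _) _; rewrite expr1n.
by rewrite mulr_ile1// sumr_ge0// => w _; exact: sqr_ge0.
Qed.

(** The mean over signs is a scalar product, up to the normalization of the
    counting measure. *)
Lemma gram_bound_mean B (W : finType)
    (f : J -> {ffun W -> bool} -> R) (g : I -> {ffun W -> bool} -> R) :
  gram_bound B ->
  (forall j, sign_mean (fun e => f j e ^+ 2) <= 1) ->
  (forall i, sign_mean (fun e => g i e ^+ 2) <= 1) ->
  sign_mean (fun e => bilin (f ^~ e) (g ^~ e)) <= B.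
Proof.
move=> HB hf hg; pose N : R := #|{ffun W -> bool}|%:R.
have N0 : 0 < N by rewrite ltr0n; apply/card_gt0P; exists [ffun=> true].
pose r := Num.sqrt N^-1.
have r2 : r * r = N^-1 by rewrite -expr2 sqr_sqrtr// invr_ge0 ltW.
have sq (h : {ffun W -> bool} -> R) :
    \sum_e (r * h e) ^+ 2 = sign_mean (fun e => h e ^+ 2).
  rewrite /sign_mean mulrC -/N -r2 mulr_sumr; apply: eq_bigr => e _; ring.
have := HB _ (fun j e => r * f j e) (fun i e => r * g i e)
  (fun j => eq_ind_r (fun s => s <= 1) (hf j) (sq (f j)))
  (fun i => eq_ind_r (fun s => s <= 1) (hg i) (sq (g i))).
rewrite /sign_mean mulrC -/N -r2 mulr_sumr.
by under eq_bigr do rewrite bilinZ.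
Qed.

(** Represent the vectors by Rademacher sums f_j and g_i, and truncate them at
    height 7.  The product of two truncations costs 7^2 c.  Fourth moments
    bound the square norm of a remainder by 3 / 49 <= 1 / 16, so each of the two
    remaining terms costs at most B / 4. *)
Lemma gram_bound_step B : gram_bound B -> gram_bound (49 * c + B / 2).
Proof.
move=> HB W u v hu hv.
pose f j e := rademacher (index_enum W) (u j) e.
pose g i e := rademacher (index_enum W) (v i) e.
pose kf j e := clamp 7 (f j e); pose kg i e := clamp 7 (g i e).
have uW : uniq (index_enum W) by exact: index_enum_uniq.
have T0 : 0 <= 7 :> R by lra.
have -> : \sum_w bilin (u ^~ w) (v ^~ w) = sign_mean (fun e => bilin (f ^~ e) (g ^~ e)).
  rewrite /bilin sign_mean_sum exchange_big; apply: eq_bigr => i _ /=.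
  rewrite sign_mean_sum exchange_big; apply: eq_bigr => j _ /=.
  by rewrite sign_meanZ rademacher_orthogonal// mulr_sumr.
have -> : (fun e => bilin (f ^~ e) (g ^~ e)) = fun e => bilin (kf ^~ e) (kg ^~ e)
    + (4^-1 * bilin (kf ^~ e) (fun i => 4 * (g i e - kg i e))
    + 4^-1 * bilin (fun j => 4 * (f j e - kf j e)) (g ^~ e)).
  apply/funext => e.
  rewrite -[in LHS](_ : (fun j => kf j e + (f j e - kf j e)) = f ^~ e); last first.
    by apply/funext => j; ring.
  have -> : bilin (fun j => 4 * (f j e - kf j e)) (g ^~ e)
      = 4 * bilin (fun j => f j e - kf j e) (g ^~ e).
    have := bilinZ 4 1 (fun j => f j e - kf j e) (g ^~ e).
    by under [X in bilin _ X]eq_fun do rewrite mul1r; rewrite mulr1.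
  have -> : bilin (kf ^~ e) (fun i => 4 * (g i e - kg i e))
      = 4 * bilin (kf ^~ e) (fun i => g i e - kg i e).
    have := bilinZ 1 4 (kf ^~ e) (fun i => g i e - kg i e).
    by under [X in bilin X _]eq_fun do rewrite mul1r; rewrite mul1r.
  rewrite bilinDl !mulKf// addrA -bilinDr; congr (bilin _ _ + _).
  by apply/funext => i; ring.
rewrite !sign_meanD !sign_meanZ.
have le0 : sign_mean (fun e => bilin (kf ^~ e) (kg ^~ e)) <= 49 * c.
  rewrite -(sign_mean_cst (W := W) (49 * c)); apply: sign_mean_le => e.
  have -> : bilin (kf ^~ e) (kg ^~ e) =
      49 * bilin (fun j => 7^-1 * kf j e) (fun i => 7^-1 * kg i e).
    by rewrite bilinZ; field.
  rewrite ler_wpM2l//; apply: a_le => k; rewrite normrM ger0_norm ?invr_ge0//;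
    by rewrite mulrC ler_pdivrMr// mul1r clamp_norm.
have small (K : finType) (z : K -> W -> R) : (forall k, \sum_w z k w ^+ 2 <= 1) ->
    forall k, sign_mean (fun e => (rademacher (index_enum W) (z k) e) ^+ 2) <= 1.
  move=> hz k; apply: le_trans (hz k).
  under eq_fun do rewrite expr2.
  by rewrite rademacher_orthogonal//; under eq_bigr do rewrite -expr2.
have smallk (K : finType) (z : K -> W -> R) : (forall k, \sum_w z k w ^+ 2 <= 1) ->
    forall k, sign_mean (fun e => clamp 7 (rademacher (index_enum W) (z k) e) ^+ 2) <= 1.
  move=> hz k; apply: le_trans (small _ z hz k); apply: sign_mean_le => e.
  exact: clamp_sqr_le.
have rest (K : finType) (z : K -> W -> R) : (forall k, \sum_w z k w ^+ 2 <= 1) ->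
    forall k, sign_mean (fun e => (4 * (rademacher (index_enum W) (z k) e
      - clamp 7 (rademacher (index_enum W) (z k) e))) ^+ 2) <= 1.
  move=> hz k.
  apply: le_trans (_ : sign_mean (fun e => 16 / 49 * rademacher (index_enum W) (z k) e ^+ 4) <= _).
    apply: sign_mean_le => e; move: (rademacher _ _ _) => x.
    by have := @clamp_remainder 7 x; rewrite ltr0n => /(_ isT); rewrite exprMn; lra.
  rewrite sign_meanZ; have := rademacher_moment4 (z k) uW; have := hz k.
  have : 0 <= \sum_(w <- index_enum W) z k w ^+ 2.
    by apply: sumr_ge0 => w _; exact: sqr_ge0.
  set S := \sum_(_ <- _) _; set E := sign_mean _; nra.
have := gram_bound_mean HB (smallk _ _ hu) (rest _ _ hv).
have := gram_bound_mean HB (rest _ _ hu) (small _ _ hv).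
rewrite -/f -/g; move: le0; rewrite /kf /kg /f /g; lra.
Qed.

(** The map B |-> 49 c + B / 2 has the fixed point 98 c; iterate it from the
    trivial bound. *)
Lemma grothendieck_inequality : gram_bound (98 * c).
Proof.
have c0 := bilin_bound_ge0.
pose B0 := \sum_i \sum_j `|a i j|.
have B00 : 0 <= B0 by apply: sumr_ge0 => i _; apply: sumr_ge0.
have H n : gram_bound (98 * c + B0 / 2 ^+ n).
  elim: n => [|n /gram_bound_step IH W u v hu hv].
    move=> W u v hu hv; apply: le_trans (gram_bound_trivial hu hv) _.
    by rewrite expr0 divr1 -/B0; lra.
  apply: le_trans (IH W u v hu hv) _; rewrite exprS invfM.
  have := exprn_gt0 n (ltr0Sn R 1); move: (2 ^+ n) => z z0; lra.
move=> W u v hu hv; apply/ler_addgt0Pr => e e0.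
pose n := Num.truncn (B0 / e).
apply: le_trans (H n.+1 W u v hu hv) _; rewrite lerD2l.
rewrite ler_pdivrMr ?exprn_gt0// mulrC -ler_pdivrMr//.
apply: le_trans (ltW (truncnS_gt _)) _; rewrite -natrX ler_nat.
exact: ltnW (ltn_expl _ _).
Qed.

End grothendieck.

(** * Factorization of bilinear forms through Hilbert space *)

Section factorization.
Context {R : realType} {I J : finType}.

(** Grothendieck's inequality in the form used by Maurey and Krivine.  The pair
    (phi, psi) must satisfy 2 a(x, y) <= L (sum phi x^2 + sum psi y^2) for all x
    and y, with L the constant of the statement.  A combination over a family
    (x_k, y_k) is solvable: with X and Y the quadratic means of the family,
    sum_k a(x_k, y_k) is a Gram form of the matrix a_ij X_j Y_i, hence at most
    98 d P(X) Q(Y), and weights norming X and Y conclude. *)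
Lemma grothendieck_factorization (a : I -> J -> R) P Q C D d :
  ideal_norm P -> ideal_norm Q -> 0 < C -> 0 < D -> 0 < d -> convex2 C P -> convex2 D Q ->
  (forall x y, bilin a x y <= d * (P x * Q y)) ->
  exists phi, exists psi, [/\ weights P phi, weights Q psi &
    forall x y, bilin a x y <= 98 * C * D * d *
      (Num.sqrt (\sum_j phi j * x j ^+ 2) * Num.sqrt (\sum_i psi i * y i ^+ 2))].
Proof.
move=> iP iQ C0 D0 d0 cP cQ aPQ.
pose K := 98 * C * D * d.
have K0 : 0 < K by rewrite !mulr_gt0.
pose S : set {ptws (J + I) -> R} := [set s : {ptws (J + I) -> R} |
  weights P (s \o inl) /\ weights Q (s \o inr)].
have Scc : closed_convex S.
  by apply: closed_convexI; exact: closed_convex_weights.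
have Scomp : compact S.
  apply: (bounded_closed_convex_compact (a := fun=> 0) (b := fun k => match k with
    | inl i => P (unit_vec R i) ^+ 2 | inr i => Q (unit_vec R i) ^+ 2 end) Scc).
  by move=> s [w1 w2] [i|i]; [have := weights_bound i w1|have := weights_bound i w2].
pose c (xy : (J -> R) * (I -> R)) (k : J + I) := match k with
    | inl j => - (K * xy.1 j ^+ 2) | inr i => - (K * xy.2 i ^+ 2) end.
pose b (xy : (J -> R) * (I -> R)) := 2 * bilin a xy.1 xy.2.
have [|s [wphi wpsi] sP] := minimax (c := c) (b := b) Scomp Scc.2; last first.
  exists (s \o inl), (s \o inr); split=> // x y.
  have nn (T : finType) (f : T -> R) z : (forall i, 0 <= f i) -> 0 <= \sum_i f i * z i ^+ 2.
    by move=> f0; apply: sumr_ge0 => i _; rewrite mulr_ge0 ?sqr_ge0.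
  have p0 := nn _ _ x wphi.1; have q0 := nn _ _ y wpsi.1.
  have [neg|pos] := leP (bilin a x y) 0.
    apply: le_trans neg _.
    exact: (mulr_ge0 (ltW K0) (mulr_ge0 (sqrtr_ge0 _) (sqrtr_ge0 _))).
  rewrite -sqrtrM// -/K -ler_pdivrMl// -[leLHS]ger0_norm; last first.
    by rewrite mulr_ge0 ?invr_ge0 ?ltW.
  rewrite -sqrtr_sqr ler_sqrt ?mulr_ge0//.
  apply: sqr_le_of_amgm => //; last by rewrite mulr_ge0 ?invr_ge0 ?ltW.
  move=> t t0; have := sP (fun j => t * x j, fun i => t^-1 * y i).
  rewrite /affine_fun /b /c big_sumType/= bilinZ mulfV ?gt_eqF// mul1r.
  have h (T : finType) (f z : T -> R) (r : R) :
      \sum_j - (K * (r * z j) ^+ 2) * f j = - (K * (r ^+ 2 * \sum_j f j * z j ^+ 2)).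
    by rewrite !mulr_sumr -sumrN; apply: eq_bigr => j _; ring.
  rewrite (h _ (fun j => s (inl j))) (h _ (fun j => s (inr j))) /= => le.
  rewrite mulrCA ler_pdivrMl// mulrDr; move: le; rewrite /comp; lra.
move=> m j t t0.
pose x k := (j k).1; pose y k := (j k).2.
pose X i := Num.sqrt (\sum_k t k * x k i ^+ 2).
pose Y i := Num.sqrt (\sum_k t k * y k i ^+ 2).
have X2 i : X i ^+ 2 = \sum_k t k * x k i ^+ 2.
  by rewrite sqr_sqrtr// sumr_ge0// => k _; rewrite mulr_ge0 ?sqr_ge0.
have Y2 i : Y i ^+ 2 = \sum_k t k * y k i ^+ 2.
  by rewrite sqr_sqrtr// sumr_ge0// => k _; rewrite mulr_ge0 ?sqr_ge0.
have X0 i : 0 <= X i by exact: sqrtr_ge0.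
have Y0 i : 0 <= Y i by exact: sqrtr_ge0.
have [phi wphi nphi] := exists_norming_weight iP C0 cP X.
have [psi wpsi npsi] := exists_norming_weight iQ D0 cQ Y.
exists (fun k => match k with inl i => phi i | inr i => psi i end); first by split.
have -> : \sum_k t k * affine_fun (c (j k)) (b (j k))
      (fun k => match k with inl i => phi i | inr i => psi i end) =
    2 * (\sum_k t k * bilin a (x k) (y k))
    - K * (\sum_i phi i * X i ^+ 2) - K * (\sum_i psi i * Y i ^+ 2).
  transitivity (\sum_k (2 * (t k * bilin a (x k) (y k))
     - K * (\sum_i phi i * (t k * x k i ^+ 2)) - K * (\sum_i psi i * (t k * y k i ^+ 2)))).
    apply: eq_bigr => k _; rewrite /affine_fun big_sumType/= /b -/(x k) -/(y k).
    transitivity (2 * (t k * bilin a (x k) (y k))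
      + t k * (\sum_i - (K * x k i ^+ 2) * phi i)
      + t k * (\sum_i - (K * y k i ^+ 2) * psi i)); first by ring.
    by congr (_ + _ + _); rewrite !mulr_sumr -sumrN; apply: eq_bigr => i _; ring.
  rewrite !sumrB -!mulr_sumr; congr (_ - K * _ - K * _).
    by rewrite exchange_big/=; apply: eq_bigr => i _; rewrite X2 mulr_sumr.
  by rewrite exchange_big/=; apply: eq_bigr => i _; rewrite Y2 mulr_sumr.
(* Grothendieck's inequality for this matrix and the vectors of norm at most 1
   xi_i = (sqrt t_k x_k(i) / X_i)_k and eta_i = (sqrt t_k y_k(i) / Y_i)_k *)
pose b' i k := a i k * (X k * Y i).
have b'E u v : bilin b' u v = bilin a (fun k => u k * X k) (fun i => v i * Y i).
  by apply: eq_bigr => i _; apply: eq_bigr => k _; rewrite /b'; ring.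
have b'_le u v : (forall k, `|u k| <= 1) -> (forall i, `|v i| <= 1) ->
    bilin b' u v <= d * (P X * Q Y).
  move=> hu hv; rewrite b'E; apply: le_trans (aPQ _ _) _.
  rewrite ler_pM2l//; apply: ler_pM; rewrite ?ideal_norm_ge0//.
    by apply: (ideal_mono iP) => k; rewrite normrM ler_piMl.
  by apply: (ideal_mono iQ) => k; rewrite normrM ler_piMl.
have gr := grothendieck_inequality b'_le
  (u := fun i k => Num.sqrt (t k) * x k i / X i)
  (v := fun i k => Num.sqrt (t k) * y k i / Y i).
have nrm (T : finType) (z : 'I_m -> T -> R) (Z : T -> R) i :
    (Z i ^+ 2 = \sum_k t k * z k i ^+ 2) ->
    \sum_k (Num.sqrt (t k) * z k i / Z i) ^+ 2 <= 1.
  move=> Z2; rewrite (eq_bigr (fun k => t k * z k i ^+ 2 / Z i ^+ 2)); last first.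
    by move=> k _; rewrite !exprMn sqr_sqrtr// exprVn.
  rewrite -mulr_suml -Z2; have [->|zi] := eqVneq (Z i) 0.
    by rewrite expr0n mul0r ler01.
  by rewrite mulfV// sqrf_eq0.
have cancel (T : finType) (z : 'I_m -> T -> R) (Z : T -> R) i k :
    (Z i ^+ 2 = \sum_k t k * z k i ^+ 2) ->
    Num.sqrt (t k) * z k i / Z i * Z i = Num.sqrt (t k) * z k i.
  move=> Z2; have [zi|zi] := eqVneq (Z i) 0; last by rewrite divfK.
  have /eqP := Z2; rewrite zi expr0n/= eq_sym psumr_eq0; last first.
    by move=> l _; rewrite mulr_ge0 ?sqr_ge0.
  move=> /allP/(_ k (mem_index_enum _)) /=; rewrite mulf_eq0 sqrf_eq0.
  by move=> /orP[/eqP ->|/eqP ->]; rewrite ?sqrtr0 !(mulr0, mul0r).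
have {}gr : \sum_k t k * bilin a (x k) (y k) <= 98 * (d * (P X * Q Y)).
  apply: le_trans (gr (fun i => nrm _ x X i (X2 i)) (fun i => nrm _ y Y i (Y2 i))).
  rewrite le_eqVlt; apply/orP; left; apply/eqP; apply: eq_bigr => k _.
  rewrite b'E -{1}(sqr_sqrtr (t0 k)) expr2 -bilinZ; congr bilin; apply/funext => i.
    by rewrite cancel.
  by rewrite cancel.
have nX := ideal_norm_ge0 X iP; have nY := ideal_norm_ge0 Y iQ.
have pp : P X ^+ 2 / C ^+ 2 <= \sum_i phi i * X i ^+ 2.
  by rewrite ler_pdivrMr ?exprn_gt0// mulrC.
have qq : Q Y ^+ 2 / D ^+ 2 <= \sum_i psi i * Y i ^+ 2.
  by rewrite ler_pdivrMr ?exprn_gt0// mulrC.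
have amgm : 2 * (98 * (d * (P X * Q Y))) <= K * (P X ^+ 2 / C ^+ 2) + K * (Q Y ^+ 2 / D ^+ 2).
  rewrite -subr_ge0 (_ : _ - _ = 98 * C * D * d * (P X / C - Q Y / D) ^+ 2).
    by rewrite mulr_ge0 ?sqr_ge0// ltW.
  by rewrite /K; field; rewrite !gt_eqF.
have := ler_wpM2l (ltW K0) pp; have := ler_wpM2l (ltW K0) qq; lra.
Qed.

End factorization.
(** * Real and complex scalars *)

Section scalars.
Context {R : realType} {k : scalars}.
Local Notation K := (scalar_field R k).
Implicit Types (a b : K) (r : R).

Definition scalar_re : K -> R :=
  match k with RealScalars => fun x : R => x | ComplexScalars => fun z : R[i] => complex.Re z end.

Definition scalar_im : K -> R :=
  match k with RealScalars => fun x : R => 0 | ComplexScalars => fun z : R[i] => complex.Im z end.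

(** The scalar 0 stands for the imaginary unit in the real case, so that
    [scalar_decomp] covers both fields. *)
Definition scalar_i : K :=
  match k with RealScalars => 0 : R | ComplexScalars => 'i%C : R[i] end.

Lemma modulus0 : modulus (0 : K) = 0.
Proof. by rewrite /modulus; case: k => /=; [exact: normr0|exact: Normc.normc0]. Qed.

Lemma modulus_ge0 a : 0 <= modulus a.
Proof. by case: k a => /= a; [exact: normr_ge0|case: a => x y; exact: sqrtr_ge0]. Qed.

Lemma modulusD a b : modulus (a + b) <= modulus a + modulus b.
Proof. by case: k a b => /= a b; [exact: ler_normD|exact: le_normcD]. Qed.

Lemma modulusM a b : modulus (a * b) = modulus a * modulus b.
Proof. by case: k a b => /= a b; [exact: normrM|exact: Normc.normcM]. Qed.

Lemma modulusN a : modulus (- a) = modulus a.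
Proof. by case: k a => /= a; [exact: normrN|exact: normcN]. Qed.

Lemma modulus_eq0 a : modulus a = 0 -> a = 0.
Proof. by case: k a => /= a; [exact: normr0_eq0|exact: Normc.eq0_normc]. Qed.

Lemma modulus_of_real r : modulus (of_real k r) = `|r|.
Proof. by case: k => //=; rewrite expr0n addr0 sqrtr_sqr. Qed.

Lemma of_realD r r' : of_real k (r + r') = of_real k r + of_real k r'.
Proof. by case: k => //=; exact: rmorphD. Qed.

Lemma of_realM r r' : of_real k (r * r') = of_real k r * of_real k r'.
Proof. by case: k => //=; exact: rmorphM. Qed.

Lemma of_real0 : of_real k (0 : R) = 0.
Proof. by case: k. Qed.

Lemma of_real1 : of_real k (1 : R) = 1.
Proof. by case: k. Qed.

Lemma modulus1 : modulus (1 : K) = 1.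
Proof. by rewrite -of_real1 modulus_of_real normr1. Qed.

Lemma modulus_i : modulus scalar_i <= 1.
Proof. by rewrite /scalar_i; case: k => /=; rewrite ?normr0 ?expr0n ?expr1n ?add0r ?sqrtr1 ?ler01. Qed.

Lemma scalar_decomp a : a = of_real k (scalar_re a) + scalar_i * of_real k (scalar_im a).
Proof.
rewrite /scalar_re /scalar_im /scalar_i; case: k a => /= a; first by rewrite mul0r addr0.
exact: complexE.
Qed.

Lemma scalar_reD a b : scalar_re (a + b) = scalar_re a + scalar_re b.
Proof. by rewrite /scalar_re; case: k a b => //= -[x y] [x' y']. Qed.

Lemma scalar_imD a b : scalar_im (a + b) = scalar_im a + scalar_im b.
Proof. by rewrite /scalar_im; case: k a b => //= [|[x y] [x' y']]//; rewrite addr0. Qed.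

Lemma scalar_reMr a r : scalar_re (a * of_real k r) = scalar_re a * r.
Proof. by rewrite /scalar_re; case: k a => //= -[x y]/=; rewrite mulr0 subr0. Qed.

Lemma scalar_imMr a r : scalar_im (a * of_real k r) = scalar_im a * r.
Proof.
by rewrite /scalar_im; case: k a => [a|[x y]]/=; rewrite ?mul0r// mulr0 add0r.
Qed.

Lemma scalar_re_le a : `|scalar_re a| <= modulus a.
Proof.
rewrite /scalar_re; case: k a => //= -[x y]/=.
by rewrite -sqrtr_sqr ler_sqrt ?lerDl ?addr_ge0 ?sqr_ge0.
Qed.

Lemma scalar_im_le a : `|scalar_im a| <= modulus a.
Proof.
rewrite /scalar_im; case: k a => [a|[x y]]/=; first by rewrite normr0.
by rewrite -sqrtr_sqr ler_sqrt ?lerDr ?addr_ge0 ?sqr_ge0.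
Qed.

Lemma modulusV a : modulus a^-1 = (modulus a)^-1.
Proof. by case: k a => /= a; [exact: normfV|exact: Normc.normcV]. Qed.

Lemma exists_phase a : exists2 u : K, modulus u <= 1 & u * a = of_real k (modulus a).
Proof.
have [->|a0] := eqVneq a 0; first by exists 0; rewrite ?mulr0 modulus0 ?of_real0 ?ler01.
have m0 : modulus a != 0 by apply: contra_neq a0; exact: modulus_eq0.
exists (of_real k (modulus a) / a); last by rewrite divfK.
by rewrite modulusM modulus_of_real modulusV ger0_norm ?modulus_ge0// mulfV.
Qed.

Lemma modulus_sum (I : Type) (s : seq I) (f : I -> K) :
  modulus (\sum_(i <- s) f i) <= \sum_(i <- s) modulus (f i).
Proof.
elim: s => [|i s IH]; first by rewrite !big_nil modulus0.
by rewrite !big_cons; apply: le_trans (modulusD _ _) _; rewrite lerD2l.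
Qed.

Lemma of_real_sum (I : Type) (s : seq I) (f : I -> R) :
  of_real k (\sum_(i <- s) f i) = \sum_(i <- s) of_real k (f i).
Proof.
elim: s => [|i s IH]; first by rewrite !big_nil of_real0.
by rewrite !big_cons of_realD IH.
Qed.

Lemma scalar_re0 : scalar_re 0 = 0.
Proof. by rewrite /scalar_re; case: k. Qed.

Lemma scalar_im0 : scalar_im 0 = 0.
Proof. by rewrite /scalar_im; case: k. Qed.

Lemma scalar_re_sum (I : Type) (s : seq I) (f : I -> K) :
  scalar_re (\sum_(i <- s) f i) = \sum_(i <- s) scalar_re (f i).
Proof.
elim: s => [|i s IH]; first by rewrite !big_nil scalar_re0.
by rewrite !big_cons scalar_reD IH.
Qed.

Lemma scalar_im_sum (I : Type) (s : seq I) (f : I -> K) :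
  scalar_im (\sum_(i <- s) f i) = \sum_(i <- s) scalar_im (f i).
Proof.
elim: s => [|i s IH]; first by rewrite !big_nil scalar_im0.
by rewrite !big_cons scalar_imD IH.
Qed.

End scalars.
(** * Schur multipliers of finite matrices *)

Section finite_schur.
Context {R : realType} {k : scalars} {I J : finType}.
Local Notation K := (scalar_field R k).

(** Bilinear also for complex scalars: no conjugation, as in the action of a matrix
    on sequences. *)
Definition kform (a : I -> J -> K) (x : J -> K) (y : I -> K) : K :=
  \sum_i \sum_j a i j * (x j * y i).

Definition modv (T : Type) (x : T -> K) : T -> R := fun i => modulus (x i).

Definition l2norm (T : finType) (x : T -> R) : R := Num.sqrt (\sum_i x i ^+ 2).

Definition form_bound (P : (J -> R) -> R) (Q : (I -> R) -> R) (a : I -> J -> K) (d : R) :=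
  forall x y, modulus (kform a x y) <= d * (P (modv x) * Q (modv y)).

(** Stated for all bounds d, so that no rescaling of the form is needed. *)
Definition schur_bound (P : (J -> R) -> R) (Q : (I -> R) -> R) (m : I -> J -> K) (c : R) :=
  forall a d, 0 < d -> form_bound P Q a d ->
    form_bound P Q (fun i j => m i j * a i j) (c * d).

Lemma eq_kform a a' x x' y y' :
  (forall i j, a i j * (x j * y i) = a' i j * (x' j * y' i)) ->
  kform a x y = kform a' x' y'.
Proof. by move=> h; apply: eq_bigr => i _; apply: eq_bigr => j _. Qed.

Lemma kformD a a' x y : kform (fun i j => a i j + a' i j) x y = kform a x y + kform a' x y.
Proof.
rewrite /kform -big_split/=; apply: eq_bigr => i _; rewrite -big_split/=.
by apply: eq_bigr => j _; rewrite mulrDl.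
Qed.

Lemma kformDl a x x' y : kform a (fun j => x j + x' j) y = kform a x y + kform a x' y.
Proof.
rewrite /kform -big_split/=; apply: eq_bigr => i _; rewrite -big_split/=.
by apply: eq_bigr => j _; rewrite mulrDl mulrDr.
Qed.

Lemma kformDr a x y y' : kform a x (fun i => y i + y' i) = kform a x y + kform a x y'.
Proof.
rewrite /kform -big_split/=; apply: eq_bigr => i _; rewrite -big_split/=.
by apply: eq_bigr => j _; rewrite mulrDr mulrDr.
Qed.

Lemma kformZ (s t u : K) a x y :
  kform (fun i j => s * a i j) (fun j => t * x j) (fun i => u * y i)
  = s * t * u * kform a x y.
Proof.
rewrite /kform mulr_sumr; apply: eq_bigr => i _; rewrite mulr_sumr.
by apply: eq_bigr => j _; ring.
Qed.

Lemma kform_real (r : I -> J -> R) x y :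
  kform (fun i j => of_real k (r i j)) (fun j => of_real k (x j)) (fun i => of_real k (y i))
  = of_real k (bilin r x y).
Proof.
rewrite /bilin of_real_sum; apply: eq_bigr => i _; rewrite of_real_sum.
by apply: eq_bigr => j _; rewrite !of_realM.
Qed.

Lemma modv_of_real (T : Type) (x : T -> R) :
  modv (fun i => of_real k (x i)) = fun i => `|x i|.
Proof. by apply/funext => i; rewrite /modv modulus_of_real. Qed.

Lemma l2norm_ge0 (T : finType) (x : T -> R) : 0 <= l2norm x.
Proof. exact: sqrtr_ge0. Qed.

Lemma l2norm_mono (T : finType) (x y : T -> R) :
  (forall i, `|x i| <= `|y i|) -> l2norm x <= l2norm y.
Proof.
move=> h; rewrite ler_sqrt; last by rewrite sumr_ge0// => i _; exact: sqr_ge0.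
apply: ler_sum => i _; rewrite -(real_normK (num_real (x i))).
by rewrite -(real_normK (num_real (y i))) ler_sqr ?nnegrE.
Qed.

Lemma l2norm_weighted_le (T : finType) (N : (T -> R) -> R) (w : T -> R) (z : T -> K) :
  ideal_norm N -> weights N w ->
  l2norm (modv (fun i => of_real k (Num.sqrt (w i)) * z i)) <= N (modv z).
Proof.
move=> iN [w0 wN]; rewrite -[leRHS]ger0_norm ?ideal_norm_ge0//.
rewrite -sqrtr_sqr ler_sqrt ?sqr_ge0//; apply: le_trans (wN (modv z)).
apply: ler_sum => i _; rewrite /modv modulusM modulus_of_real exprMn.
by rewrite real_normK ?num_real// sqr_sqrtr.
Qed.

(** A real matrix acts on complex vectors through their real and imaginary parts,
    which gives four terms. *)
Lemma form_bound_real (r : I -> J -> R) P Q d :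
  (forall x y, bilin r x y <= d * (P x * Q y)) -> 0 <= d ->
  (forall x x', (forall j, `|x j| <= `|x' j|) -> P x <= P x') ->
  (forall y y', (forall i, `|y i| <= `|y' i|) -> Q y <= Q y') ->
  (forall x, 0 <= P x) -> (forall y, 0 <= Q y) ->
  form_bound P Q (fun i j => of_real k (r i j)) (4 * d).
Proof.
move=> rPQ d0 mP mQ P0 Q0 x y.
have abs_le u v : `|bilin r u v| <= d * (P u * Q v).
  rewrite ler_norml rPQ andbT lerNl.
  have -> : - bilin r u v = bilin r (fun j => -1 * u j) (fun i => 1 * v i).
    by rewrite bilinZ; ring.
  apply: le_trans (rPQ _ _) _; rewrite ler_wpM2l// ler_pM//.
    by apply: mP => j; rewrite mulN1r normrN.
  by apply: mQ => i; rewrite mul1r.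
pose x1 j := scalar_re (x j); pose x2 j := scalar_im (x j).
pose y1 i := scalar_re (y i); pose y2 i := scalar_im (y i).
have xE : x = fun j => of_real k (x1 j) + scalar_i * of_real k (x2 j).
  by apply/funext => j; exact: scalar_decomp.
have yE : y = fun i => of_real k (y1 i) + scalar_i * of_real k (y2 i).
  by apply/funext => i; exact: scalar_decomp.
have part (s t : K) u v : modulus s <= 1 -> modulus t <= 1 ->
    (forall j, `|u j| <= modulus (x j)) -> (forall i, `|v i| <= modulus (y i)) ->
    modulus (kform (fun i j => of_real k (r i j)) (fun j => s * of_real k (u j))
      (fun i => t * of_real k (v i))) <= d * (P (modv x) * Q (modv y)).
  move=> s1 t1 hu hv.
  have -> : kform (fun i j => of_real k (r i j)) (fun j => s * of_real k (u j))
      (fun i => t * of_real k (v i)) = s * t * of_real k (bilin r u v).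
    rewrite -kform_real; have := kformZ 1 s t (fun i j => of_real k (r i j))
      (fun j => of_real k (u j)) (fun i => of_real k (v i)).
    rewrite mul1r => <-; apply: eq_kform => i j; by rewrite mul1r.
  rewrite !modulusM modulus_of_real.
  apply: le_trans (_ : `|bilin r u v| <= _).
    by rewrite ler_piMl// mulr_ile1 ?modulus_ge0.
  apply: le_trans (abs_le _ _) _; rewrite ler_wpM2l// ler_pM//.
    by apply: mP => j; rewrite /modv (ger0_norm (modulus_ge0 _)).
  by apply: mQ => i; rewrite /modv (ger0_norm (modulus_ge0 _)).
have one : modulus (1 : K) <= 1 by rewrite modulus1.
have i1 := @modulus_i R k.
have hx1 j : `|x1 j| <= modulus (x j) by exact: scalar_re_le.
have hx2 j : `|x2 j| <= modulus (x j) by exact: scalar_im_le.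
have hy1 i : `|y1 i| <= modulus (y i) by exact: scalar_re_le.
have hy2 i : `|y2 i| <= modulus (y i) by exact: scalar_im_le.
have p11 := part _ _ _ _ one one hx1 hy1; have p12 := part _ _ _ _ one i1 hx1 hy2.
have p21 := part _ _ _ _ i1 one hx2 hy1; have p22 := part _ _ _ _ i1 i1 hx2 hy2.
have xE' : x = fun j => 1 * of_real k (x1 j) + scalar_i * of_real k (x2 j).
  by rewrite [LHS]xE; apply/funext => j; rewrite mul1r.
have yE' : y = fun i => 1 * of_real k (y1 i) + scalar_i * of_real k (y2 i).
  by rewrite [LHS]yE; apply/funext => i; rewrite mul1r.
rewrite [in X in modulus X <= _]xE' [in X in modulus X <= _]yE'.
rewrite kformDl !kformDr.
apply: le_trans (modulusD _ _) _.
apply: le_trans (lerD (modulusD _ _) (modulusD _ _)) _.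
lra.
Qed.

(** The real and the imaginary part of the matrix are treated separately.  For a
    real r, the factorization gives weights with r_ij = f_j g_i b_ij, where f and
    g are the square roots of the weights and b is bounded on l_2; then
    m_ij r_ij = f_j g_i (m_ij b_ij).  The constant is 2 (two parts) times 4
    (complex vectors) times Grothendieck's 98. *)
Lemma schur_bound_from_l2 (m : I -> J -> K) P Q C D c :
  ideal_norm P -> ideal_norm Q -> 0 < C -> 0 < D -> 0 <= c ->
  convex2 C P -> convex2 D Q ->
  schur_bound (@l2norm J) (@l2norm I) m c ->
  schur_bound P Q m (784 * C * D * c).
Proof.
move=> iP iQ C0 D0 c0 cP cQ mc a d d0 aPQ.
have real_part (r : I -> J -> R) : (forall x y, bilin r x y <= d * (P x * Q y)) ->
    form_bound P Q (fun i j => m i j * of_real k (r i j)) (c * (4 * (98 * C * D * d))).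
  move=> rPQ; pose M := 98 * C * D * d.
  have M0 : 0 < M by rewrite !mulr_gt0.
  have [phi [psi [wphi wpsi rw]]] := grothendieck_factorization iP iQ C0 D0 d0 cP cQ rPQ.
  rewrite -/M in rw *.
  pose f j := Num.sqrt (phi j); pose g i := Num.sqrt (psi i).
  have f2 j : f j ^+ 2 = phi j by rewrite sqr_sqrtr// wphi.1.
  have g2 i : g i ^+ 2 = psi i by rewrite sqr_sqrtr// wpsi.1.
  pose b i j := (f j)^-1 * (g i)^-1 * r i j.
  have invle (z : R) : `|z * z^-1| <= 1.
    by have [->|z0] := eqVneq z 0; rewrite ?mul0r ?normr0 ?ler01// mulfV ?normr1.
  have bl2 x y : bilin b x y <= M * (l2norm x * l2norm y).
    have -> : bilin b x y = bilin r (fun j => (f j)^-1 * x j) (fun i => (g i)^-1 * y i).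
      by apply: eq_bigr => i _; apply: eq_bigr => j _; rewrite /b; ring.
    apply: le_trans (rw _ _) _; rewrite ler_wpM2l ?(ltW M0)//.
    have red (T : finType) (h q z : T -> R) : (forall i, h i ^+ 2 = q i) ->
        Num.sqrt (\sum_i q i * ((h i)^-1 * z i) ^+ 2) <= l2norm z.
      move=> hq; rewrite (eq_bigr (fun i => (h i * (h i)^-1 * z i) ^+ 2)).
        by apply: l2norm_mono => i; rewrite normrM ler_piMl.
      by move=> i _; rewrite -hq; ring.
    by apply: ler_pM; rewrite ?sqrtr_ge0// red.
  have bform : form_bound (@l2norm J) (@l2norm I) (fun i j => of_real k (b i j)) (4 * M).
    apply: (form_bound_real bl2 (ltW M0)) => //; try exact: l2norm_ge0.
      exact: l2norm_mono.
    exact: l2norm_mono.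
  have rb i j : r i j = f j * g i * b i j.
    (* zero weights: the factorization applied to unit vectors shows that r vanishes there *)
    have r0 : f j * g i = 0 -> r i j = 0.
      move=> fg; have unit_le (s : R) : s * r i j <= M * (f j * g i) * `|s|.
        have := rw (fun l => s * unit_vec R j l) (fun l => 1 * unit_vec R i l).
        rewrite bilinZ (_ : bilin _ _ _ = r i j).
          rewrite !sum_unit_sqr -f2 -g2 -!exprMn !sqrtr_sqr !normrM normr1 !mulr1.
          rewrite (ger0_norm (sqrtr_ge0 (phi j))) (ger0_norm (sqrtr_ge0 (psi i))).
          rewrite -/(f j) -/(g i) => le; apply: le_trans le _.
          by rewrite le_eqVlt; apply/orP; left; apply/eqP; ring.
        rewrite /bilin (bigD1 i)//= (bigD1 j)//= !big1 ?addr0 /unit_vec ?eqxx ?mulr1//.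
          by move=> l /negbTE li; rewrite big1// => l' _; rewrite li !mulr0.
        by move=> l /negbTE ->; rewrite mul0r mulr0.
      have := unit_le 1; have := unit_le (-1); rewrite fg mulr0 !mul0r.
      by move=> h1 h2; apply/eqP; rewrite eq_le; lra.
    have [fg|fg] := eqVneq (f j * g i) 0; first by rewrite fg mul0r r0.
    by rewrite /b mulrA -invfM mulfV// mul1r.
  move=> x y.
  have -> : kform (fun i j => m i j * of_real k (r i j)) x y
      = kform (fun i j => m i j * of_real k (b i j))
          (fun j => of_real k (f j) * x j) (fun i => of_real k (g i) * y i).
    by apply: eq_kform => i j; rewrite {1}rb !of_realM; ring.
  apply: le_trans (mc _ _ _ bform _ _) _; first by rewrite mulr_gt0.
  have cM0 : 0 <= c * (4 * M) by rewrite mulr_ge0// mulr_ge0// ltW.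
  apply: (ler_wpM2l cM0); apply: ler_pM; rewrite ?l2norm_ge0//; exact: l2norm_weighted_le.
have real_le (h : K -> R) : (forall z z', h (z + z') = h z + h z') ->
    (forall z r, h (z * of_real k r) = h z * r) -> (forall z, `|h z| <= modulus z) ->
    forall x y, bilin (fun i j => h (a i j)) x y <= d * (P x * Q y).
  move=> hD hM hle x y.
  have h0 : h 0 = 0 by have := hM 0 0; rewrite mul0r mulr0.
  have hsum (T : finType) (F : T -> K) : h (\sum_i F i) = \sum_i h (F i).
    elim: (index_enum T) => [|i s IH]; first by rewrite !big_nil.
    by rewrite !big_cons hD IH.
  have -> : bilin (fun i j => h (a i j)) x y =
      h (kform a (fun j => of_real k (x j)) (fun i => of_real k (y i))).
    rewrite hsum; apply: eq_bigr => i _; rewrite hsum; apply: eq_bigr => j _.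
    by rewrite -of_realM hM.
  apply: le_trans (ler_norm _) _; apply: le_trans (hle _) _.
  apply: le_trans (aPQ _ _) _; rewrite !modv_of_real.
  rewrite ler_wpM2l ?(ltW d0)//; apply: ler_pM; rewrite ?ideal_norm_ge0//.
    by apply: (ideal_mono iP) => j; rewrite normr_id.
  by apply: (ideal_mono iQ) => i; rewrite normr_id.
have b1 := real_part _ (real_le _ scalar_reD scalar_reMr scalar_re_le).
have b2 := real_part _ (real_le _ scalar_imD scalar_imMr scalar_im_le).
move=> x y.
have -> : kform (fun i j => m i j * a i j) x y =
    kform (fun i j => m i j * of_real k (scalar_re (a i j))) x y +
    scalar_i * kform (fun i j => m i j * of_real k (scalar_im (a i j))) x y.
  have := kformZ scalar_i 1 1 (fun i j => m i j * of_real k (scalar_im (a i j))) x y.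
  rewrite !mulr1 => <-.
  rewrite (_ : kform (fun i j => scalar_i * _) _ _ =
    kform (fun i j => scalar_i * (m i j * of_real k (scalar_im (a i j)))) x y); last first.
    by apply: eq_kform => i j; rewrite !mul1r.
  rewrite -kformD; apply: eq_kform => i j; congr (_ * _).
  by rewrite {1}(scalar_decomp (a i j)) mulrDr; congr (_ + _); ring.
apply: le_trans (modulusD _ _) _; rewrite modulusM.
have := b1 x y; have := b2 x y; have := @modulus_i R k; have := modulus_ge0 (@scalar_i R k).
have := modulus_ge0 (kform (fun i j => m i j * of_real k (scalar_im (a i j))) x y).
set u := modulus (kform _ _ _); set v := modulus (kform _ _ _); set w := modulus _.
set z := P _ * Q _ => u0 w0 w1 hu hv.
have : w * u <= u by rewrite ler_piMl.
lra.
Qed.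

(** Write |x_j| <= f_j e_j and |y_i| <= g_i h_i by Lozanovskii's theorem.  The
    matrix b_ij = f_j g_i a_ij is bounded for P and Q, and the value of m * a at
    (x, y) is that of m * b at vectors dominated by e and h. *)
Lemma schur_bound_to_l2 (m : I -> J -> K) P Q C D c :
  ideal_norm P -> ideal_norm Q -> 0 < C -> 0 < D -> 0 <= c ->
  convex2 C P -> convex2 D Q ->
  schur_bound P Q m c ->
  schur_bound (@l2norm J) (@l2norm I) m (C ^+ 2 * D ^+ 2 * c).
Proof.
move=> iP iQ C0 D0 c0 cP cQ mc a d d0 al2 x y.
have [phi [e [wphi xe e0 eC]]] := lozanovskii iP C0 cP (modv x).
have [psi [h [wpsi yh h0 hD]]] := lozanovskii iQ D0 cQ (modv y).
pose f j := Num.sqrt (phi j); pose g i := Num.sqrt (psi i).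
pose b i j := of_real k (f j * g i) * a i j.
have bPQ : form_bound P Q b d.
  move=> u v.
  have -> : kform b u v = kform a (fun j => of_real k (f j) * u j) (fun i => of_real k (g i) * v i).
    by apply: eq_kform => i j; rewrite /b of_realM; ring.
  apply: le_trans (al2 _ _) _; rewrite ler_wpM2l ?(ltW d0)//.
  by apply: ler_pM; rewrite ?l2norm_ge0//; apply: l2norm_weighted_le.
have quot (T : finType) (w e' : T -> R) (z : T -> K) : (forall i, 0 <= w i) ->
    (forall i, 0 <= e' i) -> (forall i, modv z i ^+ 2 <= w i * e' i ^+ 2) ->
    (forall i, of_real k (Num.sqrt (w i)) * (of_real k (Num.sqrt (w i))^-1 * z i) = z i)
    /\ (forall i, modulus (of_real k (Num.sqrt (w i))^-1 * z i) <= e' i).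
  move=> w0 e'0 le; split=> i.
    rewrite mulrA -of_realM; have [s0|s0] := eqVneq (Num.sqrt (w i)) 0.
      rewrite s0 mul0r of_real0 mul0r; apply/esym/modulus_eq0.
      have := le i; rewrite (_ : w i = 0) ?mul0r; last first.
        by apply/eqP; rewrite eq_le w0 andbT -sqrtr_eq0 s0.
      by move=> sq; apply/eqP; rewrite -sqrf_eq0 eq_le sqr_ge0 andbT.
    by rewrite mulfV// of_real1 mul1r.
  rewrite modulusM modulus_of_real normfV ger0_norm ?sqrtr_ge0//.
  have [s0|s0] := eqVneq (Num.sqrt (w i)) 0; first by rewrite s0 invr0 mul0r.
  have sp : 0 < Num.sqrt (w i) by rewrite lt_neqAle eq_sym s0 sqrtr_ge0.
  rewrite ler_pdivrMl// -ler_sqr ?nnegrE ?modulus_ge0 ?mulr_ge0 ?(ltW sp)//.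
  by rewrite exprMn sqr_sqrtr//; exact: le.
have [xE xb] := quot _ _ _ _ wphi.1 e0 xe.
have [yE yb] := quot _ _ _ _ wpsi.1 h0 yh.
have -> : kform (fun i j => m i j * a i j) x y = kform (fun i j => m i j * b i j)
    (fun j => of_real k (f j)^-1 * x j) (fun i => of_real k (g i)^-1 * y i).
  apply: eq_kform => i j; rewrite /b of_realM -{1}(xE j) -{1}(yE i) -/(f j) -/(g i); ring.
apply: le_trans (mc _ _ d0 bPQ _ _) _.
have nx : P (modv (fun j => of_real k (f j)^-1 * x j)) <= C ^+ 2 * l2norm (modv x).
  apply: le_trans eC; apply: (ideal_mono iP) => j.
  by rewrite /modv !ger0_norm ?modulus_ge0 ?xb.
have ny : Q (modv (fun j => of_real k (g j)^-1 * y j)) <= D ^+ 2 * l2norm (modv y).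
  apply: le_trans hD; apply: (ideal_mono iQ) => j.
  by rewrite /modv !ger0_norm ?modulus_ge0 ?yb.
have := ler_pM (ideal_norm_ge0 _ iP) (ideal_norm_ge0 _ iQ) nx ny.
have cd0 : 0 <= c * d by rewrite mulr_ge0 ?(ltW d0).
by move=> /(ler_wpM2l cd0) /le_trans; apply; rewrite le_eqVlt; apply/orP; left;
  apply/eqP; ring.
Qed.

End finite_schur.
(** * Convergence of scalar sequences and series *)

Section scalar_convergence.
Context {R : realType} {k : scalars}.
Local Notation K := (scalar_field R k).

(** The topology of the scalar field comes from its own order-valued norm; this
    translates it into real convergence of moduli, for both fields. *)
Lemma cvg_modulus (u : nat -> K) (l : K) :
  (u @ \oo --> l) <-> ((fun n => modulus (u n - l)) @ \oo --> (0 : R)).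
Proof.
pose f : R -> K := match k with RealScalars => fun r : R => r
                              | ComplexScalars => fun r : R => (r%:C)%C end.
have f0 r : 0 < r -> 0 < f r by rewrite /f; case: k => //= r0; rewrite ltcR.
have fE z r : (`|z| < f r) = (modulus z < r).
  rewrite /f /modulus; case: k z => //= -[x y]; by rewrite normc_def ltcR.
have fS e : 0 < e -> exists2 r, 0 < r & f r = e.
  rewrite /f; case: k e => /= e e0; first by exists e.
  case: e e0 => x y; rewrite ltcE/= => /andP[/eqP -> x0].
  by exists x.
split=> [ul|ul].
  apply/cvgrPdist_lt => e e0; have /cvgrPdist_lt/(_ _ (f0 _ e0)) := ul.
  apply: filterS => n; rewrite fE sub0r normrN ger0_norm ?modulus_ge0//.
  by rewrite -modulusN opprB.
apply/cvgrPdist_lt => e /fS[r r0 <-]; have /cvgrPdist_lt/(_ _ r0) := ul.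
apply: filterS => n; rewrite fE sub0r normrN ger0_norm ?modulus_ge0//.
by rewrite -modulusN opprB.
Qed.

Lemma summable_cvg (c : nat -> K) (B : R) :
  (forall n, \sum_(0 <= j < n) modulus (c j) <= B) -> cvgn (series c).
Proof.
move=> cB.
have real_cvg (h : K -> R) : (forall z, `|h z| <= modulus z) ->
    cvgn (series (fun j => h (c j))).
  move=> hle; apply: normed_cvg.
  apply: nondecreasing_is_cvgn.
    by apply: nondecreasing_series => n _ _; exact: normr_ge0.
  exists B => _ [n _ <-]; apply: le_trans (cB n).
  by apply: ler_sum => j _; exact: hle.
have /cvg_ex[/= l1 c1] := real_cvg _ (@scalar_re_le R k).
have /cvg_ex[/= l2 c2] := real_cvg _ (@scalar_im_le R k).
apply/cvg_ex; exists (of_real k l1 + scalar_i * of_real k l2).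
apply/cvg_modulus; apply: (@squeeze_cvgr _ _ _ _ (fun=> 0)
  (fun n => `|series (fun j => scalar_re (c j)) n - l1| +
            `|series (fun j => scalar_im (c j)) n - l2|)).
- apply: nearW => n; rewrite modulus_ge0/=.
  have -> : series c n - (of_real k l1 + scalar_i * of_real k l2) =
      of_real k (series (fun j => scalar_re (c j)) n - l1) +
      scalar_i * of_real k (series (fun j => scalar_im (c j)) n - l2).
    rewrite {1}(scalar_decomp (series c n)) /series/= scalar_re_sum scalar_im_sum.
    have ofN r : of_real k (- r) = - of_real k r.
      by apply/eqP; rewrite -addr_eq0 -of_realD addNr of_real0.
    by rewrite !of_realD !ofN; ring.
  apply: le_trans (modulusD _ _) _; rewrite modulusM !modulus_of_real lerD2l.
  by rewrite ler_piMl ?modulus_i.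
- exact: cvg_cst.
- have dist_cvg (u : R^nat) l : u @ \oo --> l -> (fun n => `|u n - l|) @ \oo --> (0 : R).
    move=> ul; rewrite -(normr0 R) -(subrr l).
    by apply: cvg_norm; apply: cvgB => //; exact: cvg_cst.
  by rewrite -(addr0 0); apply: cvgD; exact: dist_cvg.
Qed.

End scalar_convergence.
(** * Ideal spaces of sequences and their finite sections *)

Section sections.
Context {R : realType} {k : scalars}.
Local Notation K := (scalar_field R k).
Implicit Types (X Y : seq_space R k) (A : nat -> nat -> K).

(** Extension by zero, through which every finite section is seen in the sequence
    space. *)
Definition ext n (x : 'I_n -> K) : nat -> K :=
  fun i => if insub i is Some j then x j else 0.

Lemma ext_ord n (x : 'I_n -> K) (i : 'I_n) : ext x i = x i.
Proof. by rewrite /ext valK. Qed.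

Lemma ext_lt n (x : nat -> K) i : (i < n)%N -> ext (fun j : 'I_n => x j) i = x i.
Proof. by move=> h; rewrite /ext insubT. Qed.

Lemma ext_ge n (x : 'I_n -> K) i : (n <= i)%N -> ext x i = 0.
Proof. by move=> h; rewrite /ext insubF// ltnNge h. Qed.

(** What the argument uses of the domain, in a form shared by the symmetric spaces
    and by l_infinity, whose elements need not tend to zero. *)
Record ideal_space X : Prop := IdealSpace {
  space_ext : forall n (x : 'I_n -> K), carrier X (ext x);
  space_solid : forall x y, carrier X y -> (forall i, modulus (x i) <= modulus (y i)) ->
    carrier X x /\ seq_norm X x <= seq_norm X y;
  space_scale : forall n a (x : 'I_n -> K),
    seq_norm X (ext (fun i => a * x i)) = modulus a * seq_norm X (ext x);
  space_unit : forall n (i : 'I_n), 0 < seq_norm X (ext (unit_vec K i)) }.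

(** What the argument uses of the target: operators are recovered from their
    sections because a sequence with bounded sections belongs to the space. *)
Record fatou_space Y : Prop := FatouSpace {
  fatou_ideal : ideal_space Y;
  fatou_triangle : forall n (x y : 'I_n -> K),
    seq_norm Y (ext (fun i => x i + y i)) <= seq_norm Y (ext x) + seq_norm Y (ext y);
  fatou_sections : forall (y : nat -> K) c, (forall n, seq_norm Y (ext (fun i : 'I_n => y i)) <= c) ->
    carrier Y y /\ seq_norm Y y <= c }.

(** The norm of the space on n coordinates, as a real lattice norm; by solidity it
    also computes the norm of scalar vectors ([level_normE]). *)
Definition level_norm X n (w : 'I_n -> R) : R :=
  seq_norm X (ext (fun i => of_real k (w i))).

Lemma level_normE X n (x : 'I_n -> K) : ideal_space X ->
  level_norm X (modv x) = seq_norm X (ext x).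
Proof.
move=> iX; apply/eqP; rewrite eq_le.
have mE i : modulus (ext (fun j => of_real k (modv x j)) i) = modulus (ext x i).
  rewrite /ext; case: insub => [j|]; last by rewrite modulus0.
  by rewrite modulus_of_real /modv ger0_norm ?modulus_ge0.
by apply/andP; split; apply: (space_solid iX (space_ext iX _) _).2 => i; rewrite mE.
Qed.

Lemma level_norm_ideal X n : ideal_space X -> ideal_norm (@level_norm X n).
Proof.
move=> iX; split=> [x y xy|a x a0|i].
- apply: (space_solid iX (space_ext iX _) _).2 => i.
  by rewrite /ext; case: insub => [j|]//; rewrite !modulus_of_real.
- rewrite /level_norm -[in RHS](ger0_norm a0) -(modulus_of_real (k := k)).
  by rewrite -space_scale//; congr (seq_norm X (ext _)); apply/funext => i; rewrite of_realM.
- rewrite /level_norm (_ : (fun _ => _) = unit_vec K i) ?space_unit//.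
  by apply/funext => j; rewrite /unit_vec; case: eqP => _; rewrite ?of_real0 ?of_real1.
Qed.

Lemma level_norm_triangle Y n : fatou_space Y -> triangle_ineq (@level_norm Y n).
Proof.
move=> fY x y; rewrite /level_norm; apply: le_trans (fatou_triangle fY _ _).
by rewrite (_ : (fun i => of_real k _) = fun i => of_real k (x i) + of_real k (y i));
  [|apply/funext => i; rewrite of_realD].
Qed.

Definition mx_act (I J : finType) (a : I -> J -> K) (x : J -> K) : I -> K :=
  fun i => \sum_j a i j * x j.

Definition level_bound X Y n (a : 'I_n -> 'I_n -> K) (c : R) :=
  forall x, level_norm Y (modv (mx_act a x)) <= c * level_norm X (modv x).

Definition mx_section n A : 'I_n -> 'I_n -> K := fun i j => A i j.

Definition section_bound X Y A c := forall n, level_bound X Y (@mx_section n A) c.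

Lemma kform_act (I J : finType) (a : I -> J -> K) x y :
  kform a x y = \sum_i mx_act a x i * y i.
Proof.
apply: eq_bigr => i _; rewrite /mx_act mulr_suml; apply: eq_bigr => j _; ring.
Qed.

(** Operators between sections are forms on X times the dual of Y.  From the form to
    the operator, a norming functional for |A x| is turned into one for A x by
    multiplying its entries by phases. *)
Lemma level_bound_form X Y n (a : 'I_n -> 'I_n -> K) c : ideal_space X ->
  fatou_space Y ->
  level_bound X Y a c <->
  form_bound (@level_norm X n) (dual_norm (@level_norm Y n)) a c.
Proof.
move=> iX fY; have iY := fatou_ideal fY.
have iN := level_norm_ideal n iY; have iP := level_norm_ideal n iX; split=> ac.
  move=> x y; rewrite kform_act; apply: le_trans (modulus_sum _ _) _.
  have := pairing_le (modv y) (modv (mx_act a x)) iN.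
  rewrite (eq_bigr (fun i => modulus (mx_act a x i * y i))); last first.
    by move=> i _; rewrite /modv !ger0_norm ?modulus_ge0// modulusM mulrC.
  move=> /le_trans; apply; rewrite mulrA mulrC.
  by apply: ler_wpM2r; [exact: ideal_norm_ge0 (dual_norm_ideal iN)|exact: ac].
move=> x.
have [g g1 gy] := dual_norm_norming iN (@level_norm_triangle _ n fY) (modv (mx_act a x)).
have /choice[u uP] : forall i, exists u : K, modulus u <= 1 /\
    u * mx_act a x i = of_real k (modulus (mx_act a x i)).
  by move=> i; have [u u1 uE] := exists_phase (mx_act a x i); exists u.
pose y i := of_real k `|g i| * u i.
have sE : kform a x y = of_real k (\sum_i `|g i| * `|modv (mx_act a x) i|).
  rewrite kform_act of_real_sum; apply: eq_bigr => i _.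
  rewrite of_realM /modv (ger0_norm (modulus_ge0 _)) -(uP i).2 /y; ring.
(* if the norm of x is not zero, testing the form at x and a unit vector gives c >= 0 *)
have cN0 : 0 <= c * level_norm X (modv x).
  have [p0|] := eqVneq (level_norm X (modv x)) 0; first by rewrite p0 mulr0.
  move=> p0; have pp : 0 < level_norm X (modv x).
    by rewrite lt_neqAle eq_sym p0 ideal_norm_ge0.
  have [[i _]|n0] := pselect (exists i : 'I_n, True); last first.
    exfalso; move/eqP: p0; apply; apply: le_anti; rewrite ideal_norm_ge0// andbT.
    rewrite -[leRHS](ideal_norm0 iP); apply: (ideal_mono iP) => i.
    by exfalso; apply: n0; exists i.
  have dn := ideal_unit (dual_norm_ideal iN) i.
  have := ac x (fun l => of_real k (unit_vec R i l)).
  rewrite modv_of_real => h; have := le_trans (modulus_ge0 _) h.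
  have -> : dual_norm (@level_norm Y n) (fun l => `|unit_vec R i l|)
      = dual_norm (@level_norm Y n) (unit_vec R i).
    by apply: (ideal_norm_abs (dual_norm_ideal iN)) => l; rewrite normr_id.
  by rewrite mulrA pmulr_lge0.
apply: le_trans gy _; apply: le_trans (ler_norm _) _.
rewrite -(modulus_of_real (k := k)) -sE; apply: le_trans (ac _ _) _.
rewrite mulrA ler_piMr//; apply: le_trans g1; apply: (ideal_mono (dual_norm_ideal iN)) => i.
rewrite /modv /y modulusM modulus_of_real normr_id ger0_norm ?mulr_ge0 ?modulus_ge0//.
by rewrite ler_piMr// (uP i).1.
Qed.

Lemma level_norm_sections X m n (x : 'I_m -> K) : ideal_space X ->
  level_norm X (modv (fun i : 'I_n => ext x i)) <= level_norm X (modv x).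
Proof.
move=> iX; rewrite !level_normE//; apply: (space_solid iX (space_ext iX _) _).2 => i.
case: (ltnP i n) => h; first by rewrite (ext_lt (ext x) h).
by rewrite (ext_ge _ h) modulus0 modulus_ge0.
Qed.

Lemma level_norm_sum n (Y : seq_space R k) (z : 'I_n -> K) : fatou_space Y ->
  level_norm Y (modv z) <= \sum_i modulus (z i) * level_norm Y (unit_vec R i).
Proof.
move=> fY; have iN := level_norm_ideal n (fatou_ideal fY).
rewrite (_ : modv z = fun i => \sum_j modulus (z j) * unit_vec R j i); last first.
  by apply/funext => i; rewrite sum_unit_vec_r.
apply: le_trans (triangle_sum (fun j i => modulus (z j) * unit_vec R j i) iN
  (@level_norm_triangle _ n fY)) _.
by apply: ler_sum => i _; rewrite (ideal_homo iN) ?modulus_ge0.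
Qed.

Lemma level_normD n Y (z z' : 'I_n -> K) : fatou_space Y ->
  level_norm Y (modv (fun i => z i + z' i)) <= level_norm Y (modv z) + level_norm Y (modv z').
Proof.
move=> fY; apply: le_trans (level_norm_triangle fY _ _).
apply: (ideal_mono (level_norm_ideal n (fatou_ideal fY))) => i.
rewrite !ger0_norm ?addr_ge0 ?modulus_ge0//; exact: modulusD.
Qed.

Lemma level_normZ n X a (z : 'I_n -> K) : ideal_space X ->
  level_norm X (modv (fun i => a * z i)) = modulus a * level_norm X (modv z).
Proof.
move=> iX; rewrite -(ideal_homo (level_norm_ideal n iX)) ?modulus_ge0//.
by congr level_norm; apply/funext => i; rewrite /modv modulusM.
Qed.

(** Coordinatewise convergence in finite dimension is convergence in norm. *)
Lemma level_norm_limit n Y (u : nat -> 'I_n -> K) (z : 'I_n -> K) c : fatou_space Y ->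
  (forall i, (fun L => modulus (u L i - z i)) @ \oo --> (0 : R)) ->
  (\forall L \near \oo, level_norm Y (modv (u L)) <= c) ->
  level_norm Y (modv z) <= c.
Proof.
move=> fY uz uc.
pose e L := \sum_i modulus (u L i - z i) * level_norm Y (unit_vec R i).
have e0 : e @ \oo --> (0 : R).
  rewrite (_ : 0 = \sum_(i < n) 0 * level_norm Y (unit_vec R i)); last first.
    by rewrite big1// => i _; rewrite mul0r.
  rewrite /e; elim: (index_enum _) => [|i s IH].
    rewrite big_nil (_ : (fun _ => _) = cst 0); first exact: cvg_cst.
    by apply/funext => L; rewrite big_nil.
  rewrite big_cons (_ : (fun _ => _) = fun L => modulus (u L i - z i)
      * level_norm Y (unit_vec R i)
      + \sum_(j <- s) modulus (u L j - z j) * level_norm Y (unit_vec R j)).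
    by apply: cvgD => //; apply: cvgMl; exact: uz.
  by apply/funext => L; rewrite big_cons.
apply/ler_addgt0Pr => d d0.
have /cvgrPdist_lt/(_ _ d0) ed := e0.
have [L [Lc Ld0]] := filter_ex (filterI uc ed).
have Ld : e L <= d.
  move: Ld0; rewrite /= sub0r normrN => /ltW; exact: le_trans (ler_norm _).
rewrite (_ : z = fun i => u L i + -1 * (u L i - z i)); last by apply/funext => i; ring.
apply: le_trans (level_normD _ _ fY) _; rewrite (level_normZ _ _ (fatou_ideal fY)).
by rewrite modulusN modulus1 mul1r lerD// (le_trans (level_norm_sum _ fY)).
Qed.

End sections.
(** * Bounded operators and bounded sections *)

Section operators.
Context {R : realType} {k : scalars} (X Y : seq_space R k).
Hypotheses (iX : ideal_space X) (fY : fatou_space Y).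
Local Notation K := (scalar_field R k).
Implicit Types (A : nat -> nat -> K).

Let iY := fatou_ideal fY.

Lemma mx_section_act n A (x : nat -> K) (i : 'I_n) :
  mx_act (@mx_section R k n A) (fun j : 'I_n => x j) i = mx_series A x i n.
Proof. by rewrite /mx_act /mx_series /series/= big_mkord. Qed.

Lemma level_norm_le n (x : nat -> K) : carrier X x ->
  level_norm X (modv (fun i : 'I_n => x i)) <= seq_norm X x.
Proof.
move=> Xx; rewrite level_normE//; apply: (space_solid iX Xx _).2 => i.
case: (ltnP i n) => h; first by rewrite ext_lt.
by rewrite ext_ge// modulus0 modulus_ge0.
Qed.

Lemma bounded_operator_section_bound A :
  bounded_operators X Y A -> exists c, section_bound X Y A c.
Proof.
move=> [Aop [c Ac]]; exists c => n x.
have Xx := space_ext iX x.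
have [_ YA] := Aop _ Xx; have := Ac _ Xx; rewrite -level_normE//.
apply: le_trans; rewrite level_normE//; apply: (space_solid iY YA _).2 => i.
case: (ltnP i n) => h; last by rewrite ext_ge// modulus0 modulus_ge0.
rewrite -[ i ]/(val (Ordinal h)) ext_ord/=.
rewrite (_ : mx_apply A (ext x) i = mx_act (mx_section A) x (Ordinal h))//.
rewrite /mx_apply; apply: lim_near_cst => //.
near=> L; rewrite /mx_series /series/= (@big_cat_nat _ _ _ n)//=; last by near: L; exact: nbhs_infty_ge.
rewrite big_mkord [X in _ + X]big1_seq ?addr0.
  by apply: eq_bigr => j _; rewrite ext_ord.
move=> j; rewrite mem_index_iota => /andP[_ /andP[nj _]].
by rewrite ext_ge// mulr0.
Unshelve. all: by end_near. Qed.

(** Rows act absolutely: multiplying x by phases that make each A_ij x_j nonnegative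
    keeps it in the space, by solidity, and the coordinate i of the image bounds
    the sum. *)
Lemma section_row_summable A c (x : nat -> K) i n : section_bound X Y A c -> 0 <= c ->
  carrier X x -> \sum_(0 <= j < n) modulus (A i j * x j)
    <= c * seq_norm X x / level_norm Y (unit_vec R (@ord_max i)).
Proof.
(* a level that contains the row i and the first n columns *)
move=> Ac c0 Xx; pose N := maxn n i.+1.
have iN : (i < N)%N by rewrite leq_max ltnSn orbT.
have uY := ideal_unit (level_norm_ideal i.+1 iY) (@ord_max i).
have /choice[u uP] : forall j, exists u : K, modulus u <= 1 /\
    u * (A i j * x j) = of_real k (modulus (A i j * x j)).
  by move=> j; have [u u1 uE] := exists_phase (A i j * x j); exists u.
rewrite ler_pdivlMr//.
apply: le_trans (_ : \sum_(0 <= j < N) modulus (A i j * x j) *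
    level_norm Y (unit_vec R (@ord_max i)) <= _).
  rewrite -mulr_suml ler_wpM2r ?(ltW uY)//.
  rewrite (@big_cat_nat _ _ _ n 0 N)//= ?leq_maxl// lerDl.
  by apply: sumr_ge0 => j _; exact: modulus_ge0.
rewrite -mulr_suml.
have := Ac N (fun j => u j * x j).
move=> le1.
have Xux : carrier X (fun j => u j * x j) /\ seq_norm X (fun j => u j * x j) <= seq_norm X x.
  apply: (space_solid iX Xx) => j; rewrite modulusM ler_piMl ?modulus_ge0//.
  exact: (uP j).1.
have le2 := level_norm_le N Xux.1.
have le3 := le_trans le1 (ler_wpM2l c0 (le_trans le2 Xux.2)).
apply: le_trans le3.
have := ideal_norm_coord (modv (mx_act (mx_section A) (fun j : 'I_N => u j * x j)))
  (Ordinal iN) (level_norm_ideal N iY).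
have -> : level_norm Y (unit_vec R (Ordinal iN)) = level_norm Y (unit_vec R (@ord_max i)).
  rewrite /level_norm; congr seq_norm; apply/funext => l.
  have ue m (h : (i < m)%N) : ext (fun j => of_real k (unit_vec R (Ordinal h) j)) l = (l == i)%:R.
    case: (ltnP l m) => lm.
      rewrite -[l]/(val (Ordinal lm)) ext_ord /unit_vec -val_eqE/=.
      by case: eqP; rewrite ?of_real0 ?of_real1.
    rewrite ext_ge//; case: eqP => // li; move: lm; rewrite li leqNgt h//.
  by rewrite ue (ue _ (ltnSn i)).
congr (_ * _ <= _); rewrite /modv ger0_norm ?modulus_ge0//.
have -> : mx_act (mx_section A) (fun j : 'I_N => u j * x j) (Ordinal iN) =
    of_real k (\sum_(0 <= j < N) modulus (A i j * x j)).
  rewrite (mx_section_act A (fun j => u j * x j)) /mx_series /series/= of_real_sum; apply: eq_bigr => j _.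
  by rewrite -(uP j).2 mulrCA.
by rewrite modulus_of_real ger0_norm// sumr_ge0// => j _; exact: modulus_ge0.
Qed.

(** The image of x exists coordinatewise by absolute convergence of the rows.  Its
    sections are limits of images of sections of x, hence bounded, and the Fatou
    property of Y places it in Y.  Finitely supported vectors need not be dense
    in X. *)
Lemma section_bound_bounded_operator A c : section_bound X Y A c -> 0 <= c ->
  bounded_operators X Y A.
Proof.
move=> Ac c0.
have cvgA x i : carrier X x -> cvgn (mx_series A x i).
  move=> Xx; apply: summable_cvg => n; exact: section_row_summable Ac c0 Xx.
have YA x : carrier X x -> carrier Y (mx_apply A x) /\
    seq_norm Y (mx_apply A x) <= c * seq_norm X x.
  move=> Xx; apply: (fatou_sections fY) => n; rewrite -level_normE//.
  apply: (@level_norm_limit _ _ _ _ (fun L (i : 'I_n) => mx_series A x i L)) => //.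
    by move=> i; apply/cvg_modulus; exact: (cvgA x i Xx).
  near=> L.
  have nL : (n <= L)%N by near: L; exact: nbhs_infty_ge.
  apply: le_trans (_ : level_norm Y (modv (mx_act (mx_section A) (fun j : 'I_L => x j))) <= _).
    apply: le_trans (level_norm_sections n _ iY).
    rewrite !level_normE//; apply: (space_solid iY (space_ext iY _) _).2 => i.
    case: (ltnP i n) => h; last by rewrite ext_ge// modulus0 modulus_ge0.
    rewrite -[ i ]/(val (Ordinal h)) !ext_ord/=.
    rewrite -[ i ]/(val (Ordinal (leq_trans h nL))) ext_ord/=.
    by rewrite mx_section_act.
  apply: le_trans (Ac L _) _; rewrite ler_wpM2l//; exact: level_norm_le.
split=> [x Xx|]; first by split=> [i|]; [exact: cvgA|exact: (YA x Xx).1].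
by exists c => x Xx; exact: (YA x Xx).2.
Unshelve. all: by end_near. Qed.

End operators.
(** * Schur multipliers are uniformly bounded *)

Section uniform.
Context {R : realType} {k : scalars} (X Y : seq_space R k).
Hypotheses (iX : ideal_space X) (fY : fatou_space Y).
Local Notation K := (scalar_field R k).
Implicit Types (A B : nat -> nat -> K).

Let iY := fatou_ideal fY.

Lemma mx_actD (I J : finType) (a b : I -> J -> K) x i :
  mx_act (fun i j => a i j + b i j) x i = mx_act a x i + mx_act b x i.
Proof. by rewrite /mx_act -big_split/=; apply: eq_bigr => j _; rewrite mulrDl. Qed.

Lemma mx_actZ (I J : finType) s t (a : I -> J -> K) x i :
  mx_act (fun i j => s * a i j) (fun j => t * x j) i = s * t * mx_act a x i.
Proof. by rewrite /mx_act mulr_sumr; apply: eq_bigr => j _; ring. Qed.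

Lemma section_boundD A B c d : section_bound X Y A c -> section_bound X Y B d ->
  section_bound X Y (fun i j => A i j + B i j) (c + d).
Proof.
move=> Ac Bd n x; rewrite (_ : mx_act _ _ = fun i => mx_act (mx_section A) x i
    + mx_act (mx_section B) x i); last by apply/funext => i; rewrite -mx_actD.
by apply: le_trans (level_normD _ _ fY) _; rewrite mulrDl lerD//; [exact: Ac|exact: Bd].
Qed.

Lemma section_boundZ A c a : section_bound X Y A c ->
  section_bound X Y (fun i j => a * A i j) (modulus a * c).
Proof.
move=> Ac n x; rewrite (_ : mx_act _ _ = fun i => a * mx_act (mx_section A) x i).
  by rewrite level_normZ// -mulrA ler_wpM2l ?modulus_ge0//; exact: Ac.
by apply/funext => i; rewrite /mx_act mulr_sumr; apply: eq_bigr => j _; rewrite /mx_section mulrA.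
Qed.

Lemma mx_act_cvg n (u : nat -> nat -> nat -> K) A (x : 'I_n -> K) (i : 'I_n) :
  (forall i j, (fun L => modulus (u L i j - A i j)) @ \oo --> (0 : R)) ->
  (fun L => modulus (mx_act (mx_section (u L)) x i - mx_act (mx_section A) x i))
    @ \oo --> (0 : R).
Proof.
move=> uA.
apply: (@squeeze_cvgr _ _ _ _ (fun=> 0)
  (fun L => \sum_(j < n) modulus (u L i j - A i j) * modulus (x j))).
- apply: nearW => L; rewrite modulus_ge0/= /mx_act -sumrB.
  apply: le_trans (modulus_sum _ _) _; apply: ler_sum => j _.
  by rewrite -mulrBl modulusM.
- exact: cvg_cst.
- rewrite [X in _ --> X](_ : 0 = \sum_(j < n) 0 * modulus (x j)); last first.
    by rewrite big1// => j _; rewrite mul0r.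
  elim: (index_enum _) => [|j s IH].
    rewrite big_nil (_ : (fun _ => _) = cst 0); first exact: cvg_cst.
    by apply/funext => L; rewrite big_nil.
  rewrite big_cons (_ : (fun _ => _) = fun L => modulus (u L i j - A i j) * modulus (x j)
      + \sum_(j <- s) modulus (u L i j - A i j) * modulus (x j)).
    by apply: cvgD => //; apply: cvgMl; exact: uA.
  by apply/funext => L; rewrite big_cons.
Qed.

Lemma section_bound_limit (u : nat -> nat -> nat -> K) A c :
  (forall i j, (fun L => modulus (u L i j - A i j)) @ \oo --> (0 : R)) ->
  (\forall L \near \oo, section_bound X Y (u L) c) -> section_bound X Y A c.
Proof.
move=> uA uc n x.
apply: (@level_norm_limit _ _ _ _ (fun L => mx_act (mx_section (u L)) x)) => //.
  by move=> i; exact: mx_act_cvg.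
by apply: filterS uc => L; exact.
Qed.

Lemma section_bound_entry A n (i j : 'I_n) c : section_bound X Y A c ->
  modulus (A i j) <= c * (level_norm X (unit_vec R j) / level_norm Y (unit_vec R i)).
Proof.
move=> Ac; have uY := ideal_unit (level_norm_ideal n iY) i.
rewrite mulrA ler_pdivlMr//.
have modu : modv (fun l => of_real k (unit_vec R j l)) = unit_vec R j.
  rewrite modv_of_real; apply/funext => l; rewrite ger0_norm// /unit_vec; exact: ler0n.
have := Ac n (fun l => of_real k (unit_vec R j l)); rewrite modu; apply: le_trans.
have := ideal_norm_coord (modv (mx_act (mx_section A) (fun l => of_real k (unit_vec R j l)))) i
  (level_norm_ideal n iY).
congr (_ * _ <= _); rewrite /modv ger0_norm ?modulus_ge0//; congr modulus.
rewrite /mx_act (bigD1 j)//= big1 ?addr0 /unit_vec ?eqxx ?of_real1 ?mulr1//.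
by move=> l /negbTE lj; rewrite lj of_real0 mulr0.
Qed.

Variable M : nat -> nat -> K.

(** For fixed n and x this is a seminorm in the matrix A; uniform boundedness of M
    is boundedness of all these seminorms over matrices with bounded sections. *)
Definition schur_test n (x : 'I_n -> K) A : R :=
  level_norm Y (modv (mx_act (mx_section (schur_product M A)) x)).

Lemma schur_testD n (x : 'I_n -> K) A B :
  schur_test x (fun i j => A i j + B i j) <= schur_test x A + schur_test x B.
Proof.
apply: le_trans (level_normD _ _ fY); rewrite le_eqVlt; apply/orP; left; apply/eqP.
rewrite /schur_test; congr (level_norm _ (modv _)); apply/funext => i.
rewrite -mx_actD; apply: eq_bigr => j _; rewrite /mx_section /schur_product; ring.
Qed.

Lemma schur_testZ n (x : 'I_n -> K) s t A :
  schur_test (fun j => t * x j) (fun i j => s * A i j) = modulus (s * t) * schur_test x A.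
Proof.
rewrite /schur_test -level_normZ//; congr (level_norm _ (modv _)); apply/funext => i.
rewrite -mx_actZ; apply: eq_bigr => j _; rewrite /mx_section /schur_product; ring.
Qed.

Lemma schur_testZl n (x : 'I_n -> K) s A :
  schur_test x (fun i j => s * A i j) = modulus s * schur_test x A.
Proof.
have := schur_testZ x s 1 A; rewrite mulr1 => <-.
by congr schur_test; apply/funext => j; rewrite mul1r.
Qed.

Lemma schur_test_bounded n (x : 'I_n -> K) :
  exists b, forall A, section_bound X Y A 1 -> schur_test x A <= b.
Proof.
exists (\sum_(i < n) (\sum_(j < n) modulus (M i j) * (level_norm X (unit_vec R j)
  / level_norm Y (unit_vec R i)) * modulus (x j)) * level_norm Y (unit_vec R i)).
move=> A A1; apply: le_trans (level_norm_sum _ fY) _.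
apply: ler_sum => i _; rewrite ler_wpM2r ?(ltW (ideal_unit (level_norm_ideal n iY) i))//.
apply: le_trans (modulus_sum _ _) _; apply: ler_sum => j _.
rewrite !modulusM ler_wpM2r ?modulus_ge0// ler_wpM2l ?modulus_ge0//.
by have := section_bound_entry i j A1; rewrite mul1r.
Qed.

Definition schur_test_norm n (x : 'I_n -> K) : R :=
  sup [set r | exists2 A, section_bound X Y A 1 & r = schur_test x A].

Lemma section_bound0 c : 0 <= c -> section_bound X Y (fun _ _ => 0) c.
Proof.
move=> c0 n x.
rewrite (_ : modv _ = fun=> 0); last first.
  by apply/funext => i; rewrite /modv /mx_act big1 ?modulus0// => j _; rewrite /mx_section mul0r.
rewrite ideal_norm0; last exact: level_norm_ideal.
by rewrite mulr_ge0// ideal_norm_ge0//; exact: level_norm_ideal.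
Qed.

Lemma schur_test_has_sup n (x : 'I_n -> K) :
  has_sup [set r | exists2 A, section_bound X Y A 1 & r = schur_test x A].
Proof.
split; first by exists (schur_test x (fun _ _ => 0)), (fun _ _ => 0); first exact: section_bound0.
by have [b bP] := schur_test_bounded x; exists b => _ [A A1 ->]; exact: bP.
Qed.

Lemma schur_test_le n (x : 'I_n -> K) A c : 0 < c -> section_bound X Y A c ->
  schur_test x A <= c * schur_test_norm x.
Proof.
move=> c0 Ac; rewrite -ler_pdivrMl//.
have cE : modulus (of_real k c^-1) = c^-1 by rewrite modulus_of_real ger0_norm// invr_ge0 ltW.
have -> : c^-1 * schur_test x A = schur_test x (fun i j => of_real k c^-1 * A i j).
  by rewrite schur_testZl cE.
apply: ub_le_sup; first exact: (schur_test_has_sup x).2.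
exists (fun i j => of_real k c^-1 * A i j) => //.
by have := section_boundZ (of_real k c^-1) Ac; rewrite cE mulVf ?gt_eqF.
Qed.

(** Uniform boundedness principle, by a gliding hump.  If it fails, choose tests
    q_m of norm v_m > 8^m and matrices A_m of section bound 1 with
    q_m(A_m) >= v_m / 2.  Choose signs successively so that the partial sums S of
    the series of +- 4^-m A_m satisfy q_m(S_(m+1)) >= 4^-m v_m / 2; this is
    possible because q_m(S + B) + q_m(S - B) >= 2 q_m(B).  The tail after m + 1
    has section bound 4^-m / 3, hence costs at most 4^-m v_m / 3, and the sum A
    of the series satisfies q_m(A) >= 4^-m v_m / 6 >= 2^m / 6 for all m.  But A
    is a bounded operator, so that q_m(A) is bounded. *)
Lemma schur_multiplier_uniform : schur_multipliers X Y M ->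
  exists2 c, 0 <= c & forall A d, 0 < d -> section_bound X Y A d ->
    section_bound X Y (schur_product M A) (c * d).
Proof.
move=> Mschur; apply: contrapT => nuni.
have bad c : 0 <= c -> exists n (x : 'I_n -> K), level_norm X (modv x) <= 1 /\
    c < schur_test_norm x.
  move=> c0; apply: contrapT => nb; apply: nuni; exists c => // A d d0 Ad n x.
  have iN := level_norm_ideal n iX.
  have := ideal_norm_ge0 (modv x) iN; rewrite le_eqVlt => /orP[/eqP x0|x0].
    rewrite -x0 mulr0 (_ : modv _ = fun=> 0).
      by rewrite ideal_norm0//; exact: level_norm_ideal.
    apply/funext => i; rewrite /modv /mx_act big1 ?modulus0// => j _.
    rewrite (_ : x j = 0) ?mulr0//; apply: modulus_eq0.
    have := ideal_norm_coord (modv x) j iN; rewrite -x0 pmulr_lle0 ?(ideal_unit iN)//.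
    by rewrite normr_le0 => /eqP.
  pose s := of_real k (level_norm X (modv x))^-1.
  have sE : modulus s = (level_norm X (modv x))^-1.
    by rewrite modulus_of_real ger0_norm// invr_ge0 ltW.
  rewrite leNgt; apply/negP => lt; apply: nb; exists n, (fun j => s * x j); split.
    by rewrite level_normZ// sE mulVf// gt_eqF.
  have := schur_test_le (fun j => s * x j) d0 Ad.
  have := schur_testZ x 1 s A; rewrite mul1r sE.
  rewrite (_ : (fun i j => 1 * A i j) = A); last first.
    by apply/funext => i; apply/funext => j; rewrite mul1r.
  move=> ->; rewrite mulrC -ler_pdivrMl// => le; apply: lt_le_trans le.
  by rewrite mulrA ltr_pdivlMr// ltr_pdivlMl//; move: lt; rewrite mulrA (mulrC d).
have /choice[h hP] : forall m, exists p : {n & 'I_n -> K} * (nat -> nat -> K),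
    [/\ level_norm X (modv (projT2 p.1)) <= 1, 8 ^+ m < schur_test_norm (projT2 p.1),
       section_bound X Y p.2 1 &
       schur_test_norm (projT2 p.1) / 2 <= schur_test (projT2 p.1) p.2].
  move=> m; have [n [x [x1 xm]]] := bad (8 ^+ m) (exprn_ge0 m (ler0n R 8)).
  have v0 : 0 < schur_test_norm x by apply: lt_trans xm; rewrite exprn_gt0.
  have [_ [A A1 ->]] := sup_adherent (divr_gt0 v0 (ltr0Sn R 1)) (schur_test_has_sup x).
  rewrite -/(schur_test_norm x) => lt.
  exists (existT _ n x, A); split => //=; move: lt; rewrite /=; lra.
pose t m := projT2 (h m).1; pose q m A := schur_test (t m) A.
pose v m := schur_test_norm (t m).
pose W m := (4 ^+ m)^-1 : R.
have W0 m : 0 < W m by rewrite invr_gt0 exprn_gt0.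
have WS m : W m.+1 = W m / 4 by rewrite /W exprS invfM mulrC.
pose B m i j := of_real k (W m) * (h m).2 i j.
have qN m A a : modulus a = 1 -> q m (fun i j => a * A i j) = q m A.
  by move=> a1; rewrite /q schur_testZl a1 mul1r.
(* the sign of the m-th term is chosen so that the test q m grows *)
pose S := fix S m : nat -> nat -> K := match m with 0%N => fun _ _ => 0 | m.+1 =>
  if q m (B m) <= q m (fun i j => S m i j + B m i j) then fun i j => S m i j + B m i j
  else fun i j => S m i j + -1 * B m i j end.
pose D m i j := S m.+1 i j - S m i j.
have DB m : section_bound X Y (D m) (W m).
  have hB : section_bound X Y (B m) (W m).
    have [_ _ h1 _] := hP m; have := section_boundZ (of_real k (W m)) h1.
    by rewrite modulus_of_real ger0_norm ?(ltW (W0 m))// mulr1.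
  have hNB := section_boundZ (-1) hB; rewrite modulusN modulus1 mul1r in hNB.
  rewrite /D /=; case: ifP => _.
    by rewrite (_ : (fun _ _ => _) = B m)//; apply/funext => i; apply/funext => j; ring.
  by rewrite (_ : (fun _ _ => _) = fun i j => -1 * B m i j)//;
    apply/funext => i; apply/funext => j; ring.
have qS m : W m * v m / 2 <= q m (S m.+1).
  have qB : q m (B m) = W m * q m (h m).2.
    by rewrite /q schur_testZl modulus_of_real ger0_norm ?(ltW (W0 m)).
  apply: le_trans (_ : q m (B m) <= _).
    rewrite qB -mulrA ler_wpM2l ?(ltW (W0 m))//; by have [] := hP m.
  rewrite /=; case: ifP => //; move/negbT; rewrite -ltNge => lt.
  have : q m (fun i j => 2 * B m i j) <= q m (fun i j => S m i j + B m i j)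
      + q m (fun i j => -1 * (S m i j + -1 * B m i j)).
    apply: le_trans (schur_testD _ _ _); rewrite le_eqVlt; apply/orP; left; apply/eqP.
    by congr schur_test; apply/funext => i; apply/funext => j; ring.
  rewrite [X in _ + X]qN; last by rewrite modulusN modulus1.
  have -> : q m (fun i j => 2 * B m i j) = 2 * q m (B m).
    have two : (2 : K) = of_real k 2 by rewrite -[2]/(1 + 1) of_realD of_real1.
    by rewrite /q schur_testZl {1}two modulus_of_real ger0_norm.
  by lra.
have tail m l : section_bound X Y (fun i j => S (m + l)%N i j - S m i j)
    (4 / 3 * (W m - W (m + l)%N)).
  elim: l => [|l IH].
    rewrite addn0 subrr mulr0 (_ : (fun _ _ => _) = fun _ _ => 0); first exact: section_bound0.
    by apply/funext => i; apply/funext => j; rewrite subrr.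
  have := section_boundD IH (DB (m + l)%N); rewrite addnS WS.
  rewrite (_ : 4 / 3 * (W m - W (m + l)%N) + W (m + l)%N
    = 4 / 3 * (W m - W (m + l)%N / 4)); last by field.
  congr section_bound; apply/funext => i; apply/funext => j; rewrite /D; ring.
have tail' m L : (m <= L)%N -> section_bound X Y (fun i j => S L i j - S m i j) (4 / 3 * W m).
  move=> mL n x; have := tail m (L - m)%N n x; rewrite subnKC// => /le_trans; apply.
  rewrite ler_wpM2r ?ideal_norm_ge0//; first exact: level_norm_ideal.
  by rewrite ler_wpM2l// gerBl ltW.
have Scvg i j : cvgn (fun L => S L i j).
  pose N := (maxn i j).+1.
  have iN : (i < N)%N by rewrite ltnS leq_maxl.
  have jN : (j < N)%N by rewrite ltnS leq_maxr.
  pose E := level_norm X (unit_vec R (Ordinal jN)) / level_norm Y (unit_vec R (Ordinal iN)).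
  have E0 : 0 <= E.
    by rewrite divr_ge0// ideal_norm_ge0//; exact: level_norm_ideal.
  rewrite (_ : (fun L => _) = series (fun m => D m i j)); last first.
    apply/funext => L; rewrite /series/= /D telescope_sumr//= subr0//.
  apply: (@summable_cvg _ _ _ (4 / 3 * E)) => n.
  apply: le_trans (_ : 4 / 3 * (W 0 - W n) * E <= _); last first.
    rewrite ler_wpM2r// ger_pMr// ?divr_gt0//.
    by rewrite {1}/W expr0 invr1 gerBl ltW.
  elim: n => [|n IH]; first by rewrite big_geq// subrr mulr0 mul0r.
  rewrite big_nat_recr//=; apply: le_trans (lerD IH (section_bound_entry (Ordinal iN) (Ordinal jN) (DB n))) _.
  rewrite -/E -mulrDl ler_wpM2r// WS; lra.
pose A i j := limn (fun L => S L i j).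
have SA i j : (fun L => modulus (S L i j - A i j)) @ \oo --> (0 : R).
  by apply/cvg_modulus; exact: Scvg.
have Atail m : section_bound X Y (fun i j => A i j - S m i j) (4 / 3 * W m).
  apply: (@section_bound_limit (fun L i j => S L i j - S m i j)).
    move=> i j; apply: cvg_trans (SA i j); apply: near_eq_cvg; apply: nearW => L.
    by congr modulus; ring.
  near=> L; apply: tail'; near: L; exact: nbhs_infty_ge.
have Ab : section_bound X Y A (4 / 3).
  have := Atail 0%N; rewrite {1}/W expr0 invr1 mulr1.
  by congr section_bound; apply/funext => i; apply/funext => j; rewrite /= subr0.
have /bounded_operator_section_bound := Mschur A (section_bound_bounded_operator iX fY Ab (divr_ge0 (ler0n R 4) (ler0n R 3))).
case => // C CA.
have qA m : q m A <= Num.max C 0.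
  have [t1 _ _ _] := hP m.
  apply: le_trans (CA _ (t m)) _.
  apply: le_trans (_ : Num.max C 0 * level_norm X (modv (t m)) <= _).
    rewrite ler_wpM2r ?ideal_norm_ge0//; first exact: level_norm_ideal.
    by rewrite le_max lexx.
  by rewrite ler_piMr// le_max lexx orbT.
have grow m : 2 ^+ m / 6 <= q m A.
  have [_ vm _ _] := hP m.
  have W1 : 0 < 4 / 3 * W m.+1 by rewrite mulr_gt0 ?divr_gt0.
  have le1 := schur_test_le (t m) W1 (Atail m.+1).
  have : q m (S m.+1) <= q m A + q m (fun i j => -1 * (A i j - S m.+1 i j)).
    apply: le_trans (schur_testD _ _ _); rewrite le_eqVlt; apply/orP; left; apply/eqP.
    by congr schur_test; apply/funext => i; apply/funext => j; ring.
  rewrite [X in _ + X]qN; last by rewrite modulusN modulus1.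
  have := qS m; rewrite -/(v m) in le1 vm; rewrite WS in le1.
  have : 2 ^+ m <= W m * v m.
    rewrite ler_pdivlMl ?exprn_gt0// -exprMn (_ : 4 * 2 = 8) ?ltW//.
    by rewrite -natrM.
  rewrite -/(q m _) in le1; move: le1; rewrite mulrAC; lra.
pose m := (Num.truncn (6 * Num.max C 0)).+1.
have := le_trans (grow m) (qA m); rewrite ler_pdivrMr// leNgt => /negP; apply.
rewrite mulrC; apply: lt_trans (truncnS_gt _) _; rewrite -/m -natrX ltr_nat.
exact: ltn_expl.
Unshelve. all: by end_near. Qed.

End uniform.
(** * Multipliers from a 2-convex to a 2-concave space *)

Section characterization.
Context {R : realType} {k : scalars}.
Local Notation K := (scalar_field R k).
Implicit Types (A M : nat -> nat -> K) (X Y : seq_space R k).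

(** A section bound at one level n gives the same bound at all levels for the matrix
    extended by zero, since truncations are contractions in both spaces. *)
Lemma section_bound_ext X Y n (a : 'I_n -> 'I_n -> K) c : ideal_space X -> fatou_space Y ->
  0 <= c -> level_bound X Y a c ->
  section_bound X Y (fun i j => ext (fun i' : 'I_n => ext (a i') j) i) c.
Proof.
move=> iX fY c0 ac m x; have iY := fatou_ideal fY.
pose x' (j : 'I_n) := ext x j.
rewrite (_ : mx_act _ x = fun i : 'I_m => ext (mx_act a x') i).
  apply: le_trans (level_norm_sections m _ iY) _; apply: le_trans (ac x') _.
  rewrite ler_wpM2l//; exact: level_norm_sections.
apply/funext => i; rewrite /mx_act /mx_section.
case: (ltnP i n) => h; last by rewrite ext_ge// big1// => j _; rewrite ext_ge// mul0r.
rewrite -[ nat_of_ord i ]/(val (Ordinal h)) ext_ord.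
pose F l := ext (a (Ordinal h)) l * ext x l.
transitivity (\sum_(0 <= l < maxn m n) F l).
  transitivity (\sum_(0 <= l < m) F l).
    by rewrite big_mkord; apply: eq_bigr => j _; rewrite ext_ord /F ext_ord.
  rewrite [RHS](@big_cat_nat _ _ _ m)//= ?leq_maxl//.
  rewrite [X in _ + X]big1_seq ?addr0// => l; rewrite mem_index_iota => /andP[_ /andP[ml _]].
  by rewrite /F (ext_ge x ml) mulr0.
rewrite (@big_cat_nat _ _ _ n)//= ?leq_maxr// [X in _ + X]big1_seq ?addr0.
  by rewrite big_mkord; apply: eq_bigr => j _; rewrite /F ext_ord.
by move=> l; rewrite mem_index_iota => /andP[_ /andP[nl _]]; rewrite /F ext_ge ?mul0r.
Qed.

(** The common description of all the multiplier sets of the theorem. *)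
Definition l2_multiplier M := exists2 c, 0 <= c &
  forall n, schur_bound (@l2norm R 'I_n) (@l2norm R 'I_n) (mx_section (n := n) M) c.

Lemma schur_multipliersP X Y C D M : ideal_space X -> fatou_space Y ->
  0 < C -> 0 < D -> (forall n, convex2 C (@level_norm R k X n)) ->
  (forall n, concave2 D (@level_norm R k Y n)) ->
  schur_multipliers X Y M <-> l2_multiplier M.
Proof.
move=> iX fY C0 D0 cX cY; have iY := fatou_ideal fY.
have cY' n := dual_norm_convex2 (level_norm_ideal n iY) D0 (cY n).
have iP n := level_norm_ideal n iX.
have iQ n := dual_norm_ideal (level_norm_ideal n iY).
split.
  move=> /(schur_multiplier_uniform iX fY)[c c0 Mc].
  exists (C ^+ 2 * D ^+ 2 * c); first by rewrite !mulr_ge0// ltW.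
  move=> n; apply: (schur_bound_to_l2 (iP n) (iQ n) C0 D0 c0 (cX n) (cY' n)).
  move=> a d d0 /(level_bound_form a d iX fY) ad.
  apply/level_bound_form => //.
  have := Mc _ _ d0 (section_bound_ext iX fY (ltW d0) ad) n.
  congr level_bound; apply/funext => i; apply/funext => j.
  by rewrite /mx_section /schur_product !ext_ord.
move=> [c c0 Mc] A /(bounded_operator_section_bound iX fY)[d Ad].
pose d' := Num.max 1 d.
have d'0 : 0 < d' by rewrite lt_max ltr01.
have c'0 : 0 <= 784 * C * D * c.
  exact: (mulr_ge0 (mulr_ge0 (mulr_ge0 (ler0n R 784) (ltW C0)) (ltW D0)) c0).
apply: (@section_bound_bounded_operator _ _ _ _ iX fY _ (784 * C * D * c * d')); last first.
  exact: (mulr_ge0 c'0 (ltW d'0)).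
move=> n; apply/(level_bound_form _ _ iX fY).
apply: (schur_bound_from_l2 (iP n) (iQ n) C0 D0 c0 (cX n) (cY' n) (Mc n)) => //.
apply/(level_bound_form _ _ iX fY) => x; apply: le_trans (Ad n x) _.
by rewrite ler_wpM2r ?ideal_norm_ge0// le_max lexx orbT.
Qed.

Lemma ext_square_function n (I : finType) (x : I -> 'I_n -> R) :
  square_function (fun j : 'I_#|I| => ext (fun i => of_real k (x (enum_val j) i)))
  = ext (fun i => of_real k (quadratic_mean x i)).
Proof.
apply/funext => i; rewrite /square_function.
case: (ltnP i n) => h; last first.
  rewrite ext_ge// big1 ?sqrtr0 ?of_real0// => j _.
  by rewrite ext_ge// modulus0 expr0n.
rewrite -[ i ]/(val (Ordinal h)) ext_ord /quadratic_mean; congr (of_real k (Num.sqrt _)).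
rewrite [RHS](reindex (fun j : 'I_#|I| => enum_val j)); last first.
  by exists (@enum_rank I) => j _; rewrite ?enum_valK ?enum_rankK.
by apply: eq_bigr => j _; rewrite ext_ord modulus_of_real real_normK ?num_real.
Qed.

Lemma two_convex_level X : ideal_space X -> two_convex X ->
  exists2 C, 0 < C & forall n, convex2 C (@level_norm R k X n).
Proof.
move=> iX [C C0 cX]; exists C => // n I x.
have := cX _ (fun j : 'I_#|I| => ext (fun i => of_real k (x (enum_val j) i)))
  (fun j => space_ext iX _).
rewrite ext_square_function => /le_trans; apply.
rewrite ler_wpM2l ?(ltW C0)// [in leRHS](reindex (fun j : 'I_#|I| => enum_val j))//=.
by exists (@enum_rank I) => j _; rewrite ?enum_valK ?enum_rankK.
Qed.

Lemma two_concave_level X : ideal_space X -> two_concave X ->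
  exists2 C, 0 < C & forall n, concave2 C (@level_norm R k X n).
Proof.
move=> iX [C C0 cX]; exists C => // n I x.
have := cX _ (fun j : 'I_#|I| => ext (fun i => of_real k (x (enum_val j) i)))
  (fun j => space_ext iX _).
rewrite ext_square_function; apply: le_trans.
rewrite [in leLHS](reindex (fun j : 'I_#|I| => enum_val j))//=.
by exists (@enum_rank I) => j _; rewrite ?enum_valK ?enum_rankK.
Qed.

End characterization.

(** * Symmetric sequence spaces *)

Section symmetric.
Context {R : realType} {k : scalars}.
Local Notation K := (scalar_field R k).
Variables (E : seq_space R k) (sE : symmetric_space E).

(** Every superlevel set of a unit vector is empty or a singleton. *)
Lemma rearrangement_unit (i : nat) :
  rearrangement (fun j => (j == i)%:R : K) = rearrangement (fun j => (j == 0)%N%:R : K).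
Proof.
apply/funext => n; congr inf; apply/predeqP => t.
have setE l : 0 <= t -> [set j | t < modulus ((j == l)%:R : K)] = if t < 1 then [set l] else set0.
  move=> t0; rewrite predeqE => j /=; case: eqP => [->|jl].
    by rewrite modulus1; case: ifP => h; split.
  by rewrite modulus0 ltNge t0; case: ifP => h; split.
by split=> -[t0 le]; split=> //; move: le; rewrite !setE//; case: ifP => // _;
  rewrite (card_le_eql (eq_card1 i 0%N)).
Qed.

Lemma finite_support_c0 n (x : 'I_n -> K) : c0 (ext x).
Proof.
rewrite /c0/=; apply: cvg_near_cst; near=> i.
by apply/eqP; rewrite ext_ge//; near: i; exact: nbhs_infty_ge.
Unshelve. all: by end_near. Qed.

Lemma ext_unit_vec n (i : 'I_n) : ext (unit_vec K i) = (fun j => (j == i)%:R).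
Proof.
apply/funext => j; case: (ltnP j n) => h.
  by rewrite -[ j ]/(val (Ordinal h)) ext_ord /unit_vec -val_eqE.
by rewrite ext_ge//; case: eqP => // ji; move: h; rewrite ji leqNgt ltn_ord.
Qed.

Lemma symmetric_unit n (i : 'I_n) :
  carrier E (ext (unit_vec K i)) /\ seq_norm E (ext (unit_vec K i)) = 1.
Proof.
rewrite -(sym_unit_norm sE); apply: (sym_rearrangement sE (sym_unit_mem sE)).
  exact: finite_support_c0.
by rewrite ext_unit_vec rearrangement_unit.
Qed.

Lemma symmetric_ideal : ideal_space E.
Proof.
have ext_mem n (x : 'I_n -> K) : carrier E (ext x).
  rewrite (_ : ext x = fun i => \sum_j x j * ext (unit_vec K j) i); last first.
    apply/funext => i; case: (ltnP i n) => h; last first.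
      by rewrite ext_ge// big1// => j _; rewrite ext_ge// mulr0.
    rewrite -[ i ]/(val (Ordinal h)) ext_ord (bigD1 (Ordinal h))//=.
    rewrite ext_unit_vec eqxx mulr1 big1 ?addr0// => j jh.
    rewrite ext_unit_vec; case: eqP => [e|]; last by rewrite mulr0.
    by move: jh; rewrite -val_eqE/= e eqxx.
  elim: (index_enum _) => [|j s IH].
    rewrite (_ : (fun _ => _) = fun=> 0); first exact: (sym_0 sE).
    by apply/funext => i; rewrite big_nil.
  rewrite (_ : (fun _ => _) = fun i => x j * ext (unit_vec K j) i +
      \sum_(l <- s) x l * ext (unit_vec K l) i); last by apply/funext => i; rewrite big_cons.
  apply: (sym_add sE) => //; apply: (sym_scale sE); exact: (symmetric_unit j).1.
split=> // [x y Ey xy|n a x|n i].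
- apply: (sym_solid sE) => //; rewrite /c0/=; apply/cvg_modulus.
  apply: (@squeeze_cvgr _ _ _ _ (fun=> 0) (fun n => modulus (y n - 0))).
  + by apply: nearW => i; rewrite modulus_ge0 !subr0/= xy.
  + exact: cvg_cst.
  + by apply/cvg_modulus; exact: (sym_c0 sE Ey).
- rewrite -(sym_norm_scale sE a (ext_mem _ x)); congr seq_norm; apply/funext => i.
  by rewrite /ext; case: insub => //; rewrite mulr0.
- by rewrite (symmetric_unit i).2.
Qed.

Lemma symmetric_norm_ge0 x : carrier E x -> 0 <= seq_norm E x.
Proof.
move=> Ex; have := (space_solid symmetric_ideal (x := fun=> 0) Ex).
have z : seq_norm E (fun=> 0) = 0.
  rewrite (_ : (fun _ => _) = fun i : nat => 0 * (fun=> 0 : K) i).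
    by rewrite (sym_norm_scale sE _ (sym_0 sE)) modulus0 mul0r.
  by apply/funext => i; rewrite mul0r.
by rewrite z => h; apply: (h _).2 => i; rewrite modulus0 modulus_ge0.
Qed.

(** Otherwise there are arbitrarily many successive disjoint blocks of y of norm at
    least e.  The quadratic mean of L such blocks is dominated by a section of y,
    so that 2-concavity gives sqrt L e <= C c for all L. *)
Lemma two_concave_tails (y : nat -> K) c e : two_concave E -> 0 < e ->
  (forall n, seq_norm E (ext (fun i : 'I_n => y i)) <= c) ->
  exists N, forall m n, (N <= n)%N -> (n <= m)%N ->
    seq_norm E (fun i => ext (fun j : 'I_m => y j) i - ext (fun j : 'I_n => y j) i) < e.
Proof.
move=> [C C0 cE] e0 yc; apply: contrapT => nN; have iE := symmetric_ideal.
pose b m n i := ext (fun j : 'I_m => y j) i - ext (fun j : 'I_n => y j) i.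
have bE m n i : (n <= m)%N -> b m n i = if (n <= i < m)%N then y i else 0.
  move=> nm; rewrite /b; case: (ltnP i m) => im.
    rewrite ext_lt//; case: (ltnP i n) => jn; first by rewrite ext_lt// subrr.
    by rewrite ext_ge// subr0.
  by rewrite !ext_ge ?subrr ?andbF// (leq_trans nm).
have Eb m n : (n <= m)%N -> carrier E (b m n).
  move=> nm; apply: (space_solid iE (space_ext iE (fun j : 'I_m => y j)) _).1 => i.
  rewrite bE//; case: ifP => [/andP[_ h]|_]; first by rewrite ext_lt.
  by rewrite modulus0 modulus_ge0.
have big L : exists M, exists x : nat -> nat -> K, [/\ forall l, carrier E (x l),
    forall l, (l < L)%N -> e <= seq_norm E (x l) &
    forall i, \sum_(0 <= l < L) modulus (x l i) ^+ 2 <= modulus (ext (fun j : 'I_M => y j) i) ^+ 2].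
  elim: L => [|L [M [x [xE xe xM]]]].
    exists 0%N, (fun _ _ => 0); split=> [l|l|i] //; first exact: (sym_0 sE).
    by rewrite big_geq// sqr_ge0.
  have [m [n [Mn nm le]]] : exists m n, [/\ (M <= n)%N, (n <= m)%N & e <= seq_norm E (b m n)].
    apply: contrapT => h; apply: nN; exists M => m n Mn nm; rewrite ltNge.
    by apply/negP => le; apply: h; exists m, n.
  exists m, (fun l => if l == L then b m n else x l); split=> [l|l|i].
  - by case: eqP => _; [exact: Eb|exact: xE].
  - by rewrite ltnS leq_eqVlt; case: eqP => // _ /= lL; exact: xe.
  rewrite big_nat_recr//= eqxx.
  rewrite (eq_big_nat _ _ (F2 := fun l => modulus (x l i) ^+ 2)); last first.
    by move=> l /andP[_ lL]; rewrite (ltn_eqF lL).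
  have := xM i; rewrite bE//; case: (ltnP i m) => im; last first.
    rewrite !ext_ge//; last by rewrite (leq_trans Mn)// (leq_trans nm).
    by rewrite andbF modulus0 expr0n addr0.
  rewrite [in X in _ -> X]ext_lt// andbT; case: (leqP n i) => ni.
    by rewrite ext_ge ?(leq_trans Mn)// modulus0 expr0n/= => h; rewrite gerDr.
  rewrite modulus0 expr0n addr0 => /le_trans; apply.
  case: (ltnP i M) => iM; first by rewrite ext_lt.
  by rewrite ext_ge// modulus0 expr0n sqr_ge0.
pose L := (Num.truncn ((C * c / e) ^+ 2)).+1.
have [M [x [xE xe xM]]] := big L.
have := cE L (fun l => x l) (fun l => xE l).
have le1 : seq_norm E (square_function (fun l : 'I_L => x l)) <= c.
  apply: le_trans (yc M); apply: (space_solid iE (space_ext iE _) _).2 => i.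
  rewrite /square_function modulus_of_real ger0_norm ?sqrtr_ge0//.
  rewrite -[leRHS]ger0_norm ?modulus_ge0// -sqrtr_sqr ler_sqrt ?sqr_ge0//.
  by have := xM i; rewrite big_mkord.
have le2 : Num.sqrt (L%:R * e ^+ 2) <= Num.sqrt (\sum_(j < L) seq_norm E (x j) ^+ 2).
  rewrite ler_sqrt; last by rewrite sumr_ge0// => j _; exact: sqr_ge0.
  rewrite mulr_natl -[in leLHS](card_ord L) -sumr_const; apply: ler_sum => j _.
  by rewrite ler_sqr ?nnegrE ?(ltW e0) ?symmetric_norm_ge0// xe.
move=> le3; have := le_trans le2 (le_trans le3 (ler_wpM2l (ltW C0) le1)).
have c0 : 0 <= c by apply: le_trans (yc 0%N); apply: symmetric_norm_ge0; exact: space_ext.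
have Cc0 : 0 <= C * c by rewrite mulr_ge0// ltW.
have Le0 : 0 <= L%:R * e ^+ 2 by rewrite mulr_ge0 ?sqr_ge0.
rewrite -ler_sqr ?nnegrE ?sqrtr_ge0// sqr_sqrtr// -ler_pdivlMr ?exprn_gt0//.
rewrite -exprVn -exprMn leNgt => /negP; apply; exact: truncnS_gt.
Qed.

(** The sections of y form a Cauchy sequence; its limit has the coordinates of y,
    because the norm dominates each coordinate. *)
Lemma symmetric_fatou : two_concave E -> fatou_space E.
Proof.
move=> cE; have iE := symmetric_ideal; split=> // [n x y|y c yc].
  apply: le_trans (sym_norm_triangle sE (space_ext iE x) (space_ext iE y)).
  rewrite le_eqVlt; apply/orP; left; apply/eqP; congr seq_norm; apply/funext => i.
  by rewrite /ext; case: insub => //; rewrite addr0.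
pose u n := ext (fun i : 'I_n => y i).
have uE n : carrier E (u n) by exact: space_ext.
have subE x x' : carrier E x -> carrier E x' -> carrier E (fun i => x i - x' i).
  move=> Ex Ex'; rewrite (_ : (fun _ => _) = fun i => x i + -1 * x' i).
    by apply: (sym_add sE) => //; exact: (sym_scale sE).
  by apply/funext => i; rewrite mulN1r.
have subC x x' : carrier E x -> carrier E x' ->
    seq_norm E (fun i => x i - x' i) = seq_norm E (fun i => x' i - x i).
  move=> Ex Ex'; rewrite (_ : (fun i => x i - x' i) = fun i => -1 * (x' i - x i)).
    by rewrite (sym_norm_scale sE _ (subE _ _ Ex' Ex)) modulusN modulus1 mul1r.
  by apply/funext => i; rewrite mulN1r opprB.
have [|z Ez uz] := sym_complete sE uE.
  move=> e e0; have [N NP] := two_concave_tails cE e0 yc; exists N => m n Nm Nn.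
  by case: (leqP n m) => [|/ltnW] nm; [|rewrite subC//]; exact: NP.
have zy : z = y.
  apply/funext => i; apply/eqP; rewrite -subr_eq0; apply/eqP; apply: modulus_eq0.
  apply/eqP; rewrite eq_le modulus_ge0 andbT; apply/ler_addgt0Pr => e e0; rewrite add0r.
  have /cvgrPdist_lt/(_ _ e0) uze := uz.
  have [n [ne ni]] := filter_ex (filterI uze (nbhs_infty_gt i)).
  rewrite /= in ne ni.
  have Ed := subE _ _ (uE n) Ez.
  have := level_norm_le iE n Ed.
  have := ideal_norm_coord (modv (fun i : 'I_n => u n i - z i)) (Ordinal ni) (level_norm_ideal n iE).
  have -> : level_norm E (unit_vec R (Ordinal ni)) = 1.
    rewrite -(symmetric_unit (Ordinal ni)).2 -level_normE//; congr level_norm.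
    apply/funext => j; rewrite /modv /unit_vec; case: eqP => _; by rewrite ?modulus1 ?modulus0.
  rewrite mulr1 /modv ger0_norm ?modulus_ge0//= /u ext_lt// => le1 le2.
  rewrite -modulusN opprB; apply: le_trans le1 (le_trans le2 _).
  by apply: le_trans (ltW ne); rewrite sub0r normrN ler_norm.
rewrite -zy; split=> //; apply/ler_addgt0Pr => e e0.
have /cvgrPdist_lt/(_ _ e0) uze := uz.
have [n ne] := filter_ex uze; rewrite /= sub0r normrN in ne.
rewrite [X in seq_norm E X <= _](_ : z = fun i => u n i + (z i - u n i)).
  apply: le_trans (sym_norm_triangle sE (uE n) (subE _ _ Ez (uE n))) _.
  rewrite lerD// ?yc// subC//; apply: ltW; exact: le_lt_trans (ler_norm _) ne.
by apply/funext => i; rewrite subrKC.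
Qed.

End symmetric.
(** * The spaces l_p as ideal spaces *)

Section ell.
Context {R : realType} {k : scalars}.
Local Notation K := (scalar_field R k).

Lemma lee_poweR (a b : \bar R) r : 0 <= r -> (0 <= a)%E -> (a <= b)%E ->
  (a `^ r <= b `^ r)%E.
Proof.
move=> r0 a0 ab; apply: gt0_ler_poweR => //; rewrite in_itv/= leey andbT//.
exact: le_trans ab.
Qed.

(** The inequality [ell_norm p x <= c] in elementary terms, with finite partial
    sums; solidity, homogeneity and the Fatou property become immediate. *)
Definition in_ball (p : \bar R) (c : R) (x : nat -> K) : Prop :=
  match p with
  | r%:E => forall n, \sum_(0 <= i < n) modulus (x i) `^ r <= c `^ r
  | _ => forall i, modulus (x i) <= c
  end.

Lemma ell_norm_le p c (x : nat -> K) : (1 <= p)%E -> 0 <= c ->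
  (ell_norm p x <= c%:E)%E <-> in_ball p c x.
Proof.
move=> p1 c0; case: p p1 => [r| |]//=.
- rewrite lee_fin => r1; have r0 : 0 < r by lra.
  have mE i : (`|(modulus (x i))%:E| `^ r)%E = (modulus (x i) `^ r)%:E.
    by rewrite /= ger0_norm ?modulus_ge0// poweR_EFin.
  rewrite /ell_norm Lnorm_counting//.
  under eq_eseriesr do rewrite mE.
  set S := (\sum_(_ <oo) _)%E.
  have S0 : (0 <= S)%E by apply: nneseries_ge0 => i _ _; rewrite lee_fin powR_ge0.
  have SP : (S <= (c `^ r)%:E)%E <-> forall n, \sum_(0 <= i < n) modulus (x i) `^ r <= c `^ r.
    split=> [le n|le].
      rewrite -lee_fin; apply: le_trans le; rewrite -sumEFin.
      by apply: nneseries_lim_ge => i _; rewrite lee_fin powR_ge0.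
    apply: lime_le.
      by apply: is_cvg_nneseries => i _ _; rewrite lee_fin powR_ge0.
    by apply: nearW => n; rewrite sumEFin lee_fin.
  rewrite -SP; split=> le.
    have := lee_poweR (ltW r0) (poweR_ge0 _ _) le.
    by rewrite poweR_EFin -poweRrM mulVf ?gt_eqF// poweRe1.
  have ri0 : 0 <= r^-1 by rewrite invr_ge0 ltW.
  have := lee_poweR ri0 S0 le.
  by rewrite poweR_EFin -powRrM mulfV ?gt_eqF// powRr1.
- move=> _; rewrite /ell_norm unlock /=.
  have cnt : (0 < @counting nat R [set: nat])%E.
    by rewrite /counting asboolF ?ltry//; exact: infinite_nat.
  rewrite cnt; split=> [/ess_supP ae i|h].
    have [N [_ N0 sub]] := ae.
    have NE : N = set0.
      apply: contrapT => /eqP/set0P[j Nj].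
      have cN : @counting nat R N = 0%E by exact: N0.
      have [fN|fN] := pselect (finite_set N); last by rewrite /counting asboolF in cN.
      rewrite /counting asboolT// in cN; move/eqP: cN; rewrite eqe pnatr_eq0 cardfs_eq0 => /eqP Ne.
      have : j \in fset_set N by rewrite in_fset_set// inE.
      by rewrite Ne.
    apply: contrapT => ni; suff: N i by rewrite NE.
    apply: sub => /= le; apply: ni; move: le.
    by rewrite lee_fin ger0_norm ?modulus_ge0.
  apply/ess_supP; apply: nearW => i /=.
  by rewrite lee_fin ger0_norm ?modulus_ge0.
Qed.

Lemma ell_norm_ge0 p (x : nat -> K) : (0 <= ell_norm p x)%E.
Proof. exact: Lnorm_ge0. Qed.

Lemma carrier_ell p (x : nat -> K) : (1 <= p)%E -> carrier (ell k p) x ->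
  0 <= seq_norm (ell k p) x /\ in_ball p (seq_norm (ell k p) x) x.
Proof.
move=> p1 /= xfin; have x0 := ell_norm_ge0 p x.
have c0 : 0 <= fine (ell_norm p x) by exact: fine_ge0.
split=> //; apply/(ell_norm_le x p1 c0); rewrite fineK//.
by rewrite ge0_fin_numE.
Qed.

Lemma in_ball_ell p (x : nat -> K) c : (1 <= p)%E -> 0 <= c -> in_ball p c x ->
  carrier (ell k p) x /\ seq_norm (ell k p) x <= c.
Proof.
move=> p1 c0 /(ell_norm_le x p1 c0) le.
have fin : (ell_norm p x < +oo)%E by apply: le_lt_trans le (ltry _).
split=> //=; rewrite -lee_fin fineK// ge0_fin_numE//; exact: ell_norm_ge0.
Qed.

Lemma in_ball_mono p c (x y : nat -> K) : (1 <= p)%E ->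
  (forall i, modulus (x i) <= modulus (y i)) -> in_ball p c y -> in_ball p c x.
Proof.
case: p => [r| |]//=; last by move=> _ xy yc i; exact: le_trans (xy i) (yc i).
rewrite lee_fin => r1 xy yc n; apply: le_trans (yc n); apply: ler_sum => i _.
by rewrite ge0_ler_powR ?nnegrE ?modulus_ge0//; lra.
Qed.

Lemma in_ball_ext_pow n r (x : 'I_n -> K) : 1 <= r ->
  in_ball r%:E ((\sum_i modulus (x i) `^ r) `^ r^-1) (ext x).
Proof.
move=> r1; have r0 : r != 0 by lra.
set S := \sum_i _; have S0 : 0 <= S by apply: sumr_ge0 => i _; exact: powR_ge0.
move=> m; rewrite -powRrM mulVf// powRr1//.
pose F l := modulus (ext x l) `^ r.
have F0 l : 0 <= F l by exact: powR_ge0.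
apply: le_trans (_ : \sum_(0 <= l < maxn m n) F l <= _).
  rewrite [leRHS](@big_cat_nat _ _ _ m)//= ?leq_maxl// lerDl.
  by apply: sumr_ge0.
rewrite (@big_cat_nat _ _ _ n)//= ?leq_maxr// [X in _ + X]big1_seq ?addr0.
  by rewrite big_mkord /S; apply: ler_sum => i _; rewrite /F ext_ord.
by move=> l; rewrite mem_index_iota => /andP[_ /andP[nl _]]; rewrite /F ext_ge// modulus0 powR0.
Qed.

Lemma in_ball_ext n p (x : 'I_n -> K) : (1 <= p)%E ->
  exists2 c, 0 <= c & in_ball p c (ext x).
Proof.
case: p => [r| |]// => [r1|_].
  exists ((\sum_i modulus (x i) `^ r) `^ r^-1); first exact: powR_ge0.
  by apply: in_ball_ext_pow; rewrite -lee_fin.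
exists (\sum_i modulus (x i)); first by apply: sumr_ge0 => i _; exact: modulus_ge0.
move=> i /=; case: (ltnP i n) => h; last first.
  by rewrite ext_ge// modulus0 sumr_ge0// => j _; exact: modulus_ge0.
rewrite -[ i ]/(val (Ordinal h)) ext_ord (bigD1 (Ordinal h))//= lerDl.
by apply: sumr_ge0 => j _; exact: modulus_ge0.
Qed.

Lemma in_ball_scale p c a (x : nat -> K) : (1 <= p)%E -> 0 <= c -> in_ball p c x ->
  in_ball p (modulus a * c) (fun i => a * x i).
Proof.
move=> p1 c0; case: p p1 => [r| |]//= => [_ xc n|_ xc i]; last first.
  by rewrite modulusM ler_wpM2l ?modulus_ge0.
rewrite powRM ?modulus_ge0//; under eq_bigr do rewrite modulusM powRM ?modulus_ge0//.
by rewrite -mulr_sumr ler_wpM2l ?powR_ge0.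
Qed.

Lemma ell_ideal (p : \bar R) : (1 <= p)%E -> ideal_space (ell k p).
Proof.
move=> p1.
have fin n (x : 'I_n -> K) : carrier (ell k p) (ext x).
  by have [c c0 xc] := in_ball_ext x p1; have [] := in_ball_ell p1 c0 xc.
have scale_le n a (x : 'I_n -> K) :
    seq_norm (ell k p) (ext (fun i => a * x i)) <= modulus a * seq_norm (ell k p) (ext x).
  have [c0 xc] := carrier_ell p1 (fin _ x).
  have := in_ball_scale a p1 c0 xc => /(in_ball_ell p1).
  rewrite mulr_ge0 ?modulus_ge0// => /(_ isT)[_]; apply: le_trans.
  rewrite le_eqVlt; apply/orP; left; apply/eqP; congr seq_norm; apply/funext => i.
  by rewrite /ext; case: insub => //; rewrite mulr0.
split=> // [x y yE xy|n a x|n i].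
- have [c0 yc] := carrier_ell p1 yE.
  exact: in_ball_ell p1 c0 (in_ball_mono p1 xy yc).
- apply/eqP; rewrite eq_le scale_le/=.
  have [->|a0] := eqVneq a 0.
    by rewrite modulus0 mul0r; have [] := carrier_ell p1 (fin _ (fun i => 0 * x i)).
  have m0 : 0 < modulus a.
    rewrite lt_neqAle modulus_ge0 andbT eq_sym; apply: contra_neq a0; exact: modulus_eq0.
  have := scale_le _ a^-1 (fun i => a * x i).
  rewrite modulusV ler_pdivlMl//; congr (_ * seq_norm _ (ext _) <= _).
  by apply/funext => i; rewrite mulKf.
- have [c0 uc] := carrier_ell p1 (fin _ (unit_vec K i)).
  rewrite lt_neqAle c0 andbT eq_sym; apply/eqP => z; rewrite z in uc.
  have ui : modulus (ext (unit_vec K i) i) = 1 by rewrite ext_ord /unit_vec eqxx modulus1.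
  case: p p1 {fin scale_le c0 z} uc => [r| |]// => [|_ /(_ i)]; last first.
    by rewrite ui ler10.
  rewrite lee_fin => r1 /(_ i.+1); rewrite powR0; last by lra.
  rewrite big_nat_recr//= ui powR1 leNgt => /negP; apply.
  by rewrite ltr_wpDl ?ltr01// sumr_ge0// => j _; exact: powR_ge0.
Qed.

Lemma ell_fatou (p : \bar R) : (1 <= p)%E -> fatou_space (ell k p).
Proof.
move=> p1; have iE := ell_ideal p1; split=> // [n x y|y c yc].
  have [cx _] := carrier_ell p1 (space_ext iE x).
  have [cy _] := carrier_ell p1 (space_ext iE y).
  have [cxy _] := carrier_ell p1 (space_ext iE (fun i => x i + y i)).
  have fn (z : 'I_n -> K) : (seq_norm (ell k p) (ext z))%:E = ell_norm p (ext z).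
    rewrite /= fineK// ge0_fin_numE ?ell_norm_ge0//; exact: (space_ext iE z).
  rewrite -lee_fin EFinD !fn.
  pose z i := of_real k (modulus (ext x i) + modulus (ext y i)).
  have mink : (ell_norm p z <= ell_norm p (ext x) + ell_norm p (ext y))%E.
    rewrite (_ : ell_norm p z = Lnorm (@counting nat R) p
      (EFin \o ((fun i => modulus (ext x i)) \+ (fun i => modulus (ext y i))))).
      exact: eminkowski.
    apply: eq_Lnorm => i; rewrite /= /z modulus_of_real ger0_norm//.
    by rewrite addr_ge0 ?modulus_ge0.
  refine (le_trans _ mink).
  have [fz|] := boolP (ell_norm p z < +oo)%E; last by rewrite ltey negbK => /eqP ->; rewrite leey.
  have [z0 zb] := carrier_ell p1 fz.
  have -> : ell_norm p z = (fine (ell_norm p z))%:E.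
    by rewrite fineK// ge0_fin_numE// ell_norm_ge0.
  apply/(ell_norm_le _ p1 z0); apply: in_ball_mono zb => // i.
  rewrite /z modulus_of_real ger0_norm ?addr_ge0 ?modulus_ge0//.
  rewrite (_ : ext (fun i => x i + y i) i = ext x i + ext y i) ?modulusD//.
  by rewrite /ext; case: insub => //; rewrite addr0.
have [c00 _] := carrier_ell p1 (space_ext iE (fun i : 'I_0 => y i)).
have c0 := le_trans c00 (yc 0%N).
apply: in_ball_ell => //.
have sec n : in_ball p c (ext (fun i : 'I_n => y i)).
  have [z0 _] := carrier_ell p1 (space_ext iE (fun i : 'I_n => y i)).
  apply/(ell_norm_le _ p1 c0); apply: le_trans (_ : (seq_norm (ell k p) (ext (fun i : 'I_n => y i)))%:E <= _)%E.
    rewrite /= fineK// ge0_fin_numE ?ell_norm_ge0//; exact: (space_ext iE _).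
  by rewrite lee_fin.
case: p {p1 iE c00 yc} sec => [r| |] /= sec.
- move=> n; apply: le_trans (sec n n); rewrite le_eqVlt; apply/orP; left; apply/eqP.
  by apply: eq_big_nat => i /andP[_ h]; rewrite ext_lt.
- by move=> i; have := sec i.+1 i; rewrite ext_lt.
- by move=> i; have := sec i.+1 i; rewrite ext_lt.
Qed.

End ell.
Arguments ell_ideal {R} k {p}.
Arguments ell_fatou {R} k {p}.
(** * Quadratic Hölder inequalities *)

Section powers.
Context {R : realType}.

Lemma young_powR (u v t : R) : 0 <= u -> 0 <= v -> 0 < t <= 1 ->
  u `^ t * v `^ (1 - t) <= t * u + (1 - t) * v.
Proof.
move=> u0 v0 /andP[t0]; rewrite le_eqVlt => /orP[/eqP ->|t1].
  by rewrite subrr powRr0 powRr1// mulr1 mul1r mul0r addr0.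
have s0 : 0 < 1 - t by rewrite subr_gt0.
have := @conjugate_powR R (u `^ t) (v `^ (1 - t)) t^-1 (1 - t)^-1
  (powR_ge0 _ _) (powR_ge0 _ _).
rewrite !invr_gt0 !invrK subrKC => /(_ t0 s0 erefl).
by rewrite -!powRrM !mulfV ?gt_eqF// !powRr1// (mulrC u) (mulrC v).
Qed.

Lemma powR_div (z w e : R) : 0 <= z -> 0 < w -> (z / w) `^ e = z `^ e / w `^ e.
Proof.
move=> z0 w0; rewrite powRM ?invr_ge0 ?(ltW w0)//; congr (_ * _).
by rewrite -(powR_inv1 (ltW w0)) -powRrM mulN1r powRN.
Qed.

(** Young's inequality for the normalized entries a_i / A and b_i / B, with the
    exponents 2 / r and 1 - 2 / r, summed over i. *)
Lemma hoelder_square (I : finType) (a b : I -> R) (A B r : R) : 2 <= r ->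
  0 < A -> 0 < B -> (forall i, 0 <= a i) -> (forall i, 0 <= b i) ->
  \sum_i a i `^ r <= A `^ r -> \sum_i b i `^ r <= B `^ r ->
  \sum_i a i `^ (r - 2) * b i ^+ 2 <= A `^ (r - 2) * B ^+ 2.
Proof.
move=> r2 A0 B0 a0 b0 aA bB; have r0 : 0 < r by lra.
have An : 0 < A `^ (r - 2) by exact: powR_gt0.
have Ar : 0 < A `^ r by exact: powR_gt0.
have Br : 0 < B `^ r by exact: powR_gt0.
pose t := 2 / r.
have t01 : 0 < t <= 1 by rewrite divr_gt0//= ler_pdivrMr// mul1r.
have tr : t * r = 2 by rewrite divfK// gt_eqF.
have term i : a i `^ (r - 2) * b i ^+ 2 <= A `^ (r - 2) * B ^+ 2 *
    (t * (b i `^ r / B `^ r) + (1 - t) * (a i `^ r / A `^ r)).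
  have := young_powR (u := b i `^ r / B `^ r) (v := a i `^ r / A `^ r)
    (divr_ge0 (powR_ge0 _ _) (ltW Br)) (divr_ge0 (powR_ge0 _ _) (ltW Ar)) t01.
  have norm (z Z s : R) : 0 <= z -> 0 < Z -> (z `^ r / Z `^ r) `^ s = z `^ (r * s) / Z `^ (r * s).
    by move=> z0 Z0; rewrite powR_div ?powR_ge0 ?powR_gt0// -!powRrM.
  rewrite !norm// (mulrC r t) tr mulrBr mulr1 (mulrC r t) tr.
  rewrite -[2]/(2%:R) !powR_mulrn ?(ltW B0)// => le.
  have P0 : 0 < A `^ (r - 2) * B ^+ 2 by rewrite mulr_gt0// exprn_gt0.
  rewrite -ler_pdivrMl//; apply: le_trans le.
  rewrite le_eqVlt; apply/orP; left; apply/eqP; field.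
  by rewrite gt_eqF// gt_eqF.
apply: le_trans (ler_sum _ (fun i _ => term i)) _.
rewrite -mulr_sumr ler_piMr//; first by rewrite mulr_ge0 ?(ltW An) ?sqr_ge0.
rewrite big_split/= -!mulr_sumr -!mulr_suml.
have h1 : (\sum_i b i `^ r) / B `^ r <= 1 by rewrite ler_pdivrMr// mul1r.
have h2 : (\sum_i a i `^ r) / A `^ r <= 1 by rewrite ler_pdivrMr// mul1r.
move: t01 => /andP[t0 t1]; have := ler_wpM2l (ltW t0) h1.
have s0 : 0 <= 1 - t by rewrite subr_ge0.
have := ler_wpM2l s0 h2; lra.
Qed.

(** Young's inequality for u_i = (s_i / S)^(r-2) (b_i / B)^2 and v_i = (s_i / S)^r,
    with the exponents r / 2 and 1 - r / 2: the left side is (b_i / B)^r, and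
    summing over i gives 1 <= (r / 2) sum_i u_i + (1 - r / 2). *)
Lemma reverse_hoelder_square (I : finType) (s b : I -> R) (S B r : R) : 1 <= r <= 2 ->
  0 < S -> 0 < B -> (forall i, 0 <= s i) -> (forall i, 0 <= b i) ->
  (forall i, s i = 0 -> b i = 0) ->
  \sum_i s i `^ r <= S `^ r -> B `^ r <= \sum_i b i `^ r ->
  S `^ (r - 2) * B ^+ 2 <= \sum_i s i `^ (r - 2) * b i ^+ 2.
Proof.
move=> /andP[r1 r2] S0 B0 s0 b0 sb sS bB; have r0 : 0 < r by lra.
have Sn : 0 < S `^ (r - 2) by exact: powR_gt0.
have Sr : 0 < S `^ r by exact: powR_gt0.
have Br : 0 < B `^ r by exact: powR_gt0.
have B2 : 0 < B ^+ 2 by exact: exprn_gt0.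
pose t := r / 2.
have t01 : 0 < t <= 1 by rewrite divr_gt0//= ler_pdivrMr// mul1r.
have t2 : 2 * t = r by rewrite /t; field.
pose u i := s i `^ (r - 2) * b i ^+ 2 / (S `^ (r - 2) * B ^+ 2).
pose v i := s i `^ r / S `^ r.
have u0 i : 0 <= u i.
  by apply: divr_ge0; apply: mulr_ge0; rewrite ?powR_ge0 ?sqr_ge0.
have v0 i : 0 <= v i by rewrite divr_ge0 ?powR_ge0.
have term i : b i `^ r / B `^ r <= t * u i + (1 - t) * v i.
  have := s0 i; rewrite le_eqVlt => /orP[/eqP si|si].
    rewrite (sb i (esym si)) powR0 ?gt_eqF// mul0r.
    by move: t01 => /andP[t0 t1]; have := u0 i; have := v0 i; nra.
  apply: le_trans (young_powR (u0 i) (v0 i) t01).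
  have bE z : 0 <= z -> (z ^+ 2) `^ t = z `^ r.
    by move=> z0; rewrite -powR_mulrn// -powRrM t2.
  have sE z : 0 < z -> (z `^ (r - 2)) `^ t * (z `^ r) `^ (1 - t) = 1.
    move=> z0; rewrite -!powRrM -powRD; last by rewrite (gt_eqF z0) implybT.
    rewrite (_ : _ + _ = 0) ?powRr0//.
    by rewrite -t2; ring.
  have uE : u i `^ t = (s i `^ (r - 2)) `^ t / (S `^ (r - 2)) `^ t * (b i `^ r / B `^ r).
    rewrite /u powR_div ?mulr_ge0 ?powR_ge0 ?sqr_ge0 ?mulr_gt0//.
    rewrite (powRM _ (powR_ge0 _ _) (sqr_ge0 (b i))) (powRM _ (powR_ge0 _ _) (sqr_ge0 B)).
    by rewrite !bE ?(ltW B0)// mulf_div.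
  have vE : v i `^ (1 - t) = (s i `^ r) `^ (1 - t) / (S `^ r) `^ (1 - t).
    by rewrite /v powR_div ?powR_ge0.
  have cancel (x1 x2 X1 X2 z : R) : x1 * x2 = 1 -> X1 * X2 = 1 ->
      x1 / X1 * z * (x2 / X2) = z.
    by move=> e1 e2; rewrite mulrAC mulf_div e1 e2 invr1 mulr1 mul1r.
  by rewrite uE vE (cancel _ _ _ _ _ (sE _ si) (sE _ S0)).
have : 1 <= t * \sum_i u i + (1 - t) * \sum_i v i.
  rewrite !mulr_sumr -big_split/=; apply: le_trans (ler_sum _ (fun i _ => term i)).
  by rewrite -mulr_suml ler_pdivlMr// mul1r.
have v1 : \sum_i v i <= 1 by rewrite /v -mulr_suml ler_pdivrMr// mul1r.
move: t01 => /andP[t0 t1]; have s1 : 0 <= 1 - t by rewrite subr_ge0.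
have := ler_wpM2l s1 v1 => le1 le2.
have : t * 1 <= t * \sum_i u i by lra.
rewrite ler_pM2l// /u -mulr_suml ler_pdivlMr ?mul1r//.
by rewrite mulr_gt0.
Qed.

End powers.

(** * Convexity and concavity of l_p, and the theorem *)

Section ell_convexity.
Context {R : realType} {k : scalars}.

Lemma level_norm_ell_pow r n (w : 'I_n -> R) : 1 <= r ->
  (level_norm (ell k r%:E) w) `^ r = \sum_i `|w i| `^ r.
Proof.
move=> r1; have r0 : 0 < r by lra.
have p1 : (1 <= r%:E)%E by rewrite lee_fin.
pose x i := of_real k (w i).
have xE i : modulus (x i) = `|w i| by rewrite modulus_of_real.
pose S := \sum_i `|w i| `^ r.
have S0 : 0 <= S by apply: sumr_ge0 => i _; exact: powR_ge0.
have [c0 cb] := carrier_ell p1 (space_ext (ell_ideal k p1) x).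
apply/eqP; rewrite eq_le; apply/andP; split.
  have : in_ball r%:E (S `^ r^-1) (ext x) by rewrite /S; under eq_bigr do rewrite -xE; exact: in_ball_ext_pow.
  move=> /(in_ball_ell p1 (powR_ge0 _ _))[_ le].
  apply: le_trans (_ : (S `^ r^-1) `^ r <= _).
    by rewrite ge0_ler_powR ?nnegrE ?powR_ge0// ltW.
  by rewrite -powRrM mulVf ?gt_eqF// powRr1.
have := cb n; rewrite big_mkord; apply: le_trans.
by apply: ler_sum => i _; rewrite ext_ord xE.
Qed.

Lemma quadratic_mean_sqr (I K : finType) (x : K -> I -> R) i :
  quadratic_mean x i ^+ 2 = \sum_k x k i ^+ 2.
Proof. exact: sqr_sqrt_sum. Qed.

Lemma quadratic_mean_eq0 (I K : finType) (x : K -> I -> R) i :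
  quadratic_mean x i = 0 -> forall j, x j i = 0.
Proof.
move=> q0 j; have /eqP := quadratic_mean_sqr x i; rewrite q0 expr0n eq_sym psumr_eq0.
  by move=> /allP/(_ j (mem_index_enum _)); rewrite sqrf_eq0 => /eqP.
by move=> l _; exact: sqr_ge0.
Qed.

(** Linearize at the quadratic mean q of the family: N(q)^r is the sum over the
    family of the pairings of q^(r-2) with |x_j|^2, and each pairing is at most
    N(q)^(r-2) N(x_j)^2. *)
Lemma ell_convex2 p n : (2%:E <= p)%E -> convex2 1 (@level_norm R k (ell k p) n).
Proof.
move=> p2; have p1 : (1 <= p)%E by apply: le_trans p2; rewrite lee_fin ler1n.
move=> K x; rewrite mul1r; set q := quadratic_mean x.
have q0 i : 0 <= q i by exact: sqrtr_ge0.
set N := @level_norm R k _ n.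
have iN : ideal_norm N := level_norm_ideal n (ell_ideal k p1).
case: p p1 p2 @N iN => [r| |]// p1 p2 N iN; last first.
  have cN (w : 'I_n -> R) i : `|w i| <= N w.
    have [_ /(_ i)] := carrier_ell p1 (space_ext (ell_ideal k p1) (fun i => of_real k (w i))).
    by rewrite ext_ord modulus_of_real.
  have c0 : 0 <= Num.sqrt (\sum_j N (x j) ^+ 2) by exact: sqrtr_ge0.
  apply: (in_ball_ell p1 c0 _).2 => i /=.
  case: (ltnP i n) => h; last by rewrite ext_ge// modulus0.
  rewrite -[ i ]/(val (Ordinal h)) ext_ord modulus_of_real ger0_norm//.
  rewrite ler_sqrt; last by rewrite sumr_ge0// => j _; exact: sqr_ge0.
  apply: ler_sum => j _; rewrite -real_normK ?num_real// ler_sqr ?nnegrE ?(ideal_norm_ge0 _ iN)//.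
have r2 : 2 <= r by rewrite -lee_fin.
have r1 : 1 <= r by lra.
have Nq0 := ideal_norm_ge0 q iN.
move: (Nq0); rewrite le_eqVlt => /orP[/eqP <-|A0]; first exact: sqrtr_ge0.
rewrite -[leLHS]ger0_norm// -sqrtr_sqr ler_sqrt; last first.
  by rewrite sumr_ge0// => j _; exact: sqr_ge0.
have An : 0 < N q `^ (r - 2) by exact: powR_gt0.
have split2 z : 0 <= z -> z `^ r = z `^ (r - 2) * z ^+ 2.
  move=> z0; rewrite -powR_mulrn// -powRD ?subrK//.
  by rewrite gt_eqF//; lra.
rewrite -(ler_pM2l An) -split2// level_norm_ell_pow//.
rewrite (eq_bigr (fun i => \sum_j q i `^ (r - 2) * `|x j i| ^+ 2)); last first.
  move=> i _; rewrite ger0_norm// split2// quadratic_mean_sqr mulr_sumr.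
  by apply: eq_bigr => j _; rewrite real_normK ?num_real.
rewrite exchange_big mulr_sumr; apply: ler_sum => j _ /=.
have := ideal_norm_ge0 (x j) iN; rewrite le_eqVlt => /orP[/eqP B0|B0].
  rewrite big1 => [|i _]; first by rewrite mulr_ge0 ?(ltW An) ?sqr_ge0.
  have := ideal_norm_coord (x j) i iN; rewrite -B0 pmulr_lle0 ?(ideal_unit iN)//.
  by rewrite normr_le0 => /eqP ->; rewrite normr0 expr0n mulr0.
apply: hoelder_square => //; last by rewrite level_norm_ell_pow.
by rewrite level_norm_ell_pow//; apply: ler_sum => i _; rewrite ger0_norm.
Qed.

(** The same linearization at q, with the reverse inequality between N(x_j)^2 and
    its pairing with q^(r-2), valid for r <= 2. *)
Lemma ell_concave2 p n : (1 <= p)%E -> (p <= 2%:E)%E ->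
  concave2 1 (@level_norm R k (ell k p) n).
Proof.
move=> p1 p2 K x; rewrite mul1r; set q := quadratic_mean x.
have q0 i : 0 <= q i by exact: sqrtr_ge0.
set N := @level_norm R k _ n.
have iN : ideal_norm N := level_norm_ideal n (ell_ideal k p1).
case: p p1 p2 @N iN => [r| |]// p1 p2 N iN.
have r2 : 2 >= r by rewrite -lee_fin.
have r1 : 1 <= r by rewrite -lee_fin.
have Nq0 := ideal_norm_ge0 q iN.
rewrite -[leRHS]ger0_norm// -sqrtr_sqr ler_sqrt ?sqr_ge0//.
move: (Nq0); rewrite le_eqVlt => /orP[/eqP A0|A0].
  rewrite big1 ?sqr_ge0// => j _; rewrite (_ : x j = fun=> 0) ?ideal_norm0 ?expr0n//.
  apply/funext => i; apply: quadratic_mean_eq0; rewrite -/q.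
  have := ideal_norm_coord q i iN; rewrite -A0 pmulr_lle0 ?(ideal_unit iN)//.
  by rewrite normr_le0 => /eqP.
have An : 0 < N q `^ (r - 2) by exact: powR_gt0.
have split2 z : 0 <= z -> z `^ r = z `^ (r - 2) * z ^+ 2.
  move=> z0; rewrite -powR_mulrn// -powRD ?subrK//.
  by rewrite gt_eqF//; lra.
rewrite -(ler_pM2l An) -split2// level_norm_ell_pow//.
rewrite [leRHS](eq_bigr (fun i => \sum_j q i `^ (r - 2) * `|x j i| ^+ 2)); last first.
  move=> i _; rewrite ger0_norm// split2// quadratic_mean_sqr mulr_sumr.
  by apply: eq_bigr => j _; rewrite real_normK ?num_real.
rewrite exchange_big mulr_sumr; apply: ler_sum => j _ /=.
have := ideal_norm_ge0 (x j) iN; rewrite le_eqVlt => /orP[/eqP B0|B0].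
  rewrite -B0 expr0n mulr0 sumr_ge0// => i _.
  by rewrite mulr_ge0 ?powR_ge0 ?sqr_ge0.
apply: reverse_hoelder_square => //.
- by rewrite r1.
- by move=> i /quadratic_mean_eq0 ->; rewrite normr0.
- by rewrite level_norm_ell_pow//; apply: ler_sum => i _; rewrite ger0_norm.
- by rewrite level_norm_ell_pow.
Qed.

End ell_convexity.

Theorem theorem4p16 (R : realType) (k : scalars) (E F : seq_space R k)
    (p q : \bar R) :
  symmetric_space E -> symmetric_space F ->
  two_convex E -> two_concave F ->
  (1 <= q)%E -> (q <= 2%:E)%E -> (2%:E <= p)%E -> (p <= +oo)%E ->
  schur_multipliers E F = schur_multipliers (ell k p) (ell k q).
Proof.
move=> sE sF cE cF q1 q2 p2 _; apply/predeqP => M.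
have p1 : (1 <= p)%E by apply: le_trans p2; rewrite lee_fin ler1n.
have iE := symmetric_ideal sE; have fF := symmetric_fatou sF cF.
have [C C0 EC] := two_convex_level iE cE.
have [D D0 FD] := two_concave_level (fatou_ideal fF) cF.
rewrite (schur_multipliersP M iE fF C0 D0 EC FD).
rewrite (schur_multipliersP M (ell_ideal k p1) (ell_fatou k q1) ltr01 ltr01)//.
- by move=> n; exact: ell_convex2.
- by move=> n; exact: ell_concave2.
Qed.
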